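(* Let $1\le p<\infty$ and let $g_1,g_2\in\mathrm{BMOA}$ be non-constant and locally univalent in $\mathbb{D}$. The following are equivalent: (a) $[T_{g_1},H^p]=[T_{g_2},H^p]$; (b) there exist two functions $k_1,k_2\in H^\infty$ such that $g_1=T_{g_2}(k_1)+g_1(0)$ and $g_2=T_{g_1}(k_2)+g_2(0)$. Moreover, in this case $k_2=\frac{1}{k_1}$.
   Context: $\mathbb{D}$ is the open unit disc of $\mathbb{C}$; $\mathrm{Hol}(\mathbb{D})$ is the set of holomorphic functions on $\mathbb{D}$. $H^p$ ($0<p<\infty$) is the Hardy space of $f\in\mathrm{Hol}(\mathbb{D})$ with $\|f\|_{H^p}^p=\sup_{0\le r<1}\int_0^{2\pi}|f(re^{it})|^p\frac{dt}{2\pi}<\infty$; $H^\infty$ is the space of bounded holomorphic functions on $\mathbb{D}$. $\mathrm{BMOA}$ consists of all $f\in H^2$ with $\|f\|_*:=\sup_{a\in\mathbb{D}}\|f\circ\varphi_a-f(a)\|_{H^2}<\infty$, where $\varphi_a(z)=\frac{z-a}{1-\overline{a}z}$. A function $g\in\mathrm{Hol}(\mathbb{D})$ is locally univalent if and only if $g'$ never vanishes in $\mathbb{D}$. For $g,f\in\mathrm{Hol}(\mathbb{D})$, $T_g(f)(z)=\int_0^z f(\zeta)g'(\zeta)\,d\zeta$. The holomorphic optimal domain is $[T_g,H^p]=\{f\in\mathrm{Hol}(\mathbb{D}): T_g(f)\in H^p\}$. Equality in (a) is equality of sets. *)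

(* Defs.v *)
From Stdlib Require Import Reals.
From Coquelicot Require Import Coquelicot.
Open Scope R_scope.

Definition unit_disc (z : C) : Prop := Cmod z < 1.

(* A function on the disc is represented by a total function C -> C of which
   only the values on the disc matter. *)
Definition holomorphic (f : C -> C) : Prop :=
  forall z : C, unit_disc z -> ex_derive (K := C_AbsRing) (V := C_NormedModule) f z.

(* x ^ p for x >= 0 and p > 0; [Rpower 0 p] is 1 in Stdlib, hence the case
   distinction. *)
Definition rpow (x p : R) : R :=
  if Req_EM_T x 0 then 0 else Rpower x p.

Definition circle_pt (r t : R) : C := (r * cos t, r * sin t).

Definition integral_mean (p : R) (f : C -> C) (r : R) : R :=
  RInt (fun t => rpow (Cmod (f (circle_pt r t))) p / (2 * PI)) 0 (2 * PI).

(* The p-th power of the H^p norm, possibly infinite. *)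
Definition hardy_normp (p : R) (f : C -> C) : Rbar :=
  Lub_Rbar (fun x => exists r : R, 0 <= r < 1 /\ x = integral_mean p f r).

Definition hardy_norm (p : R) (f : C -> C) : Rbar :=
  match hardy_normp p f with
  | Finite x => Finite (rpow x (/ p))
  | p_infty => p_infty
  | m_infty => m_infty
  end.

Definition hardy (p : R) (f : C -> C) : Prop :=
  holomorphic f /\ Rbar_lt (hardy_normp p f) p_infty.

Definition hardy_infty (f : C -> C) : Prop :=
  holomorphic f /\ exists M : R, forall z : C, unit_disc z -> Cmod (f z) <= M.

(* The automorphism of the disc exchanging 0 and a.  The sign matters: since
   [mobius a 0 = a], the function [f o mobius a - f a] below vanishes at 0, and
   [BMOA] is the usual space of analytic functions of bounded mean oscillation.
   With the opposite sign z - a in the numerator one would have to subtract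
   [f (- a)] instead. *)
Definition mobius (a z : C) : C := ((a - z) / (1 - Cconj a * z))%C.

Definition bmoa_norm (f : C -> C) : Rbar :=
  Rbar_lub (fun y => exists a : C, unit_disc a /\
    y = hardy_norm 2 (fun z => (f (mobius a z) - f a)%C)).

Definition BMOA (f : C -> C) : Prop :=
  hardy 2 f /\ Rbar_lt (bmoa_norm f) p_infty.

Definition nonconstant (g : C -> C) : Prop :=
  exists z w : C, unit_disc z /\ unit_disc w /\ g z <> g w.

Definition locally_univalent (g : C -> C) : Prop :=
  holomorphic g /\ forall z : C, unit_disc z -> C_derive g z <> 0%C.

(* The integral from 0 to z is taken along the segment s |-> s z, s in [0, 1]. *)
Definition T (g f : C -> C) (z : C) : C :=
  RInt (V := C_R_CompleteNormedModule)
    (fun s : R => (f (s * z) * C_derive g (s * z) * z)%C) 0 1.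

Definition optimal_domain (g : C -> C) (p : R) (f : C -> C) : Prop :=
  holomorphic f /\ hardy p (T g f).

(* Main.v *)
Require Import Defs.
From Stdlib Require Import Reals Lra Lia Classical IndefiniteDescription.
From Coquelicot Require Import Coquelicot.
Open Scope R_scope.

(* T_{g1} f ranges over the functions F of H^p with F(0) = 0, and T_{g2} f is
   then the primitive of k F' with k = g2'/g1'.  So everything reduces to the
   statement that F |-> int k F' preserves H^p exactly when k is bounded.

   If |k| <= M then G = int k F' satisfies |G'| <= |M F'|.  Following
   Burkholder, one looks for a function u(|F|^2, |G|^2) that is superharmonic
   for every such pair and dominates a multiple of |G|^p minus a multiple of
   (1 + |F|^2)^(p/2); the decrease of its circular means bounds those of |G|^p.
   With s = p/2, a = |F|^2, b = |G|^2 one can take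
     (1+a+b)^s - (2/s) (1+a)^s                       if s <= 1,
     (1+b)^s - A a (1+b)^(s-1) - B (1+a)^s           if s >= 1.

   Conversely, Cauchy's formula gives |h'(a)| <= K (1-|a|)^(-1-1/p) for h in H^p,
   and a gliding hump argument with the normalised functions z / (1 - conj(a) z)^2
   shows that k is bounded.  Goursat's theorem and Cauchy's formula are needed
   because holomorphy is just pointwise complex differentiability. *)

(** * Complex derivatives, continuity and integrals *)

(** That a bounded k preserves H^p is classically read off from a square function or a nontangential
    maximal function. A superharmonic majorant replaces both by one pointwise inequality and
    calculus in one real variable. The summand 1 in every power keeps u smooth at the zeros of F and
    G. The negative terms pay for the positive Laplacian of the leading one. For s <= 1 a power of
    1+a is enough, because the exponent s-1 makes (1+a+b)^(s-1) decrease in b. For s > 1 the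
    corresponding power grows with b and no function of a alone can pay: a (1+b)^(s-1) pays where b
    is large compared with a, and (1+a)^s pays elsewhere. In the converse, an explicit series takes
    the place of the closed graph theorem, so neither completeness of H^p nor a norm on the optimal
    domain is needed. The test functions are calibrated on their derivatives, since k multiplies F'
    and not F. Local univalence makes F'/g1' holomorphic, so that all of H^p is available for
    testing. *)

Notation is_cderive f z l :=
  (is_derive (K := C_AbsRing) (V := C_NormedModule) f z l).
Notation is_curve_derive c t l :=
  (is_derive (K := R_AbsRing) (V := C_R_NormedModule) c t l).
Notation CInt f a b := (RInt (V := C_R_CompleteNormedModule) f a b).
Notation continuous_Rplus := (continuous_plus (V := R_NormedModule)).
Notation continuous_Rmult := (continuous_mult (K := R_AbsRing)).
Notation is_RInt_Rplus := (is_RInt_plus (V := R_NormedModule)).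
Notation is_RInt_Rscal := (is_RInt_scal (V := R_NormedModule)).
Notation is_RInt_Rconst := (is_RInt_const (V := R_NormedModule)).
Notation RInt_Rcorrect := (RInt_correct (V := R_CompleteNormedModule)).
Notation CInt_correct := (RInt_correct (V := C_R_CompleteNormedModule)).
Notation ex_RInt_Rcontinuous := (ex_RInt_continuous (V := R_CompleteNormedModule)).
Notation ex_derive_Rcontinuous :=
  (ex_derive_continuous (K := R_AbsRing) (V := R_NormedModule)).
Notation ex_CInt f a b := (ex_RInt (V := C_R_NormedModule) f a b).

Ltac cring := match goal with |- @eq _ ?a ?b => change (@eq C a b) end; ring.
Ltac cfield := match goal with |- @eq _ ?a ?b => change (@eq C a b) end; field.

Lemma Cmod_le_abs (z : C) : Cmod z <= Rabs (fst z) + Rabs (snd z).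
Proof.
  destruct z as [x y]; simpl.
  replace (x, y) with (RtoC x + Ci * RtoC y)%C
    by (unfold RtoC, Ci, Cplus, Cmult; simpl; f_equal; ring).
  eapply Rle_trans; [apply Cmod_triangle|].
  rewrite Cmod_mult, Cmod_Ci, !Cmod_R; lra.
Qed.

Lemma Rabs_fst_le_Cmod (z : C) : Rabs (fst z) <= Cmod z.
Proof. eapply Rle_trans; [apply Rmax_l|apply Rmax_Cmod]. Qed.

Lemma Rabs_snd_le_Cmod (z : C) : Rabs (snd z) <= Cmod z.
Proof. eapply Rle_trans; [apply Rmax_r|apply Rmax_Cmod]. Qed.

Lemma Cmod_triangle_inv (z w : C) : Cmod z - Cmod w <= Cmod (z - w).
Proof.
  assert (H := Cmod_triangle (z - w) w).
  replace (z - w + w)%C with z in H by cring. lra.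
Qed.

Lemma Cmod_minus_sym (z w : C) : Cmod (z - w) = Cmod (w - z).
Proof. rewrite <- Cmod_opp. apply f_equal. cring. Qed.

Lemma Cmod_minus_triangle (z w : C) : Cmod (z - w) <= Cmod z + Cmod w.
Proof.
  rewrite <- (Cmod_opp w). apply Cmod_triangle.
Qed.

Lemma locally_C_eps (z : C) (P : C -> Prop) :
  locally (T := C_UniformSpace) z P <->
  exists d, 0 < d /\ forall w, Cmod (w - z) < d -> P w.
Proof.
  rewrite locally_C; split.
  - intros [d Hd]; exists d; split; [apply cond_pos|].
    intros w Hw; apply Hd; exact Hw.
  - intros [d [Hd Hw]]; exists (mkposreal d Hd).
    intros w H; apply Hw; exact H.
Qed.

Lemma is_cderive_eps (f : C -> C) (z l : C) :
  is_cderive f z l <->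
  forall eps, 0 < eps -> exists d, 0 < d /\ forall w, Cmod (w - z) < d ->
    Cmod (f w - f z - (w - z) * l) <= eps * Cmod (w - z).
Proof.
  split.
  - intros [_ H] eps Heps.
    assert (Hz : is_filter_lim (locally (T := AbsRing_UniformSpace C_AbsRing) z) z)
      by (intros P HP; exact HP).
    specialize (H z Hz (mkposreal eps Heps)).
    apply locally_C, locally_C_eps in H. exact H.
  - intros H; split; [apply is_linear_scal_l|].
    intros x Hx.
    apply (is_filter_lim_locally_unique (V := AbsRing_NormedModule C_AbsRing)) in Hx.
    subst x. intros eps.
    apply locally_C, locally_C_eps.
    exact (H eps (cond_pos eps)).
Qed.

Lemma is_curve_derive_eps (c : R -> C) (t : R) (l : C) :
  is_curve_derive c t l <->
  forall eps, 0 < eps -> exists d, 0 < d /\ forall s, Rabs (s - t) < d ->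
    Cmod (c s - c t - RtoC (s - t) * l) <= eps * Rabs (s - t).
Proof.
  assert (Hn : forall s, Cmod (c s - c t - RtoC (s - t) * l) =
    norm (V := C_R_NormedModule) (minus (minus (c s) (c t)) (scal (minus s t) l))).
  { intros s. rewrite Cmod_norm. apply f_equal.
    destruct (c s), (c t), l. apply injective_projections; simpl;
    unfold scal; simpl; unfold mult; simpl; unfold plus, opp, minus; simpl; unfold plus, opp; simpl; ring. }
  split.
  - intros [_ H] eps Heps.
    assert (Hz : is_filter_lim (locally (T := R_UniformSpace) t) t)
      by (intros P HP; exact HP).
    specialize (H t Hz (mkposreal eps Heps)).
    destruct H as [d Hd]; exists d; split; [apply cond_pos|].
    intros s Hs. rewrite Hn. apply (Hd s). exact Hs.
  - intros H; split; [apply is_linear_scal_l|].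
    intros x Hx.
    apply (is_filter_lim_locally_unique (V := R_NormedModule)) in Hx.
    subst x. intros eps.
    destruct (H eps (cond_pos eps)) as [d [Hd H']].
    exists (mkposreal d Hd). intros s Hs.
    specialize (H' s Hs). rewrite Hn in H'. exact H'.
Qed.

Lemma is_curve_derive_pair (c : R -> C) (t : R) (l : C) :
  is_derive (fun s => fst (c s)) t (fst l) ->
  is_derive (fun s => snd (c s)) t (snd l) ->
  is_curve_derive c t l.
Proof.
  intros [_ H1] [_ H2]. apply is_curve_derive_eps; intros eps He.
  assert (Hz : is_filter_lim (locally (T := R_UniformSpace) t) t)
      by (intros P HP; exact HP).
  assert (He2 : 0 < eps / 2) by lra.
  destruct (H1 t Hz (mkposreal _ He2)) as [d1 Hd1].
  destruct (H2 t Hz (mkposreal _ He2)) as [d2 Hd2].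
  exists (Rmin d1 d2); split; [apply Rmin_pos; apply cond_pos|].
  intros s Hs.
  specialize (Hd1 s (Rlt_le_trans _ _ _ Hs (Rmin_l _ _))).
  specialize (Hd2 s (Rlt_le_trans _ _ _ Hs (Rmin_r _ _))).
  eapply Rle_trans; [apply Cmod_le_abs|].
  unfold norm, abs, minus, plus, opp, scal, mult in Hd1, Hd2; simpl in Hd1, Hd2.
  unfold mult in Hd1, Hd2; simpl in Hd1, Hd2. unfold abs in Hd1, Hd2; simpl in Hd1, Hd2.
  destruct (c s), (c t), l; simpl in *.
  match goal with |- Rabs ?x + Rabs ?y <= _ =>
  match type of Hd1 with Rabs ?x' <= ?b => replace x with x' by ring;
  match type of Hd2 with Rabs ?y' <= _ => replace y with y' by ring end end end.
  unfold Rminus. lra.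
Qed.

Lemma is_curve_derive_coordinate (pi : C -> R) (c : R -> C) (t : R) (l : C) :
  (forall z, Rabs (pi z) <= Cmod z) ->
  (forall s, pi (c s - c t - RtoC (s - t) * l)%C = pi (c s) - pi (c t) - (s - t) * pi l) ->
  is_curve_derive c t l -> is_derive (fun s => pi (c s)) t (pi l).
Proof.
  intros Hpi Hlin H. split; [apply is_linear_scal_l|].
  intros x Hx. apply (is_filter_lim_locally_unique (V := R_NormedModule)) in Hx.
  subst x. intros eps.
  destruct (proj1 (is_curve_derive_eps c t l) H eps (cond_pos eps)) as [d [Hd H']].
  exists (mkposreal d Hd). intros s Hs.
  eapply Rle_trans; [|apply (H' s Hs)].
  eapply Rle_trans; [|apply Hpi]. right. rewrite Hlin. reflexivity.
Qed.

Lemma is_curve_derive_fst (c : R -> C) (t : R) (l : C) :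
  is_curve_derive c t l -> is_derive (fun s => fst (c s)) t (fst l).
Proof.
  apply (is_curve_derive_coordinate fst); [apply Rabs_fst_le_Cmod|intros s; simpl; ring].
Qed.

Lemma is_curve_derive_snd (c : R -> C) (t : R) (l : C) :
  is_curve_derive c t l -> is_derive (fun s => snd (c s)) t (snd l).
Proof.
  apply (is_curve_derive_coordinate snd); [apply Rabs_snd_le_Cmod|intros s; simpl; ring].
Qed.

(** The inner derivative is over the reals and the outer one over the complex numbers, so the chain
    rule is obtained directly from the two linear approximations. *)
Lemma is_curve_derive_comp (f : C -> C) (c : R -> C) (t : R) (l c' : C) :
  is_cderive f (c t) l -> is_curve_derive c t c' ->
  is_curve_derive (fun s => f (c s)) t (c' * l)%C.
Proof.
  intros Hf Hc. apply is_curve_derive_eps; intros eps He.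
  rewrite is_cderive_eps in Hf. rewrite is_curve_derive_eps in Hc.
  set (K := Cmod c' + 1). set (L := Cmod l + 1).
  assert (HK : 1 <= K) by (unfold K; generalize (Cmod_ge_0 c'); lra).
  assert (HL : 1 <= L) by (unfold L; generalize (Cmod_ge_0 l); lra).
  assert (e1 : 0 < eps / (2 * K)) by (apply Rdiv_lt_0_compat; lra).
  (* The bound 1 makes [c] Lipschitz with constant [K] near [t]; the second bound pays for the error
     of [c] after multiplication by [l]. *)
  assert (e2 : 0 < Rmin 1 (eps / (2 * L)))
    by (apply Rmin_pos; [lra|apply Rdiv_lt_0_compat; lra]).
  destruct (Hf _ e1) as [d1 [Hd1 H1]].
  destruct (Hc _ e2) as [d2 [Hd2 H2]].
  exists (Rmin d2 (d1 / K)); split.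
  { apply Rmin_pos; [lra|apply Rdiv_lt_0_compat; lra]. }
  intros s Hs.
  specialize (H2 s (Rlt_le_trans _ _ _ Hs (Rmin_l _ _))).
  assert (Hs' : Rabs (s - t) < d1 / K) by (eapply Rlt_le_trans; [exact Hs|apply Rmin_r]).
  assert (Hcs : Cmod (c s - c t) <= K * Rabs (s - t)).
  { replace (c s - c t)%C with ((c s - c t - RtoC (s - t) * c') + RtoC (s - t) * c')%C by cring.
    eapply Rle_trans; [apply Cmod_triangle|].
    rewrite Cmod_mult, Cmod_R.
    assert (Hm := Rmin_l 1 (eps / (2 * L))).
    unfold K. generalize (Rabs_pos (s - t)) (Cmod_ge_0 c'); intros.
    assert (Rmin 1 (eps / (2 * L)) * Rabs (s - t) <= 1 * Rabs (s - t))
      by (apply Rmult_le_compat_r; lra). lra. }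
  assert (Hlt : Cmod (c s - c t) < d1).
  { eapply Rle_lt_trans; [exact Hcs|].
    apply Rmult_lt_reg_r with (/ K); [apply Rinv_0_lt_compat; lra|].
    replace (K * Rabs (s - t) * / K) with (Rabs (s - t)) by (field; lra). exact Hs'. }
  specialize (H1 _ Hlt).
  replace (f (c s) - f (c t) - RtoC (s - t) * (c' * l))%C with
    ((f (c s) - f (c t) - (c s - c t) * l) + (c s - c t - RtoC (s - t) * c') * l)%C by cring.
  eapply Rle_trans; [apply Cmod_triangle|]. rewrite Cmod_mult.
  generalize (Rabs_pos (s - t)); intros Hp.
  assert (A : eps / (2 * K) * Cmod (c s - c t) <= eps / 2 * Rabs (s - t)).
  { eapply Rle_trans; [apply Rmult_le_compat_l; [lra|exact Hcs]|].
    right; field; lra. }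
  assert (B : Cmod (c s - c t - RtoC (s - t) * c') * Cmod l <= eps / 2 * Rabs (s - t)).
  { assert (Hm := Rmin_r 1 (eps / (2 * L))).
    apply Rle_trans with ((eps / (2 * L) * Rabs (s - t)) * L).
    - apply Rmult_le_compat; [apply Cmod_ge_0|apply Cmod_ge_0| |unfold L; lra].
      eapply Rle_trans; [exact H2|]. apply Rmult_le_compat_r; lra.
    - right; field; lra. }
  lra.
Qed.

Notation Ccontinuous f x := (continuous (U := C_UniformSpace) f x).

Lemma Ccontinuous_eps {T : UniformSpace} (f : T -> C) (x : T) :
  Ccontinuous f x <->
  forall eps, 0 < eps -> locally x (fun y => Cmod (f y - f x) < eps).
Proof.
  split.
  - intros H eps He. apply (H (fun w => Cmod (w - f x) < eps)).
    apply locally_C_eps. exists eps; split; [exact He|]. intros w Hw; exact Hw.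
  - intros H P HP. apply locally_C_eps in HP. destruct HP as [d [Hd HP]].
    unfold filtermap. generalize (H d Hd). apply filter_imp.
    intros y Hy. apply HP, Hy.
Qed.

Lemma Ccontinuous_pair {T : UniformSpace} (f : T -> C) (x : T) :
  continuous (fun y => fst (f y)) x -> continuous (fun y => snd (f y)) x ->
  Ccontinuous f x.
Proof.
  intros H1 H2. apply Ccontinuous_eps; intros eps He.
  assert (He2 : 0 < eps / 2) by lra.
  specialize (H1 _ (locally_ball _ (mkposreal _ He2))).
  specialize (H2 _ (locally_ball _ (mkposreal _ He2))).
  unfold filtermap in H1, H2.
  generalize (filter_and _ _ H1 H2). apply filter_imp.
  intros y [Hy1 Hy2]. eapply Rle_lt_trans; [apply Cmod_le_abs|].
  change (Rabs (fst (f y) - fst (f x)) < eps / 2) in Hy1.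
  change (Rabs (snd (f y) - snd (f x)) < eps / 2) in Hy2.
  simpl. unfold Rminus in *. lra.
Qed.

Lemma Ccontinuous_fst {T : UniformSpace} (f : T -> C) (x : T) :
  Ccontinuous f x -> continuous (fun y => fst (f y)) x.
Proof.
  intros H. apply (continuous_comp f fst); [exact H|]. apply continuous_fst.
Qed.

Lemma Ccontinuous_snd {T : UniformSpace} (f : T -> C) (x : T) :
  Ccontinuous f x -> continuous (fun y => snd (f y)) x.
Proof.
  intros H. apply (continuous_comp f snd); [exact H|]. apply continuous_snd.
Qed.

Lemma Ccontinuous_plus {T : UniformSpace} (f g : T -> C) (x : T) :
  Ccontinuous f x -> Ccontinuous g x -> Ccontinuous (fun y => f y + g y)%C x.
Proof.
  intros Hf Hg. apply Ccontinuous_pair; simpl.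
  - apply continuous_Rplus; apply Ccontinuous_fst; assumption.
  - apply continuous_Rplus; apply Ccontinuous_snd; assumption.
Qed.

Lemma Ccontinuous_opp {T : UniformSpace} (f : T -> C) (x : T) :
  Ccontinuous f x -> Ccontinuous (fun y => - f y)%C x.
Proof.
  intros Hf. apply Ccontinuous_pair; simpl.
  - apply (continuous_opp (V := R_NormedModule)); apply Ccontinuous_fst; assumption.
  - apply (continuous_opp (V := R_NormedModule)); apply Ccontinuous_snd; assumption.
Qed.

Lemma Ccontinuous_minus {T : UniformSpace} (f g : T -> C) (x : T) :
  Ccontinuous f x -> Ccontinuous g x -> Ccontinuous (fun y => f y - g y)%C x.
Proof. intros. apply Ccontinuous_plus; [|apply Ccontinuous_opp]; assumption. Qed.

Lemma Ccontinuous_mult {T : UniformSpace} (f g : T -> C) (x : T) :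
  Ccontinuous f x -> Ccontinuous g x -> Ccontinuous (fun y => f y * g y)%C x.
Proof.
  intros Hf Hg.
  assert (Hf1 := Ccontinuous_fst _ _ Hf). assert (Hf2 := Ccontinuous_snd _ _ Hf).
  assert (Hg1 := Ccontinuous_fst _ _ Hg). assert (Hg2 := Ccontinuous_snd _ _ Hg).
  apply Ccontinuous_pair; simpl.
  - apply (continuous_minus (V := R_NormedModule));
      apply continuous_Rmult; assumption.
  - apply continuous_Rplus;
      apply continuous_Rmult; assumption.
Qed.

Lemma Ccontinuous_Cmod {T : UniformSpace} (f : T -> C) (x : T) :
  Ccontinuous f x -> continuous (fun y => Cmod (f y)) x.
Proof.
  intros H P [d HP]. unfold filtermap.
  generalize (proj1 (Ccontinuous_eps f x) H d (cond_pos d)). apply filter_imp.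
  intros y Hy. apply HP. change (Rabs (Cmod (f y) - Cmod (f x)) < d).
  apply Rabs_def1.
  - eapply Rle_lt_trans; [apply Cmod_triangle_inv|exact Hy].
  - assert (H' := Cmod_triangle_inv (f x) (f y)). rewrite Cmod_minus_sym in H'. lra.
Qed.

Lemma Ccontinuous_inv {T : UniformSpace} (f : T -> C) (x : T) :
  Ccontinuous f x -> f x <> 0%C -> Ccontinuous (fun y => / f y)%C x.
Proof.
  intros Hf H0.
  assert (Hf1 := Ccontinuous_fst _ _ Hf). assert (Hf2 := Ccontinuous_snd _ _ Hf).
  assert (Hp : fst (f x) ^ 2 + snd (f x) ^ 2 <> 0).
  { intros E. apply H0, Cmod_eq_0. unfold Cmod. rewrite E, sqrt_0. reflexivity. }
  assert (Hi : continuous (fun y => / (fst (f y) ^ 2 + snd (f y) ^ 2)) x).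
  { apply (continuous_comp (fun y => fst (f y) ^ 2 + snd (f y) ^ 2) Rinv).
    - simpl. apply continuous_Rplus;
      repeat apply continuous_Rmult; try assumption; apply continuous_const.
    - apply continuous_Rinv. exact Hp. }
  apply Ccontinuous_pair; unfold Cinv; cbn [fst snd]; unfold Rdiv;
    apply continuous_Rmult; try assumption.
  apply (continuous_opp (V := R_NormedModule)); assumption.
Qed.

Lemma Ccontinuous_RtoC {T : UniformSpace} (f : T -> R) (x : T) :
  continuous f x -> Ccontinuous (fun y => RtoC (f y)) x.
Proof.
  intros H. apply Ccontinuous_pair; simpl; [exact H|apply continuous_const].
Qed.

Lemma is_cderive_continuous (f : C -> C) (z l : C) :
  is_cderive f z l -> Ccontinuous f z.
Proof.
  intros H. apply Ccontinuous_eps; intros eps He.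
  destruct (proj1 (is_cderive_eps f z l) H 1 Rlt_0_1) as [d [Hd H']].
  apply locally_C_eps.
  set (K := Cmod l + 1).
  assert (HK : 1 <= K) by (unfold K; generalize (Cmod_ge_0 l); lra).
  exists (Rmin d (eps / K)); split.
  { apply Rmin_pos; [lra|apply Rdiv_lt_0_compat; lra]. }
  intros w Hw.
  specialize (H' w (Rlt_le_trans _ _ _ Hw (Rmin_l _ _))).
  assert (Hw2 := Rlt_le_trans _ _ _ Hw (Rmin_r _ _)).
  replace (f w - f z)%C with ((f w - f z - (w - z) * l) + (w - z) * l)%C by cring.
  eapply Rle_lt_trans; [apply Cmod_triangle|]. rewrite Cmod_mult.
  apply Rle_lt_trans with (K * Cmod (w - z)).
  { unfold K. lra. }
  apply Rmult_lt_reg_r with (/ K); [apply Rinv_0_lt_compat; lra|].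
  replace (K * Cmod (w - z) * / K) with (Cmod (w - z)) by (field; lra). exact Hw2.
Qed.

Lemma is_cderive_ext_loc (f g : C -> C) (z l : C) :
  (exists d, 0 < d /\ forall w, Cmod (w - z) < d -> f w = g w) ->
  is_cderive f z l -> is_cderive g z l.
Proof.
  intros [d [Hd He]] H. apply is_cderive_eps; intros eps Heps.
  destruct (proj1 (is_cderive_eps f z l) H eps Heps) as [d' [Hd' H']].
  exists (Rmin d d'); split; [apply Rmin_pos; assumption|]. intros w Hw.
  rewrite <- He by (eapply Rlt_le_trans; [exact Hw|apply Rmin_l]).
  rewrite <- (He z).
  - apply H'. eapply Rlt_le_trans; [exact Hw|apply Rmin_r].
  - replace (z - z)%C with (RtoC 0) by cring. rewrite Cmod_0. exact Hd.
Qed.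

(* Coquelicot's [AbsRing_NormedModule C_AbsRing] and [C_NormedModule] carry
   different uniform structures. *)
Lemma is_cderive_AbsRing (f : C -> C) (z l : C) :
  is_derive (K := C_AbsRing) (V := AbsRing_NormedModule C_AbsRing) f z l <->
  is_cderive f z l.
Proof.
  split; intros [_ H]; (split; [apply is_linear_scal_l|exact H]).
Qed.

Lemma is_cderive_const (c z : C) : is_cderive (fun _ => c) z (RtoC 0).
Proof. apply (is_derive_const (K := C_AbsRing) (V := C_NormedModule) c z). Qed.

Lemma is_cderive_id (z : C) : is_cderive (fun w => w) z (RtoC 1).
Proof. apply is_cderive_AbsRing, (is_derive_id (K := C_AbsRing) z). Qed.

Lemma is_cderive_plus (f g : C -> C) (z a b : C) :
  is_cderive f z a -> is_cderive g z b -> is_cderive (fun w => f w + g w)%C z (a + b)%C.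
Proof. apply (is_derive_plus (K := C_AbsRing) (V := C_NormedModule)). Qed.

Lemma is_cderive_opp (f : C -> C) (z a : C) :
  is_cderive f z a -> is_cderive (fun w => - f w)%C z (- a)%C.
Proof. apply (is_derive_opp (K := C_AbsRing) (V := C_NormedModule)). Qed.

Lemma is_cderive_minus (f g : C -> C) (z a b : C) :
  is_cderive f z a -> is_cderive g z b -> is_cderive (fun w => f w - g w)%C z (a - b)%C.
Proof. apply (is_derive_minus (K := C_AbsRing) (V := C_NormedModule)). Qed.

Lemma is_cderive_mult (f g : C -> C) (z a b : C) :
  is_cderive f z a -> is_cderive g z b ->
  is_cderive (fun w => f w * g w)%C z (a * g z + f z * b)%C.
Proof.
  rewrite <- !is_cderive_AbsRing. intros Hf Hg.
  apply (is_derive_mult (K := C_AbsRing) f g z a b Hf Hg).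
  intros n m. apply Cmult_comm.
Qed.

Lemma is_cderive_comp (f g : C -> C) (z a b : C) :
  is_cderive f (g z) a -> is_cderive g z b ->
  is_cderive (fun w => f (g w)) z (b * a)%C.
Proof.
  intros Hf Hg. apply (is_derive_comp (K := C_AbsRing) (V := C_NormedModule) f g z a b Hf).
  apply is_cderive_AbsRing, Hg.
Qed.

Lemma is_cderive_inv_id (z : C) :
  z <> RtoC 0 -> is_cderive (fun w => / w)%C z (- / (z * z))%C.
Proof.
  intros Hz. assert (Hm := proj1 (Cmod_gt_0 z) Hz).
  apply is_cderive_eps; intros eps He.
  assert (Hc := Ccontinuous_inv (fun w => w) z (continuous_id z) Hz).
  destruct (proj1 (locally_C_eps _ _) (proj1 (Ccontinuous_eps _ z) Hc (eps * Cmod z)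
    ltac:(apply Rmult_lt_0_compat; assumption))) as [d [Hd H]].
  exists (Rmin d (Cmod z)). split; [apply Rmin_pos; assumption|]. intros w Hw.
  specialize (H w (Rlt_le_trans _ _ _ Hw (Rmin_l _ _))).
  assert (Hw0 : w <> RtoC 0).
  { intros ->. assert (H' := Rlt_le_trans _ _ _ Hw (Rmin_r _ _)).
    rewrite Cmod_minus_sym in H'. replace (z - 0)%C with z in H' by cring. lra. }
  replace (/ w - / z - (w - z) * - / (z * z))%C with (- (/ w - / z) / z * (w - z))%C
    by (cfield; split; assumption).
  rewrite Cmod_mult, Cmod_div, Cmod_opp by assumption.
  apply Rmult_le_compat_r; [apply Cmod_ge_0|].
  apply Rmult_le_reg_r with (Cmod z); [exact Hm|].
  unfold Rdiv. rewrite Rmult_assoc, Rinv_l by lra. lra.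
Qed.

Lemma is_cderive_inv (f : C -> C) (z a : C) :
  is_cderive f z a -> f z <> RtoC 0 ->
  is_cderive (fun w => / f w)%C z (- a / (f z * f z))%C.
Proof.
  intros Hf H0.
  replace (- a / (f z * f z))%C with (a * - / (f z * f z))%C by (cfield; assumption).
  apply (is_cderive_comp Cinv f z); [|exact Hf].
  apply is_cderive_inv_id, H0.
Qed.

Lemma is_cderive_eq (f : C -> C) (z l m : C) :
  is_cderive f z l -> l = m -> is_cderive f z m.
Proof. intros H <-. exact H. Qed.

Ltac cderive_step :=
  first [ refine (is_cderive_const _ _) | refine (is_cderive_id _) |
  lazymatch goal with
  | |- is_cderive (fun w => (@?f w + @?g w)%C) _ _ => refine (is_cderive_plus f g _ _ _ _ _)
  | |- is_cderive (fun w => (@?f w - @?g w)%C) _ _ => refine (is_cderive_minus f g _ _ _ _ _)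
  | |- is_cderive (fun w => (@?f w * @?g w)%C) _ _ => refine (is_cderive_mult f g _ _ _ _ _)
  | |- is_cderive (fun w => (- @?f w)%C) _ _ => refine (is_cderive_opp f _ _ _)
  | |- is_cderive (fun w => (/ @?f w)%C) _ _ => refine (is_cderive_inv f _ _ _ _)
  | |- is_cderive (fun w => (@?f w / @?g w)%C) _ _ =>
      refine (is_cderive_mult f (fun w => / g w)%C _ _ _ _ _)
  end ].

Ltac cderive := eapply is_cderive_eq; [repeat cderive_step|cbv beta].

Lemma C_derive_is_cderive (f : C -> C) (z : C) :
  ex_derive (K := C_AbsRing) (V := C_NormedModule) f z -> is_cderive f z (C_derive f z).
Proof. intros H. apply C_derive_correct; [exact z|exact H]. Qed.

Lemma holomorphic_is_cderive (f : C -> C) (z : C) :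
  holomorphic f -> unit_disc z -> is_cderive f z (C_derive f z).
Proof. intros H Hz. apply C_derive_is_cderive, H, Hz. Qed.

Lemma holomorphic_continuous (f : C -> C) (z : C) :
  holomorphic f -> unit_disc z -> Ccontinuous f z.
Proof. intros H Hz. eapply is_cderive_continuous, holomorphic_is_cderive; eassumption. Qed.

Lemma is_cderive_unique (f : C -> C) (z l m : C) :
  is_cderive f z l -> is_cderive f z m -> l = m.
Proof.
  intros H1 H2. apply is_C_derive_unique in H1, H2. congruence.
Qed.

Lemma is_CInt_pair (f : R -> C) (a b : R) (l : C) :
  is_RInt (V := C_R_NormedModule) f a b l <->
  is_RInt (fun t => fst (f t)) a b (fst l) /\ is_RInt (fun t => snd (f t)) a b (snd l).
Proof.
  split.
  - intros H. split.
    + apply (is_RInt_fct_extend_fst (U := R_NormedModule) (V := R_NormedModule) f a b l H).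
    + apply (is_RInt_fct_extend_snd (U := R_NormedModule) (V := R_NormedModule) f a b l H).
  - intros [H1 H2].
    assert (H := is_RInt_fct_extend_pair (U := R_NormedModule) (V := R_NormedModule)
      f a b (fst l) (snd l) H1 H2).
    destruct l; exact H.
Qed.

Lemma is_CInt_mult_l (f : R -> C) (a b : R) (c l : C) :
  is_RInt (V := C_R_NormedModule) f a b l ->
  is_RInt (V := C_R_NormedModule) (fun t => c * f t)%C a b (c * l)%C.
Proof.
  rewrite !is_CInt_pair. intros [H1 H2]. destruct c as [x y], l as [u v]; simpl in *.
  split.
  - apply (is_RInt_minus (V := R_NormedModule));
      apply is_RInt_Rscal; assumption.
  - apply is_RInt_Rplus;
      apply is_RInt_Rscal; assumption.
Qed.

Lemma CInt_mult_l (f : R -> C) (a b : R) (c : C) :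
  ex_CInt f a b -> CInt (fun t => c * f t)%C a b = (c * CInt f a b)%C.
Proof.
  intros H. apply (is_RInt_unique (V := C_R_CompleteNormedModule)).
  apply is_CInt_mult_l, CInt_correct, H.
Qed.

Lemma CInt_plus (f g : R -> C) (a b : R) :
  ex_CInt f a b -> ex_CInt g a b ->
  CInt (fun t => f t + g t)%C a b = (CInt f a b + CInt g a b)%C.
Proof. apply (RInt_plus (V := C_R_CompleteNormedModule)). Qed.

Lemma CInt_minus (f g : R -> C) (a b : R) :
  ex_CInt f a b -> ex_CInt g a b ->
  CInt (fun t => f t - g t)%C a b = (CInt f a b - CInt g a b)%C.
Proof. apply (RInt_minus (V := C_R_CompleteNormedModule)). Qed.

Lemma ex_CInt_continuous (f : R -> C) (a b : R) :
  (forall t, Rmin a b <= t <= Rmax a b -> Ccontinuous f t) -> ex_CInt f a b.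
Proof. apply (ex_RInt_continuous (V := C_R_CompleteNormedModule)). Qed.

Lemma Cmod_CInt_le (f : R -> C) (g : R -> R) (a b : R) :
  a <= b -> (forall t, a <= t <= b -> Cmod (f t) <= g t) ->
  ex_CInt f a b -> ex_RInt g a b -> Cmod (CInt f a b) <= RInt g a b.
Proof.
  intros Hab H Hf Hg. rewrite Cmod_norm.
  apply (norm_RInt_le (V := C_R_NormedModule) f g a b); [exact Hab| | |].
  - intros t Ht. specialize (H t Ht). rewrite Cmod_norm in H. exact H.
  - apply CInt_correct, Hf.
  - apply RInt_Rcorrect, Hg.
Qed.

Lemma Cmod_CInt_le_const (f : R -> C) (M a b : R) :
  a <= b -> (forall t, a <= t <= b -> Cmod (f t) <= M) ->
  ex_CInt f a b -> Cmod (CInt f a b) <= (b - a) * M.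
Proof.
  intros Hab H Hf.
  replace ((b - a) * M) with (RInt (fun _ => M) a b)
    by (rewrite (RInt_const (V := R_CompleteNormedModule)); reflexivity).
  apply Cmod_CInt_le; try assumption. apply (ex_RInt_const (V := R_NormedModule)).
Qed.

Lemma CInt_derive (f df : R -> C) (a b : R) :
  (forall t, Rmin a b <= t <= Rmax a b -> is_curve_derive f t (df t)) ->
  (forall t, Rmin a b <= t <= Rmax a b -> Ccontinuous df t) ->
  CInt df a b = (f b - f a)%C.
Proof.
  intros H1 H2. apply (is_RInt_unique (V := C_R_CompleteNormedModule)).
  apply (is_RInt_derive (V := C_R_CompleteNormedModule) f df a b H1 H2).
Qed.

Lemma CInt_ext (f g : R -> C) (a b : R) :
  (forall t, Rmin a b <= t <= Rmax a b -> f t = g t) -> CInt f a b = CInt g a b.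
Proof.
  intros H. apply (RInt_ext (V := C_R_CompleteNormedModule)). intros t Ht. apply H. lra.
Qed.

Ltac ccont_step :=
  first [ refine (continuous_const _ _) | assumption |
  lazymatch goal with
  | |- continuous (fun w => (@?f w + @?g w)%C) _ => refine (Ccontinuous_plus f g _ _ _)
  | |- continuous (fun w => (@?f w - @?g w)%C) _ => refine (Ccontinuous_minus f g _ _ _)
  | |- continuous (fun w => (@?f w * @?g w)%C) _ => refine (Ccontinuous_mult f g _ _ _)
  | |- continuous (fun w => (- @?f w)%C) _ => refine (Ccontinuous_opp f _ _)
  | |- continuous (fun w => (/ @?f w)%C) _ => refine (Ccontinuous_inv f _ _ _)
  | |- continuous (fun w => (@?f w / @?g w)%C) _ =>
      refine (Ccontinuous_mult f (fun w => / g w)%C _ _ _)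
  end ].

Ltac ccont := repeat ccont_step; cbv beta.

Ltac rcont :=
  repeat first [ assumption | refine (continuous_const _ _) |
  lazymatch goal with
  | |- continuous (fun q => @?f q + @?g q) _ => refine (continuous_Rplus f g _ _ _)
  | |- continuous (fun q => @?f q * @?g q) _ => refine (continuous_Rmult f g _ _ _)
  end ].

(** * Goursat's theorem and primitives *)

Lemma Cmod_segment_le (p q : C) (rho s : R) :
  Cmod p <= rho -> Cmod q <= rho -> 0 <= s <= 1 -> Cmod (p + s * (q - p)) <= rho.
Proof.
  intros Hp Hq Hs.
  replace (p + s * (q - p))%C with (RtoC (1 - s) * p + RtoC s * q)%C
    by (rewrite RtoC_minus; cring).
  eapply Rle_trans; [apply Cmod_triangle|].
  rewrite !Cmod_mult, !Cmod_R, !Rabs_pos_eq by lra.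
  assert ((1 - s) * Cmod p <= (1 - s) * rho) by (apply Rmult_le_compat_l; lra).
  assert (s * Cmod q <= s * rho) by (apply Rmult_le_compat_l; lra). lra.
Qed.

Lemma unit_disc_segment (p q : C) (s : R) :
  unit_disc p -> unit_disc q -> 0 <= s <= 1 -> unit_disc (p + s * (q - p))%C.
Proof.
  unfold unit_disc; intros Hp Hq Hs.
  apply Rle_lt_trans with (Rmax (Cmod p) (Cmod q)).
  - apply Cmod_segment_le; [apply Rmax_l|apply Rmax_r|exact Hs].
  - apply Rmax_lub_lt; assumption.
Qed.

Definition disc_continuous (f : C -> C) : Prop :=
  forall z, unit_disc z -> Ccontinuous f z.

Lemma Ccontinuous_segment (p q : C) (s : R) :
  Ccontinuous (fun s : R => p + s * (q - p))%C s.
Proof.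
  apply Ccontinuous_plus; [apply continuous_const|].
  apply Ccontinuous_mult; [|apply continuous_const].
  apply Ccontinuous_RtoC, continuous_id.
Qed.

Lemma is_curve_derive_segment (p q : C) (s : R) :
  is_curve_derive (fun s : R => p + s * (q - p))%C s (q - p)%C.
Proof.
  apply is_curve_derive_eps; intros eps He; exists 1; split; [lra|]. intros t _.
  replace (p + t * (q - p) - (p + s * (q - p)) - RtoC (t - s) * (q - p))%C with (RtoC 0)
    by (rewrite RtoC_minus; cring).
  rewrite Cmod_0. apply Rmult_le_pos; [lra|apply Rabs_pos].
Qed.

Definition segment_integral (f : C -> C) (p q : C) : C :=
  CInt (fun s : R => f (p + s * (q - p)) * (q - p))%C 0 1.

Lemma segment_integrand_continuous (f : C -> C) (p q : C) (s : R) :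
  disc_continuous f -> unit_disc p -> unit_disc q -> 0 <= s <= 1 ->
  Ccontinuous (fun s : R => f (p + s * (q - p)) * (q - p))%C s.
Proof.
  intros Hf Hp Hq Hs. apply Ccontinuous_mult; [|apply continuous_const].
  apply (continuous_comp (fun s : R => p + s * (q - p))%C f).
  - apply Ccontinuous_segment.
  - apply Hf, unit_disc_segment; assumption.
Qed.

Lemma ex_segment_integral (f : C -> C) (p q : C) (a b : R) :
  disc_continuous f -> unit_disc p -> unit_disc q -> 0 <= a <= 1 -> 0 <= b <= 1 ->
  ex_CInt (fun s : R => f (p + s * (q - p)) * (q - p))%C a b.
Proof.
  intros Hf Hp Hq Ha Hb. apply ex_CInt_continuous.
  intros t [Ht1 Ht2]. apply segment_integrand_continuous; try assumption. split.
  - eapply Rle_trans; [|exact Ht1]. apply Rmin_glb; lra.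
  - eapply Rle_trans; [exact Ht2|]. apply Rmax_lub; lra.
Qed.

Lemma scal_C_R (a : R) (z : C) : scal (V := C_R_NormedModule) a z = (RtoC a * z)%C.
Proof.
  destruct z as [x y]. apply injective_projections; simpl;
  unfold scal; simpl; unfold mult; simpl; ring.
Qed.

Lemma segment_integral_midpoint (f : C -> C) (p q : C) :
  disc_continuous f -> unit_disc p -> unit_disc q ->
  segment_integral f p q =
  (segment_integral f p ((p + q) / 2) + segment_integral f ((p + q) / 2) q)%C.
Proof.
  intros Hf Hp Hq. unfold segment_integral.
  set (phi := fun s : R => (f (p + s * (q - p)) * (q - p))%C).
  assert (H2 : RtoC (/ 2) = (/ 2)%C) by (rewrite RtoC_inv by lra; reflexivity).
  rewrite <- (RInt_Chasles (V := C_R_CompleteNormedModule) phi 0 (1 / 2) 1);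
    try (apply ex_segment_integral; try assumption; lra).
  apply (f_equal2 Cplus).
  - assert (E := RInt_comp_lin (V := C_R_CompleteNormedModule) phi (/ 2) 0 0 1).
    replace (/ 2 * 0 + 0) with 0 in E by lra.
    replace (/ 2 * 1 + 0) with (1 / 2) in E by lra.
    rewrite <- E by (apply ex_segment_integral; try assumption; lra).
    apply CInt_ext. intros t _.
    change (scal (V := C_R_NormedModule) (/ 2) (phi (/ 2 * t + 0)) =
      (f (p + t * ((p + q) / 2 - p)) * ((p + q) / 2 - p))%C).
    rewrite scal_C_R. unfold phi. rewrite RtoC_plus, RtoC_mult, H2.
    replace (p + t * ((p + q) / 2 - p))%C with (p + (/ 2 * t + 0) * (q - p))%C
      by cfield.
    cfield.
  - assert (E := RInt_comp_lin (V := C_R_CompleteNormedModule) phi (/ 2) (/ 2) 0 1).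
    replace (/ 2 * 0 + / 2) with (1 / 2) in E by lra.
    replace (/ 2 * 1 + / 2) with 1 in E by lra.
    rewrite <- E by (apply ex_segment_integral; try assumption; lra).
    apply CInt_ext. intros t _.
    change (scal (V := C_R_NormedModule) (/ 2) (phi (/ 2 * t + / 2)) =
      (f ((p + q) / 2 + t * (q - (p + q) / 2)) * (q - (p + q) / 2))%C).
    rewrite scal_C_R. unfold phi. rewrite RtoC_plus, RtoC_mult, H2.
    replace ((p + q) / 2 + t * (q - (p + q) / 2))%C with (p + (/ 2 * t + / 2) * (q - p))%C
      by cfield.
    cfield.
Qed.

Lemma segment_integral_reverse (f : C -> C) (p q : C) :
  disc_continuous f -> unit_disc p -> unit_disc q ->
  segment_integral f q p = (- segment_integral f p q)%C.
Proof.
  intros Hf Hp Hq. unfold segment_integral.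
  set (phi := fun s : R => (f (p + s * (q - p)) * (q - p))%C).
  change (- CInt phi 0 1)%C with (opp (CInt phi 0 1)).
  rewrite (opp_RInt_swap (V := C_R_CompleteNormedModule))
    by (apply ex_segment_integral; try assumption; lra).
  assert (E := RInt_comp_lin (V := C_R_CompleteNormedModule) phi (- 1) 1 0 1).
  replace (- 1 * 0 + 1) with 1 in E by lra.
  replace (- 1 * 1 + 1) with 0 in E by lra.
  rewrite <- E by (apply ex_segment_integral; try assumption; lra).
  apply CInt_ext. intros t _.
  change ((f (q + t * (p - q)) * (p - q))%C =
    scal (V := C_R_NormedModule) (- 1) (phi (- 1 * t + 1))).
  rewrite scal_C_R. unfold phi. rewrite RtoC_plus, RtoC_mult.
  replace (RtoC (- 1)) with (- (1))%C by (rewrite <- RtoC_opp; reflexivity).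
  replace (q + t * (p - q))%C with (p + (- (1) * t + 1) * (q - p))%C by cring.
  cring.
Qed.

Lemma segment_integral_primitive (F f : C -> C) (p q : C) :
  disc_continuous f -> (forall z, unit_disc z -> is_cderive F z (f z)) ->
  unit_disc p -> unit_disc q -> segment_integral f p q = (F q - F p)%C.
Proof.
  intros Hf HF Hp Hq. unfold segment_integral.
  rewrite (CInt_derive (fun s : R => F (p + s * (q - p)))%C).
  - replace (p + 1 * (q - p))%C with q by cring.
    replace (p + 0 * (q - p))%C with p by cring. reflexivity.
  - intros t Ht. rewrite Rmin_left, Rmax_right in Ht by lra.
    rewrite Cmult_comm.
    apply (is_curve_derive_comp F (fun s : R => p + s * (q - p))%C).
    + apply HF, unit_disc_segment; assumption.
    + apply is_curve_derive_segment.
  - intros t Ht. rewrite Rmin_left, Rmax_right in Ht by lra.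
    apply segment_integrand_continuous; assumption.
Qed.

Lemma segment_integral_bound (f : C -> C) (p q : C) (M : R) :
  disc_continuous f -> unit_disc p -> unit_disc q ->
  (forall s, 0 <= s <= 1 -> Cmod (f (p + s * (q - p))%C) <= M) ->
  Cmod (segment_integral f p q) <= M * Cmod (q - p).
Proof.
  intros Hf Hp Hq HM. unfold segment_integral.
  replace (M * Cmod (q - p)) with ((1 - 0) * (M * Cmod (q - p))) by ring.
  apply Cmod_CInt_le_const; [lra| |apply ex_segment_integral; try assumption; lra].
  intros t Ht. rewrite Cmod_mult. apply Rmult_le_compat_r; [apply Cmod_ge_0|].
  apply HM, Ht.
Qed.

Lemma segment_integral_plus (f g : C -> C) (p q : C) :
  disc_continuous f -> disc_continuous g -> unit_disc p -> unit_disc q ->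
  segment_integral (fun z => f z + g z)%C p q =
  (segment_integral f p q + segment_integral g p q)%C.
Proof.
  intros Hf Hg Hp Hq. unfold segment_integral.
  rewrite <- CInt_plus by (apply ex_segment_integral; try assumption; lra).
  apply CInt_ext. intros t _. cring.
Qed.

(** * Sequences with geometrically decreasing increments *)

Lemma inv_pow2_pos (n : nat) : 0 < / 2 ^ n.
Proof. apply Rinv_0_lt_compat, pow_lt; lra. Qed.

Lemma geometric_small (D eps : R) : 0 < eps -> exists n, D * / 2 ^ n < eps.
Proof.
  intros He.
  assert (Hlim : is_lim_seq (fun n => D * / 2 ^ n) (D * 0)).
  { apply (is_lim_seq_scal_l _ D (Finite 0)).
    apply (is_lim_seq_ext (fun n => (/ 2) ^ n)).
    - intros n. rewrite pow_inv. reflexivity.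
    - apply is_lim_seq_geom. rewrite Rabs_pos_eq; lra. }
  apply is_lim_seq_spec in Hlim.
  destruct (Hlim (mkposreal eps He)) as [N HN]. exists N.
  specialize (HN N (Nat.le_refl _)). simpl in HN. rewrite Rmult_0_r, Rminus_0_r in HN.
  apply Rabs_def2 in HN. lra.
Qed.

Lemma geometric_cauchy_R (u : nat -> R) (D : R) :
  (forall n, Rabs (u (S n) - u n) <= D * / 2 ^ n) ->
  exists l, forall n, Rabs (u n - l) <= 2 * D * / 2 ^ n.
Proof.
  intros H.
  assert (HD : 0 <= D).
  { specialize (H O). generalize (Rabs_pos (u 1%nat - u O)). simpl in *. lra. }
  assert (Hpos : forall n, 0 < / 2 ^ n) by (intros; apply Rinv_0_lt_compat, pow_lt; lra).
  assert (Hs : forall n, / 2 ^ S n = / 2 ^ n / 2).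
  { intros n. simpl. field. apply pow_nonzero; lra. }
  assert (Hk : forall k n, Rabs (u (n + k)%nat - u n) <= 2 * D * (/ 2 ^ n - / 2 ^ (n + k))).
  { induction k; intros n.
    - rewrite Nat.add_0_r, Rminus_diag, Rabs_R0. lra.
    - replace (n + S k)%nat with (S (n + k)) by lia.
      replace (u (S (n + k)) - u n) with ((u (S (n + k)) - u (n + k)%nat) + (u (n + k)%nat - u n)) by ring.
      eapply Rle_trans; [apply Rabs_triang|].
      specialize (H (n + k)%nat). specialize (IHk n). rewrite Hs. lra. }
  assert (Hc : ex_finite_lim_seq u).
  { apply ex_lim_seq_cauchy_corr. intros eps.
    assert (He2 : 0 < eps / 2) by (generalize (cond_pos eps); lra).
    destruct (geometric_small (2 * D) (eps / 2) He2) as [N HN]. exists N.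
    assert (Hb : forall n, (N <= n)%nat -> Rabs (u n - u N) < eps / 2).
    { intros n Hn. replace n with (N + (n - N))%nat by lia.
      eapply Rle_lt_trans; [apply Hk|].
      assert (0 <= 2 * D * / 2 ^ (N + (n - N))) by (apply Rmult_le_pos; [lra|left; apply Hpos]).
      lra. }
    intros n m Hn Hm.
    replace (u n - u m) with ((u n - u N) - (u m - u N)) by ring.
    unfold Rminus at 1. eapply Rle_lt_trans; [apply Rabs_triang|]. rewrite Rabs_Ropp.
    specialize (Hb n Hn) as H1. specialize (Hb m Hm) as H2'. lra. }
  destruct Hc as [l Hl]. exists l. intros n.
  assert (Hl2 : is_lim_seq (fun k => Rabs (u n - u (k + n)%nat)) (Rabs (u n - l))).
  { apply (is_lim_seq_abs _ (Finite (u n - l))).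
    apply (is_lim_seq_minus _ _ (u n) l).
    - apply is_lim_seq_const.
    - apply (is_lim_seq_incr_n u n), Hl.
    - reflexivity. }
  apply (is_lim_seq_le (fun k => Rabs (u n - u (k + n)%nat)) (fun _ => 2 * D * / 2 ^ n)
    (Rabs (u n - l)) (2 * D * / 2 ^ n)); [|exact Hl2|apply is_lim_seq_const].
  intros k. rewrite Rabs_minus_sym, Nat.add_comm. eapply Rle_trans; [apply Hk|].
  assert (0 <= 2 * D * / 2 ^ (n + k)) by (apply Rmult_le_pos; [lra|left; apply Hpos]). lra.
Qed.

Lemma geometric_cauchy_C (u : nat -> C) (D : R) :
  (forall n, Cmod (u (S n) - u n) <= D * / 2 ^ n) ->
  exists l, forall n, Cmod (u n - l) <= 4 * D * / 2 ^ n.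
Proof.
  intros H.
  destruct (geometric_cauchy_R (fun n => fst (u n)) D) as [x Hx].
  { intros n. eapply Rle_trans; [|apply H]. apply (Rabs_fst_le_Cmod (u (S n) - u n)%C). }
  destruct (geometric_cauchy_R (fun n => snd (u n)) D) as [y Hy].
  { intros n. eapply Rle_trans; [|apply H]. apply (Rabs_snd_le_Cmod (u (S n) - u n)%C). }
  exists (x, y). intros n. eapply Rle_trans; [apply Cmod_le_abs|].
  specialize (Hx n). specialize (Hy n). simpl in *. unfold Rminus in *. lra.
Qed.

Definition triangle_integral (f : C -> C) (t : C * C * C) : C :=
  let '(p, q, r) := t in
  (segment_integral f p q + segment_integral f q r + segment_integral f r p)%C.

Definition triangle_in (rho d : R) (t : C * C * C) : Prop :=
  let '(p, q, r) := t in
  (Cmod p <= rho /\ Cmod q <= rho /\ Cmod r <= rho) /\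
  (Cmod (q - p) <= d /\ Cmod (r - q) <= d /\ Cmod (p - r) <= d).

(** The central triangle needs no test: it is reached only if the other three integrals fall short
    of a quarter. The vertices are ordered so that each inner side is traversed once in either
    direction. *)
Definition subtriangle (f : C -> C) (t : C * C * C) : C * C * C :=
  let '(p, q, r) := t in
  let a := ((p + q) / 2)%C in let b := ((q + r) / 2)%C in let c := ((r + p) / 2)%C in
  let big u := Rle_dec (Cmod (triangle_integral f t) / 4) (Cmod (triangle_integral f u)) in
  if big (p, a, c) then (p, a, c) else
  if big (a, q, b) then (a, q, b) else
  if big (c, b, r) then (c, b, r) else (a, b, c).

Lemma Cmod_midpoint_le (p q : C) (rho : R) :
  Cmod p <= rho -> Cmod q <= rho -> Cmod ((p + q) / 2) <= rho.
Proof.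
  intros Hp Hq. replace ((p + q) / 2)%C with (p + RtoC (/ 2) * (q - p))%C.
  - apply Cmod_segment_le; lra.
  - rewrite RtoC_inv by lra. cfield.
Qed.

Lemma Cmod_half (z w : C) (d : R) : w = (z / 2)%C -> Cmod z <= d -> Cmod w <= d / 2.
Proof.
  intros -> H. unfold Cdiv. rewrite Cmod_mult, <- RtoC_inv, Cmod_R, Rabs_pos_eq by lra. lra.
Qed.

Lemma Cmod_half_opp (z w : C) (d : R) : w = (- z / 2)%C -> Cmod z <= d -> Cmod w <= d / 2.
Proof. intros Hw H. apply (Cmod_half (- z)%C); [exact Hw|]. rewrite Cmod_opp; exact H. Qed.

Lemma subtriangle_in (f : C -> C) (t : C * C * C) (rho d : R) :
  triangle_in rho d t -> triangle_in rho (d / 2) (subtriangle f t).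
Proof.
  destruct t as [[p q] r]. intros [[Hp [Hq Hr]] [H1 [H2 H3]]].
  assert (Ha := Cmod_midpoint_le p q rho Hp Hq).
  assert (Hb := Cmod_midpoint_le q r rho Hq Hr).
  assert (Hc := Cmod_midpoint_le r p rho Hr Hp).
  unfold subtriangle.
  repeat match goal with |- context [Rle_dec ?x ?y] => destruct (Rle_dec x y) end;
  (split; [repeat split; assumption|]);
  repeat split;
  first [ refine (Cmod_half _ _ _ _ H1); cfield | refine (Cmod_half_opp _ _ _ _ H1); cfield
        | refine (Cmod_half _ _ _ _ H2); cfield | refine (Cmod_half_opp _ _ _ _ H2); cfield
        | refine (Cmod_half _ _ _ _ H3); cfield | refine (Cmod_half_opp _ _ _ _ H3); cfield ].
Qed.

Lemma subtriangle_vertex (f : C -> C) (t : C * C * C) (rho d : R) :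
  0 <= d -> triangle_in rho d t ->
  Cmod (fst (fst (subtriangle f t)) - fst (fst t)) <= d.
Proof.
  destruct t as [[p q] r]. intros Hd [_ [H1 [H2 H3]]]. unfold subtriangle.
  apply Rle_trans with (d / 2); [|lra].
  repeat match goal with |- context [Rle_dec ?x ?y] => destruct (Rle_dec x y) end;
  cbn [fst];
  first [ refine (Cmod_half _ _ _ _ H1); cfield
        | refine (Cmod_half _ _ _ _ H3); cfield 
        | refine (Cmod_half_opp _ _ _ _ H3); cfield | idtac].
  replace (p - p)%C with (RtoC 0) by cring. rewrite Cmod_0. lra.
Qed.

Lemma subtriangle_integral (f : C -> C) (t : C * C * C) (rho d : R) :
  disc_continuous f -> rho < 1 -> triangle_in rho d t ->
  Cmod (triangle_integral f t) / 4 <= Cmod (triangle_integral f (subtriangle f t)).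
Proof.
  destruct t as [[p q] r]. intros Hf Hrho [[Hp [Hq Hr]] _].
  assert (Ha := Cmod_midpoint_le p q rho Hp Hq).
  assert (Hb := Cmod_midpoint_le q r rho Hq Hr).
  assert (Hc := Cmod_midpoint_le r p rho Hr Hp).
  unfold subtriangle.
  repeat match goal with |- context [Rle_dec ?x ?y] => destruct (Rle_dec x y) end;
    try assumption.
  set (a := ((p + q) / 2)%C) in *. set (b := ((q + r) / 2)%C) in *.
  set (c := ((r + p) / 2)%C) in *.
  assert (E : triangle_integral f (p, q, r) =
    (triangle_integral f (p, a, c) + triangle_integral f (a, q, b) +
     triangle_integral f (c, b, r) + triangle_integral f (a, b, c))%C).
  { unfold triangle_integral.
    rewrite (segment_integral_midpoint f p q), (segment_integral_midpoint f q r),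
      (segment_integral_midpoint f r p) by (unfold unit_disc; try assumption; lra).
    fold a b c.
    rewrite (segment_integral_reverse f a b), (segment_integral_reverse f b c),
      (segment_integral_reverse f c a) by (unfold unit_disc; try assumption; lra).
    cring. }
  assert (Ht : Cmod (triangle_integral f (p, q, r)) <=
    Cmod (triangle_integral f (p, a, c)) + Cmod (triangle_integral f (a, q, b)) +
    Cmod (triangle_integral f (c, b, r)) + Cmod (triangle_integral f (a, b, c))).
  { rewrite E.
    eapply Rle_trans; [apply Cmod_triangle|]. apply Rplus_le_compat_r.
    eapply Rle_trans; [apply Cmod_triangle|]. apply Rplus_le_compat_r.
    apply Cmod_triangle. }
  lra.
Qed.

Lemma goursat (f : C -> C) (p q r : C) :
  holomorphic f -> unit_disc p -> unit_disc q -> unit_disc r ->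
  triangle_integral f (p, q, r) = RtoC 0.
Proof.
  intros Hf Hp Hq Hr.
  assert (Hc : disc_continuous f) by (intros z Hz; apply holomorphic_continuous; assumption).
  set (rho := Rmax (Cmod p) (Rmax (Cmod q) (Cmod r))).
  set (d := Cmod (q - p) + Cmod (r - q) + Cmod (p - r)).
  assert (Hrho : rho < 1) by (repeat apply Rmax_lub_lt; assumption).
  assert (Hd : 0 <= d) by (unfold d;
    generalize (Cmod_ge_0 (q - p)) (Cmod_ge_0 (r - q)) (Cmod_ge_0 (p - r)); lra).
  set (t := fun n => Nat.iter n (subtriangle f) (p, q, r)).
  assert (Hpow : forall n, 0 < / 2 ^ n) by (intros; apply Rinv_0_lt_compat, pow_lt; lra).
  assert (Hpow1 : forall n, 2 ^ n <> 0) by (intros; apply pow_nonzero; lra).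
  assert (Hin : forall n, triangle_in rho (d * / 2 ^ n) (t n)).
  { induction n.
    - replace (d * / 2 ^ 0) with d by (simpl; field). split; [repeat split|repeat split].
      + apply Rmax_l.
      + eapply Rle_trans; [|apply Rmax_r]. apply Rmax_l.
      + eapply Rle_trans; [|apply Rmax_r]. apply Rmax_r.
      + unfold d. generalize (Cmod_ge_0 (r - q)) (Cmod_ge_0 (p - r)); lra.
      + unfold d. generalize (Cmod_ge_0 (q - p)) (Cmod_ge_0 (p - r)); lra.
      + unfold d. generalize (Cmod_ge_0 (r - q)) (Cmod_ge_0 (q - p)); lra.
    - replace (d * / 2 ^ S n) with (d * / 2 ^ n / 2) by (simpl; field; apply Hpow1).
      apply subtriangle_in, IHn. }
  assert (Hbig : forall n, Cmod (triangle_integral f (p, q, r)) * (/ 2 ^ n * / 2 ^ n) <=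
    Cmod (triangle_integral f (t n))).
  { induction n.
    - simpl. right. field.
    - eapply Rle_trans; [|apply (subtriangle_integral f (t n) rho (d * / 2 ^ n) Hc Hrho (Hin n))].
      eapply Rle_trans; [|apply Rmult_le_compat_r; [lra|exact IHn]].
      right. simpl. field. apply Hpow1. }
  destruct (geometric_cauchy_C (fun n => fst (fst (t n))) d) as [z Hz].
  { intros n. apply (subtriangle_vertex f (t n) rho); [|apply Hin].
    apply Rmult_le_pos; [lra|left; apply Hpow]. }
  assert (Hzd : unit_disc z).
  (* A limit on or outside the unit circle would be at distance at least 1 - rho from every
     vertex. *)
  { apply Rnot_le_lt. intros H1.
    destruct (geometric_small (4 * d) (1 - rho)) as [n Hn]; [lra|].
    specialize (Hz n). specialize (Hin n). destruct (t n) as [[p' q'] r'].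
    destruct Hin as [[Hp' _] _]. simpl in Hz.
    assert (H := Cmod_triangle_inv z p'). rewrite Cmod_minus_sym in H. lra. }
  apply Cmod_eq_0. apply Rle_antisym; [|apply Cmod_ge_0].
  apply Rnot_lt_le. intros Hpos.
  set (c := Cmod (triangle_integral f (p, q, r))) in *.
  set (l := C_derive f z).
  (* Three sides, each of length at most d 2^-n and within 5 d 2^-n of [z], give c <= 15 d^2 eps.
     The added 1 covers the degenerate triangle with d = 0. *)
  set (eps := c / (2 * (15 * (d * d) + 1))).
  assert (Hdd : 0 <= d * d) by (apply Rmult_le_pos; lra).
  assert (Heps : 0 < eps) by (apply Rdiv_lt_0_compat; lra).
  destruct (proj1 (is_cderive_eps f z l) (holomorphic_is_cderive f z Hf Hzd) eps Heps)
    as [dl [Hdl Hdf]].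
  destruct (geometric_small (5 * d) dl Hdl) as [n Hn].
  specialize (Hin n). specialize (Hbig n). specialize (Hz n).
  destruct (t n) as [[p' q'] r']. cbn [fst] in Hz.
  destruct Hin as [[Hp' [Hq' Hr']] [H1 [H2 H3]]].
  set (h := / 2 ^ n) in *. assert (Hh : 0 < h) by apply Hpow.
  assert (Hdh : 0 <= d * h) by (apply Rmult_le_pos; lra).
  (* 4 d h from the first vertex to the limit point, plus one side of length at most d h. *)
  assert (Kq : Cmod (q' - z) <= 5 * d * h).
  { replace (q' - z)%C with ((q' - p') + (p' - z))%C by cring.
    eapply Rle_trans; [apply Cmod_triangle|]. lra. }
  assert (Kr : Cmod (r' - z) <= 5 * d * h).
  { replace (r' - z)%C with ((p' - z) - (p' - r'))%C by cring.
    eapply Rle_trans; [apply Cmod_minus_triangle|]. lra. }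
  assert (Kp : Cmod (p' - z) <= 5 * d * h) by lra.
  (* The affine part of [f] at [z] has an explicit primitive, so it contributes nothing around the
     triangle and only the error of order eps remains. *)
  set (aff := fun w : C => (f z + (w - z) * l)%C).
  set (err := fun w : C => (f w - aff w)%C).
  assert (Haff : forall w, is_cderive (fun w => f z * w + l * (w * w * / 2 - z * w))%C w (aff w)).
  { intros w.
    cderive. unfold aff. cfield. }
  assert (Caff : disc_continuous aff).
  { intros w _. unfold aff. apply Ccontinuous_plus; [apply continuous_const|].
    apply Ccontinuous_mult; [|apply continuous_const].
    apply Ccontinuous_minus; [apply continuous_id|apply continuous_const]. }
  assert (Cerr : disc_continuous err).
  { intros w Hw. apply Ccontinuous_minus; [apply Hc, Hw|apply Caff, Hw]. }
  assert (Hseg : forall u v, Cmod u <= rho -> Cmod v <= rho -> Cmod (u - z) <= 5 * d * h ->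
    Cmod (v - z) <= 5 * d * h -> Cmod (v - u) <= d * h ->
    exists e, Cmod e <= eps * (5 * d * h) * (d * h) /\ segment_integral f u v =
     ((f z * v + l * (v * v * / 2 - z * v)) - (f z * u + l * (u * u * / 2 - z * u)) + e)%C).
  { intros u v Hu Hv Ku Kv Kuv. exists (segment_integral err u v).
    assert (Du : unit_disc u) by (unfold unit_disc; lra).
    assert (Dv : unit_disc v) by (unfold unit_disc; lra).
    split.
    - eapply Rle_trans; [apply (segment_integral_bound err u v (eps * (5 * d * h)))|];
        try assumption.
      + intros s Hs. 
        assert (Hw : Cmod (u + s * (v - u) - z) <= 5 * d * h).
        { replace (u + s * (v - u) - z)%C with ((u - z) + s * ((v - z) - (u - z)))%C by cring.
          apply Cmod_segment_le; assumption. }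
        replace (err (u + s * (v - u))%C) with
          (f (u + s * (v - u)) - f z - (u + s * (v - u) - z) * l)%C by (unfold err, aff; cring).
        eapply Rle_trans; [apply Hdf; unfold h in *; lra|].
        apply Rmult_le_compat_l; lra.
      + apply Rmult_le_compat_l; [|exact Kuv]. apply Rmult_le_pos; lra.
    - rewrite <- (segment_integral_primitive (fun w => f z * w + l * (w * w * / 2 - z * w))%C aff);
        try assumption; [|intros; apply Haff].
      rewrite <- segment_integral_plus by assumption.
      unfold segment_integral. apply CInt_ext. intros s _. unfold err, aff. cring. }
  destruct (Hseg p' q') as [e1 [E1 S1]]; try assumption.
  destruct (Hseg q' r') as [e2 [E2 S2]]; try assumption.
  destruct (Hseg r' p') as [e3 [E3 S3]]; try assumption.
  unfold triangle_integral in Hbig. rewrite S1, S2, S3 in Hbig.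
  match type of Hbig with _ <= Cmod ?x => replace x with (e1 + e2 + e3)%C in Hbig by cring end.
  assert (Hsum : Cmod (e1 + e2 + e3) <= 3 * (eps * (5 * d * h) * (d * h))).
  { eapply Rle_trans; [apply Cmod_triangle|].
    assert (H := Cmod_triangle e1 e2). lra. }
  assert (Hhh : 0 < h * h) by (apply Rmult_lt_0_compat; lra).
  assert (Hfin : c <= 15 * (d * d) * eps).
  { apply Rmult_le_reg_r with (h * h); [exact Hhh|].
    replace (15 * (d * d) * eps * (h * h)) with (3 * (eps * (5 * d * h) * (d * h))) by ring.
    lra. }
  assert (He : (15 * (d * d) + 1) * eps = c / 2) by (unfold eps; field; lra).
  lra.
Qed.

Lemma segment_integral_chasles (f : C -> C) (p q r : C) :
  holomorphic f -> unit_disc p -> unit_disc q -> unit_disc r ->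
  segment_integral f p r = (segment_integral f p q + segment_integral f q r)%C.
Proof.
  intros Hf Hp Hq Hr. assert (H := goursat f p q r Hf Hp Hq Hr).
  unfold triangle_integral in H.
  rewrite (segment_integral_reverse f p r) in H; try assumption.
  2: { intros z Hz; apply holomorphic_continuous; assumption. }
  set (A := segment_integral f p q) in *. set (B := segment_integral f q r) in *.
  set (D := segment_integral f p r) in *.
  replace D with (A + B - (A + B + - D))%C by cring. rewrite H. cring.
Qed.

Lemma unit_disc_0 : unit_disc (RtoC 0).
Proof. unfold unit_disc. rewrite Cmod_0. lra. Qed.

(** By Goursat's theorem, moving the endpoint from [z] to [w] adds the integral over the segment
    from [z] to [w]. After subtraction of the constant [f z] the integrand there is small by
    continuity. *)
Lemma is_cderive_segment_integral (f : C -> C) (z : C) :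
  holomorphic f -> unit_disc z -> is_cderive (segment_integral f (RtoC 0)) z (f z).
Proof.
  intros Hf Hz.
  assert (Hc : disc_continuous f) by (intros w Hw; apply holomorphic_continuous; assumption).
  apply is_cderive_eps; intros eps He.
  destruct (proj1 (locally_C_eps _ _) (proj1 (Ccontinuous_eps f z) (Hc z Hz) eps He))
    as [d [Hd H]].
  unfold unit_disc in Hz.
  exists (Rmin d (1 - Cmod z)); split; [apply Rmin_pos; lra|].
  intros w Hw.
  assert (H1 := Rlt_le_trans _ _ _ Hw (Rmin_l _ _)).
  assert (H2 := Rlt_le_trans _ _ _ Hw (Rmin_r _ _)).
  assert (Hwd : unit_disc w).
  { unfold unit_disc. assert (H3 := Cmod_triangle_inv w z). lra. }
  rewrite (segment_integral_chasles f (RtoC 0) z w) by (try assumption; apply unit_disc_0).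
  assert (Cc : disc_continuous (fun _ => - f z)%C) by (intros u _; apply continuous_const).
  replace (segment_integral f (RtoC 0) z + segment_integral f z w - segment_integral f (RtoC 0) z
    - (w - z) * f z)%C with (segment_integral f z w + (- f z * w - - f z * z))%C by cring.
  rewrite <- (segment_integral_primitive (fun w => - f z * w)%C (fun _ => - f z)%C z w);
    try assumption.
  2: { intros u _. cderive. cring. }
  rewrite <- segment_integral_plus by assumption.
  apply segment_integral_bound; try assumption.
  - intros u Hu. apply Ccontinuous_plus; [apply Hc, Hu|apply continuous_const].
  - intros s Hs. left. apply H.
    replace (z + s * (w - z) - z)%C with (RtoC s * (w - z))%C by cring.
    rewrite Cmod_mult, Cmod_R, Rabs_pos_eq by lra.
    eapply Rle_lt_trans; [|exact H1]. 
    rewrite <- (Rmult_1_l (Cmod (w - z))) at 2. apply Rmult_le_compat_r; [apply Cmod_ge_0|lra].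
Qed.

(** * Cauchy's formula *)

Lemma continuous_R2_fst (h : R -> R) (q : R * R) :
  continuous h (fst q) -> continuous (fun q : R * R => h (fst q)) q.
Proof. intros H. apply (continuous_comp fst h); [apply continuous_fst|exact H]. Qed.

Lemma continuous_R2_snd (h : R -> R) (q : R * R) :
  continuous h (snd q) -> continuous (fun q : R * R => h (snd q)) q.
Proof. intros H. apply (continuous_comp snd h); [apply continuous_snd|exact H]. Qed.

Lemma is_derive_RInt_2d (h dh : R -> R -> R) (a b x d : R) :
  0 < d ->
  (forall y t, Rabs (y - x) < d -> is_derive (fun y => h y t) y (dh y t)) ->
  (forall t, continuous (fun q : R * R => dh (fst q) (snd q)) (x, t)) ->
  (forall y, Rabs (y - x) < d -> ex_RInt (h y) a b) ->
  is_derive (fun y => RInt (h y) a b) x (RInt (dh x) a b).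
Proof.
  intros Hd Hh Hc Hi.
  assert (Hx : Rabs (x - x) < d) by (rewrite Rminus_diag, Rabs_R0; exact Hd).
  replace (RInt (dh x) a b) with (RInt (fun t => Derive (fun u => h u t) x) a b).
  2: { apply RInt_ext. intros t _. apply is_derive_unique, Hh, Hx. }
  apply is_derive_RInt_param.
  - exists (mkposreal d Hd). intros y Hy t _. exists (dh y t). apply Hh, Hy.
  - intros t _. apply (continuity_2d_pt_ext_loc (fun y t => dh y t)).
    + exists (mkposreal d Hd). intros u v Hu _. symmetry. apply is_derive_unique, Hh, Hu.
    + apply continuity_2d_pt_filterlim. apply (Hc t).
  - exists (mkposreal d Hd). intros y Hy. apply Hi, Hy.
Qed.

Lemma CInt_components (f : R -> C) (a b : R) :
  ex_CInt f a b ->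
  (ex_RInt (fun t => fst (f t)) a b /\ RInt (fun t => fst (f t)) a b = fst (CInt f a b)) /\
  (ex_RInt (fun t => snd (f t)) a b /\ RInt (fun t => snd (f t)) a b = snd (CInt f a b)).
Proof.
  intros H. apply CInt_correct, is_CInt_pair in H. destruct H as [H1 H2].
  split; (split; [eexists; eassumption|apply is_RInt_unique; assumption]).
Qed.

Lemma is_curve_derive_CInt_2d (h dh : R -> R -> C) (a b x d : R) :
  0 < d ->
  (forall y t, Rabs (y - x) < d -> is_curve_derive (fun y => h y t) y (dh y t)) ->
  (forall t, Ccontinuous (fun q : R * R => dh (fst q) (snd q)) (x, t)) ->
  (forall y, Rabs (y - x) < d -> ex_CInt (h y) a b) -> ex_CInt (dh x) a b ->
  is_curve_derive (fun y => CInt (h y) a b) x (CInt (dh x) a b).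
Proof.
  intros Hd Hh Hc Hi Hi'.
  destruct (CInt_components _ _ _ Hi') as [[_ E1] [_ E2]].
  apply is_curve_derive_pair; rewrite <- ?E1, <- ?E2.
  - apply (is_derive_ext_loc (fun y => RInt (fun t => fst (h y t)) a b)).
    + exists (mkposreal d Hd). intros y Hy. apply (CInt_components _ _ _ (Hi y Hy)).
    + apply (is_derive_RInt_2d (fun y t => fst (h y t)) (fun y t => fst (dh y t)) a b x d Hd).
      * intros y t Hy. apply (is_curve_derive_fst (fun y => h y t)), Hh, Hy.
      * intros t. apply (Ccontinuous_fst (fun q : R * R => dh (fst q) (snd q))), Hc.
      * intros y Hy. apply (CInt_components _ _ _ (Hi y Hy)).
  - apply (is_derive_ext_loc (fun y => RInt (fun t => snd (h y t)) a b)).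
    + exists (mkposreal d Hd). intros y Hy. apply (CInt_components _ _ _ (Hi y Hy)).
    + apply (is_derive_RInt_2d (fun y t => snd (h y t)) (fun y t => snd (dh y t)) a b x d Hd).
      * intros y t Hy. apply (is_curve_derive_snd (fun y => h y t)), Hh, Hy.
      * intros t. apply (Ccontinuous_snd (fun q : R * R => dh (fst q) (snd q))), Hc.
      * intros y Hy. apply (CInt_components _ _ _ (Hi y Hy)).
Qed.

Lemma Cmod_circle_pt (r t : R) : 0 <= r -> Cmod (circle_pt r t) = r.
Proof.
  intros Hr. unfold circle_pt, Cmod. cbn [fst snd].
  replace ((r * cos t) ^ 2 + (r * sin t) ^ 2) with (r * r * (Rsqr (sin t) + Rsqr (cos t)))
    by (unfold Rsqr; ring).
  rewrite sin2_cos2, Rmult_1_r. apply sqrt_square, Hr.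
Qed.

Lemma circle_pt_closed (r : R) : circle_pt r (2 * PI) = circle_pt r 0.
Proof. unfold circle_pt. rewrite cos_2PI, sin_2PI, cos_0, sin_0. reflexivity. Qed.

Lemma is_curve_derive_circle_pt (r t : R) :
  is_curve_derive (circle_pt r) t (Ci * circle_pt r t)%C.
Proof.
  apply is_curve_derive_pair; unfold circle_pt, Ci, Cmult; cbn [fst snd];
    auto_derive; try exact I; ring.
Qed.

Lemma Ccontinuous_circle_pt (r t : R) : Ccontinuous (circle_pt r) t.
Proof.
  apply Ccontinuous_pair; unfold circle_pt; cbn [fst snd];
  apply ex_derive_Rcontinuous; auto_derive; exact I.
Qed.

Lemma Ccontinuous_snd_comp (f : R -> C) (q : R * R) :
  Ccontinuous f (snd q) -> Ccontinuous (fun q : R * R => f (snd q)) q.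
Proof. intros H. apply (continuous_comp snd f); [apply continuous_snd|exact H]. Qed.

Lemma Ccontinuous_fst_RtoC (q : R * R) : Ccontinuous (fun q : R * R => RtoC (fst q)) q.
Proof. apply Ccontinuous_RtoC, continuous_fst. Qed.

Lemma circle_pt_minus_neq_0 (r t : R) (a : C) :
  Cmod a < r -> (circle_pt r t - a)%C <> RtoC 0.
Proof.
  intros Ha. apply Cmod_gt_0. assert (H := Cmod_triangle_inv (circle_pt r t) a).
  rewrite Cmod_circle_pt in H by (generalize (Cmod_ge_0 a); lra). lra.
Qed.

Lemma CInt_closed_curve (f df : R -> C) :
  (forall t, is_curve_derive f t (df t)) -> (forall t, Ccontinuous df t) ->
  f (2 * PI) = f 0 -> CInt df 0 (2 * PI) = RtoC 0.
Proof.
  intros H1 H2 H. rewrite (CInt_derive f df); [rewrite H; cring| |]; intros; auto.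
Qed.

Lemma curve_constant (g : R -> C) :
  (forall x, 0 <= x <= 1 -> is_curve_derive g x (RtoC 0)) -> g 0 = g 1.
Proof.
  intros H. apply (eq_is_derive (V := C_R_NormedModule) g 0 1); [|lra].
  intros t Ht. apply H, Ht.
Qed.

Lemma Ci_sqr : (Ci * Ci)%C = (- (1))%C.
Proof. unfold Ci, Cmult, Copp; simpl. f_equal; ring. Qed.

Lemma unit_disc_circle_pt (r t : R) : 0 <= r < 1 -> unit_disc (circle_pt r t).
Proof. intros Hr. unfold unit_disc. rewrite Cmod_circle_pt; lra. Qed.

Lemma Ccontinuous_circle_comp (f : C -> C) (r t : R) :
  disc_continuous f -> 0 <= r < 1 -> Ccontinuous (fun t => f (circle_pt r t)) t.
Proof.
  intros Hf Hr. apply (continuous_comp (circle_pt r) f).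
  - apply Ccontinuous_circle_pt.
  - apply Hf, unit_disc_circle_pt, Hr.
Qed.

(** With zeta = r e^(it) and d zeta = i zeta dt, this is 1/i times the contour integral of f(zeta) /
    (zeta - a)^n. *)
Definition cauchy_integral (f : C -> C) (r : R) (n : nat) (a : C) : C :=
  CInt (fun t => f (circle_pt r t) * circle_pt r t / (circle_pt r t - a) ^ n)%C 0 (2 * PI).

Lemma Ccontinuous_Cpow {T : UniformSpace} (f : T -> C) (n : nat) (x : T) :
  Ccontinuous f x -> Ccontinuous (fun y => f y ^ n)%C x.
Proof.
  intros H. induction n; simpl.
  - apply continuous_const.
  - apply Ccontinuous_mult; assumption.
Qed.

Lemma Cpow_neq_0 (z : C) (n : nat) : z <> RtoC 0 -> (z ^ n)%C <> RtoC 0.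
Proof.
  intros H. induction n; simpl; [apply C1_nz|apply Cmult_neq_0; assumption].
Qed.

Lemma circle_kernel_continuous (f : C -> C) (r : R) (n : nat) (a : C) (t : R) :
  disc_continuous f -> Cmod a < r -> r < 1 ->
  Ccontinuous (fun t => f (circle_pt r t) * circle_pt r t / (circle_pt r t - a) ^ n)%C t.
Proof.
  intros Hf Ha Hr. assert (Ha0 := Cmod_ge_0 a).
  assert (Hc := Ccontinuous_circle_comp f r t Hf ltac:(lra)).
  assert (Hz := Ccontinuous_circle_pt r t).
  apply (Ccontinuous_mult (fun t => f (circle_pt r t) * circle_pt r t)%C
    (fun t => / (circle_pt r t - a) ^ n)%C).
  - ccont.
  - apply Ccontinuous_inv.
    + apply (Ccontinuous_Cpow (fun t => circle_pt r t - a)%C). ccont.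
    + apply Cpow_neq_0, circle_pt_minus_neq_0, Ha.
Qed.

Lemma ex_circle_kernel (f : C -> C) (r : R) (n : nat) (a : C) :
  disc_continuous f -> Cmod a < r -> r < 1 ->
  ex_CInt (fun t => f (circle_pt r t) * circle_pt r t / (circle_pt r t - a) ^ n)%C 0 (2 * PI).
Proof.
  intros. apply ex_CInt_continuous. intros t _. apply circle_kernel_continuous; assumption.
Qed.

Lemma two_PI_pos : 0 < 2 * PI.
Proof. generalize PI_RGT_0; lra. Qed.

(** A quadratic remainder that is uniform in the parameter is all that differentiation under the
    integral needs; for Cauchy kernels it comes from an algebraic identity. *)
Lemma is_cderive_CInt (k k1 : R -> C -> C) (u v : R) (a : C) (d M : R) :
  u <= v -> 0 < d ->
  (forall h t, Cmod h < d -> u <= t <= v ->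
     Cmod (k t (a + h)%C - k t a - h * k1 t a) <= M * (Cmod h * Cmod h)) ->
  (forall h, Cmod h < d -> ex_CInt (fun t => k t (a + h)%C) u v) ->
  ex_CInt (fun t => k1 t a) u v ->
  is_cderive (fun z => CInt (fun t => k t z) u v) a (CInt (fun t => k1 t a) u v).
Proof.
  intros Huv Hd HM Hk Hk1. apply is_cderive_eps; intros eps He.
  set (N := (v - u) * Rabs M + 1).
  assert (HN : 0 < N).
  { unfold N. assert (0 <= (v - u) * Rabs M) by (apply Rmult_le_pos; [lra|apply Rabs_pos]). lra. }
  exists (Rmin d (eps / N)); split.
  { apply Rmin_pos; [lra|apply Rdiv_lt_0_compat; lra]. }
  intros w Hw.
  assert (H1 := Rlt_le_trans _ _ _ Hw (Rmin_l _ _)).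
  assert (H2 := Rlt_le_trans _ _ _ Hw (Rmin_r _ _)).
  set (h := (w - a)%C) in *.
  assert (Ew : w = (a + h)%C) by (unfold h; cring).
  assert (I1 := Hk h H1). rewrite <- Ew in I1.
  assert (I0 : ex_CInt (fun t => k t a) u v).
  { assert (I := Hk (RtoC 0)). rewrite Cmod_0 in I. specialize (I Hd).
    replace (a + 0)%C with a in I by cring. exact I. }
  assert (I2 : ex_CInt (fun t => h * k1 t a)%C u v).
  { destruct Hk1 as [l Hl]. exists (h * l)%C. apply is_CInt_mult_l, Hl. }
  rewrite <- CInt_mult_l by exact Hk1.
  rewrite <- CInt_minus by assumption.
  assert (I3 : ex_CInt (fun t => k t w - k t a)%C u v)
    by (apply (ex_RInt_minus (V := C_R_NormedModule)); assumption).
  rewrite <- CInt_minus by assumption.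
  eapply Rle_trans; [apply (Cmod_CInt_le_const _ (M * (Cmod h * Cmod h)))|].
  - exact Huv.
  - intros t Ht. rewrite Ew. apply HM; assumption.
  - apply (ex_RInt_minus (V := C_R_NormedModule)); assumption.
  - assert (Hh := Cmod_ge_0 h).
    apply Rle_trans with (N * Cmod h * Cmod h).
    + replace ((v - u) * (M * (Cmod h * Cmod h))) with ((v - u) * M * (Cmod h * Cmod h)) by ring.
      rewrite (Rmult_assoc N). apply Rmult_le_compat_r; [apply Rmult_le_pos; lra|].
      assert ((v - u) * M <= (v - u) * Rabs M) by (apply Rmult_le_compat_l; [lra|apply Rle_abs]).
      unfold N. lra.
    + apply Rmult_le_compat_r; [exact Hh|].
      apply Rle_trans with (N * (eps / N)); [apply Rmult_le_compat_l; lra|].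
      right; field; lra.
Qed.

Lemma disc_continuous_circle_bounded (f : C -> C) (r : R) :
  disc_continuous f -> 0 <= r < 1 ->
  exists M, 0 <= M /\ forall t, 0 <= t <= 2 * PI -> Cmod (f (circle_pt r t)) <= M.
Proof.
  intros Hf Hr.
  destruct (bounded_continuity (V := C_R_NormedModule) (fun t => f (circle_pt r t)) 0 (2 * PI))
    as [M HM].
  { intros t _. apply (Ccontinuous_circle_comp f r t Hf Hr). }
  exists (Rabs M). split; [apply Rabs_pos|]. intros t Ht.
  specialize (HM t Ht). rewrite <- Cmod_norm in HM.
  generalize (Rle_abs M). lra.
Qed.

Lemma Cmod_div_le (x y : C) (A b : R) :
  0 < b -> Cmod x <= A -> b <= Cmod y -> Cmod (x / y) <= A / b.
Proof.
  intros Hb Hx Hy.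
  assert (y <> RtoC 0) by (apply Cmod_gt_0; lra).
  rewrite Cmod_div by assumption.
  apply Rmult_le_compat; [apply Cmod_ge_0|left; apply Rinv_0_lt_compat; lra|exact Hx|].
  apply Rinv_le_contravar; assumption.
Qed.

(** With w = zeta - a, [remainder] is the error of the first-order expansion of (w - h)^-j divided
    by h^2. On the circle |w| is at most 2, and restricting h to half the distance from [a] to the
    circle keeps w - h away from zero. *)
Lemma is_cderive_circle_kernel (f : C -> C) (r : R) (a : C) (j : nat) (c : R)
    (remainder : C -> C -> C) (B : R) :
  disc_continuous f -> Cmod a < r -> r < 1 ->
  (forall w h, w <> RtoC 0 -> (w - h)%C <> RtoC 0 ->
    (/ (w - h) ^ j - / w ^ j - h * (c / w ^ S j))%C = (remainder w h * (h * h))%C) ->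
  (forall w h, r - Cmod a <= Cmod w <= 2 -> (r - Cmod a) / 2 <= Cmod (w - h) -> Cmod h <= 1 ->
    Cmod (remainder w h) <= B) ->
  is_cderive (cauchy_integral f r j) a (c * cauchy_integral f r (S j) a)%C.
Proof.
  intros Hf Ha Hr Hrem HB. assert (Ha0 := Cmod_ge_0 a).
  destruct (disc_continuous_circle_bounded f r Hf ltac:(lra)) as [M [HM0 HM]].
  set (e := r - Cmod a) in *. assert (He : 0 < e) by (unfold e; lra).
  assert (Hin : forall h, Cmod h < e / 2 -> Cmod (a + h) < r).
  { intros h Hh. eapply Rle_lt_trans; [apply Cmod_triangle|]. unfold e in *; lra. }
  unfold cauchy_integral at 2. rewrite <- CInt_mult_l by (apply ex_circle_kernel; assumption).
  apply (is_cderive_CInt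
    (fun t a => f (circle_pt r t) * circle_pt r t / (circle_pt r t - a) ^ j)%C
    (fun t a => c * (f (circle_pt r t) * circle_pt r t / (circle_pt r t - a) ^ S j))%C
    0 (2 * PI) a (e / 2) (M * r * B)).
  - left; apply two_PI_pos.
  - lra.
  - intros h t Hh Ht.
    assert (Hn := circle_pt_minus_neq_0 r t a Ha).
    assert (Hn2 := circle_pt_minus_neq_0 r t _ (Hin h Hh)).
    assert (Hz : Cmod (circle_pt r t) = r) by (apply Cmod_circle_pt; lra).
    specialize (HM t Ht). set (z := circle_pt r t) in *.
    replace (z - (a + h))%C with (z - a - h)%C in * by cring.
    assert (W1 := Cmod_triangle_inv z a). assert (W2 := Cmod_triangle_inv (z - a) h).
    assert (W3 := Cmod_minus_triangle z a).
    specialize (HB (z - a)%C h ltac:(unfold e; lra) ltac:(unfold e in *; lra)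
      ltac:(unfold e in *; lra)).
    replace (f z * z / (z - a - h) ^ j - f z * z / (z - a) ^ j - h * (c * (f z * z / (z - a) ^ S j)))%C
      with (f z * z * (/ (z - a - h) ^ j - / (z - a) ^ j - h * (c / (z - a) ^ S j)))%C
      by (unfold Cdiv; cring).
    rewrite Hrem, !Cmod_mult, Hz by assumption. rewrite <- !Rmult_assoc.
    repeat (apply Rmult_le_compat_r; [apply Cmod_ge_0|]).
    apply Rmult_le_compat; [apply Rmult_le_pos; [apply Cmod_ge_0|lra]|apply Cmod_ge_0| |exact HB].
    apply Rmult_le_compat_r; lra.
  - intros h Hh. apply ex_circle_kernel; try assumption. apply Hin, Hh.
  - destruct (ex_circle_kernel f r (S j) a Hf Ha Hr) as [l Hl]. eexists. apply is_CInt_mult_l, Hl.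
Qed.

Lemma is_cderive_circle_kernel_1 (f : C -> C) (r : R) (a : C) :
  disc_continuous f -> Cmod a < r -> r < 1 ->
  is_cderive (cauchy_integral f r 1) a (cauchy_integral f r 2 a).
Proof.
  intros Hf Ha Hr. set (e := r - Cmod a).
  rewrite <- (Cmult_1_l (cauchy_integral f r 2 a)).
  apply (is_cderive_circle_kernel f r a 1 1 (fun w h => 1 / (w * w * (w - h)))%C
    (1 / (e * e * (e / 2)))); try assumption.
  - intros w h Hw Hwh. simpl. cfield. split; assumption.
  - intros w h Hw Hwh _. fold e in Hw, Hwh. assert (0 < e) by (unfold e; lra).
    apply Cmod_div_le; [repeat apply Rmult_lt_0_compat; lra|rewrite Cmod_1; lra|].
    rewrite !Cmod_mult. repeat apply Rmult_le_compat; try lra. apply Rmult_le_pos; lra.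
Qed.

Lemma is_cderive_circle_kernel_2 (f : C -> C) (r : R) (a : C) :
  disc_continuous f -> Cmod a < r -> r < 1 ->
  is_cderive (cauchy_integral f r 2) a (2 * cauchy_integral f r 3 a)%C.
Proof.
  intros Hf Ha Hr. set (e := r - Cmod a).
  (* The numerator 3 w - 2 h is at most 3 * 2 + 2 * 1 = 8 in modulus. *)
  apply (is_cderive_circle_kernel f r a 2 2
    (fun w h => (3 * w - 2 * h) / (w * w * w * (w - h) * (w - h)))%C
    (8 / (e * e * e * (e / 2) * (e / 2)))); try assumption.
  - intros w h Hw Hwh. simpl. cfield. split; assumption.
  - intros w h Hw Hwh Hh. fold e in Hw, Hwh. assert (0 < e) by (unfold e; lra).
    apply Cmod_div_le; [repeat apply Rmult_lt_0_compat; lra| |].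
    + eapply Rle_trans; [apply Cmod_minus_triangle|].
      rewrite !Cmod_mult, !Cmod_R, !Rabs_pos_eq by lra. lra.
    + rewrite !Cmod_mult. repeat apply Rmult_le_compat; try lra;
      repeat apply Rmult_le_pos; lra.
Qed.

(** The two integrands differ by the derivative of -i F(zeta) / (zeta - a) along the circle, and
    this function returns to its initial value. *)
Lemma circle_kernel_by_parts (F f : C -> C) (r : R) (a : C) :
  disc_continuous f -> (forall z, unit_disc z -> is_cderive F z (f z)) ->
  Cmod a < r -> r < 1 ->
  cauchy_integral F r 2 a = cauchy_integral f r 1 a.
Proof.
  intros Hf HF Ha Hr. assert (Ha0 := Cmod_ge_0 a).
  assert (HFc : disc_continuous F)
    by (intros z Hz; eapply is_cderive_continuous, HF, Hz).
  assert (E : (cauchy_integral f r 1 a - cauchy_integral F r 2 a)%C = RtoC 0).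
  { unfold cauchy_integral.
    rewrite <- CInt_minus by (apply ex_circle_kernel; assumption).
    apply (CInt_closed_curve (fun t => F (circle_pt r t) * (- Ci / (circle_pt r t - a)))%C).
    - intros t. assert (Hn := circle_pt_minus_neq_0 r t a Ha).
      set (z := circle_pt r t) in *.
      replace (f z * z / (z - a) ^ 1 - F z * z / (z - a) ^ 2)%C with
        ((Ci * z) * (f z * (- Ci / (z - a)) + F z * (Ci / ((z - a) * (z - a)))))%C.
      + apply (is_curve_derive_comp (fun w => F w * (- Ci / (w - a)))%C (circle_pt r));
          [|apply is_curve_derive_circle_pt].
        apply (is_cderive_mult F (fun w => - Ci / (w - a))%C); [apply HF, unit_disc_circle_pt; lra|].
        cderive; [exact Hn|]. cfield. exact Hn.
      + transitivity ((- (Ci * Ci)) * (f z * z / (z - a) ^ 1 - F z * z / (z - a) ^ 2))%C;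
          [simpl; cfield; exact Hn|]. rewrite Ci_sqr. cring.
    - intros t. apply (Ccontinuous_minus (fun t => f (circle_pt r t) * circle_pt r t / (circle_pt r t - a) ^ 1)%C); apply circle_kernel_continuous; assumption.
    - rewrite circle_pt_closed. reflexivity. }
  replace (cauchy_integral f r 1 a) with
    (cauchy_integral f r 1 a - cauchy_integral F r 2 a + cauchy_integral F r 2 a)%C by cring.
  rewrite E. cring.
Qed.

Lemma circle_pt_scal (c r t : R) : circle_pt (c * r) t = (RtoC c * circle_pt r t)%C.
Proof. unfold circle_pt, Cmult, RtoC; cbn [fst snd]. f_equal; ring. Qed.

(** The derivative in [a] is the order-two integral of the constant 1, which vanishes by parts, and
    at the centre the integrand is 1. Since the kernel is homogeneous it can be rescaled to radius
    1/2; hence there is no restriction on [r], and the Poisson kernel becomes available on the unit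
    circle itself. *)
Lemma CInt_circle_kernel (r : R) (a : C) :
  Cmod a < r ->
  CInt (fun t => circle_pt r t / (circle_pt r t - a))%C 0 (2 * PI) = RtoC (2 * PI).
Proof.
  intros Ha. assert (Ha0 := Cmod_ge_0 a).
  set (K := cauchy_integral (fun _ => RtoC 1) (/ 2)).
  assert (H1 : disc_continuous (fun _ => RtoC 1)) by (intros z _; apply continuous_const).
  set (b := (RtoC (/ (2 * r)) * a)%C).
  assert (Hb : Cmod b < / 2).
  { unfold b. assert (0 < / (2 * r)) by (apply Rinv_0_lt_compat; lra).
    rewrite Cmod_mult, Cmod_R, Rabs_pos_eq by lra.
    replace (/ 2) with (/ (2 * r) * r) by (field; lra). apply Rmult_lt_compat_l; lra. }
  assert (K2 : forall z, Cmod z < / 2 -> K 2%nat z = RtoC 0).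
  { intros z Hz. unfold K.
    rewrite (circle_kernel_by_parts _ (fun _ => RtoC 0)) by
      (try exact Hz; try lra; intros u _; (apply continuous_const || apply is_cderive_const)).
    transitivity (CInt (fun _ => RtoC 0) 0 (2 * PI)).
    - apply CInt_ext. intros t _. unfold Cdiv. cring.
    - rewrite (RInt_const (V := C_R_CompleteNormedModule)).
      transitivity (RtoC (2 * PI - 0) * 0)%C; [apply scal_C_R|cring]. }
  assert (Hg : K 1%nat (RtoC 0 + RtoC 0 * (b - 0))%C = K 1%nat (RtoC 0 + RtoC 1 * (b - 0))%C).
  { apply (curve_constant (fun x => K 1%nat (RtoC 0 + RtoC x * (b - 0))%C)). intros x Hx.
    assert (Hxb : Cmod (0 + x * (b - 0)) < / 2).
    { replace (0 + x * (b - 0))%C with (RtoC x * b)%C by cring.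
      rewrite Cmod_mult, Cmod_R, Rabs_pos_eq by lra.
      assert (x * Cmod b <= 1 * Cmod b) by (apply Rmult_le_compat_r; [apply Cmod_ge_0|lra]). lra. }
    assert (D := is_curve_derive_comp (K 1%nat) (fun x : R => 0 + x * (b - 0))%C x _ _
      (is_cderive_circle_kernel_1 (fun _ => RtoC 1) (/ 2) _ H1 Hxb ltac:(lra))
      (is_curve_derive_segment (RtoC 0) b x)).
    fold (K 2%nat (0 + x * (b - 0))%C) in D. rewrite K2, Cmult_0_r in D by exact Hxb.
    exact D. }
  transitivity (K 1%nat (RtoC 0 + RtoC 1 * (b - 0))%C).
  - apply CInt_ext. intros t _.
    replace r with (2 * r * / 2) at 1 2 by field. rewrite circle_pt_scal.
    replace a with (RtoC (2 * r) * b)%C.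
    + replace (0 + 1 * (b - 0))%C with b by cring.
      assert (Hn := circle_pt_minus_neq_0 (/ 2) t b Hb).
      assert (Hr : RtoC (2 * r) <> RtoC 0) by (intros E; injection E; lra).
      simpl. cfield. split; [exact Hn|].
      replace (RtoC (2 * r) * circle_pt (/ 2) t - RtoC (2 * r) * b)%C with
        (RtoC (2 * r) * (circle_pt (/ 2) t - b))%C by cring.
      apply Cmult_neq_0; assumption.
    + unfold b. rewrite RtoC_inv by lra. cfield. intros E; injection E; lra.
  - rewrite <- Hg. transitivity (CInt (fun _ => RtoC 1) 0 (2 * PI)).
    + apply CInt_ext. intros t _.
      assert (Hn := circle_pt_minus_neq_0 (/ 2) t (RtoC 0)). rewrite Cmod_0 in Hn.
      specialize (Hn ltac:(lra)).
      replace (0 + 0 * (b - 0))%C with (RtoC 0) by cring. simpl. cfield.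
      replace (circle_pt (/ 2) t) with (circle_pt (/ 2) t - 0)%C by cring. exact Hn.
    + rewrite (RInt_const (V := C_R_CompleteNormedModule)).
      transitivity (RtoC (2 * PI - 0) * 1)%C; [apply scal_C_R|].
      rewrite Rminus_0_r. cring.
Qed.

(** The circle is contracted to [a] along segments. Differentiation in the contraction parameter
    cancels the denominator zeta - a, and what remains integrates to zero because it is the
    derivative of a closed curve. The derivative [f] of [F] has to be continuous for this. *)
Lemma circle_kernel_homotopy (F f : C -> C) (r : R) (a : C) :
  disc_continuous f -> (forall z, unit_disc z -> is_cderive F z (f z)) ->
  Cmod a < r -> r < 1 ->
  cauchy_integral F r 1 a = (F a * RtoC (2 * PI))%C.
Proof.
  intros Hf HF Ha Hr1. assert (Ha0 := Cmod_ge_0 a).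
  assert (HFc : disc_continuous F)
    by (intros z Hz; eapply is_cderive_continuous, HF, Hz).
  (* A margin that keeps the dilated circle inside the disc for x slightly outside [0, 1], so that
     two-sided derivatives exist at both ends. *)
  set (e := (/ r - 1) / 2).
  assert (He : 0 < e).
  { assert (1 < / r) by (apply Rmult_lt_reg_r with r; [lra|]; rewrite Rinv_l; lra). unfold e; lra. }
  assert (Her : (1 + 2 * e) * r = 1) by (unfold e; field; lra).
  assert (Hd : forall x t, - e < x < 1 + e -> unit_disc (a + RtoC x * (circle_pt r t - a))%C).
  { intros x t Hx. unfold unit_disc.
    replace (a + x * (circle_pt r t - a))%C with (RtoC (1 - x) * a + RtoC x * circle_pt r t)%C
      by (rewrite RtoC_minus; cring).
    eapply Rle_lt_trans; [apply Cmod_triangle|].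
    rewrite !Cmod_mult, !Cmod_R, Cmod_circle_pt by lra.
    apply Rle_lt_trans with (Rabs (1 - x) * r + Rabs x * r).
    - apply Rplus_le_compat_r, Rmult_le_compat_l; [apply Rabs_pos|lra].
    - apply Rlt_le_trans with ((1 + 2 * e) * r); [|lra].
      rewrite <- Rmult_plus_distr_r. apply Rmult_lt_compat_r; [lra|].
      unfold Rabs. destruct (Rcase_abs (1 - x)), (Rcase_abs x); lra. }
  set (path := fun (x t : R) => (a + RtoC x * (circle_pt r t - a))%C).
  set (ker := fun t : R => (circle_pt r t / (circle_pt r t - a))%C).
  assert (Hk : forall t, Ccontinuous ker t).
  { intros t. unfold ker. assert (Hz := Ccontinuous_circle_pt r t). ccont.
    apply circle_pt_minus_neq_0, Ha. }
  set (g := fun x : R => CInt (fun t => F (path x t) * ker t)%C 0 (2 * PI)).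
  assert (Hpc : forall x t, Ccontinuous (path x) t).
  { intros x t. unfold path. assert (Hz := Ccontinuous_circle_pt r t). ccont. }
  assert (Hg : g 0 = g 1).
  { apply curve_constant. intros x Hx.
    assert (Hcx : forall t, Ccontinuous (fun t => f (path x t) * circle_pt r t)%C t).
    { intros t. assert (Hz := Ccontinuous_circle_pt r t).
      apply Ccontinuous_mult; [|exact Hz].
      apply (continuous_comp (path x) f); [apply Hpc|apply Hf, Hd; lra]. }
    replace (RtoC 0) with (CInt (fun t => f (path x t) * circle_pt r t)%C 0 (2 * PI)).
    - unfold g.
      apply (is_curve_derive_CInt_2d (fun x t => F (path x t) * ker t)%C
        (fun x t => f (path x t) * circle_pt r t)%C 0 (2 * PI) x e He).
      + intros y t Hy. apply Rabs_def2 in Hy.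
        assert (Hn := circle_pt_minus_neq_0 r t a Ha).
        replace (f (path y t) * circle_pt r t)%C with
          ((circle_pt r t - a) * (f (path y t) * ker t))%C by (unfold ker; cfield; exact Hn).
        apply (is_curve_derive_comp (fun w => F w * ker t)%C (fun x => path x t)).
        * eapply is_cderive_eq; [apply is_cderive_mult; [apply HF, Hd; lra|apply is_cderive_const]|].
          unfold path; cbv beta; cring.
        * apply is_curve_derive_segment.
      + intros t. 
        assert (Hz := Ccontinuous_snd_comp (circle_pt r) (x, t) (Ccontinuous_circle_pt r t)).
        assert (Hx' := Ccontinuous_fst_RtoC (x, t)).
        apply Ccontinuous_mult; [|exact Hz].
        apply (continuous_comp (fun q : R * R => path (fst q) (snd q)) f).
        * unfold path. ccont.
        * apply Hf, Hd. cbn [fst]. lra.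
      + intros y Hy. apply Rabs_def2 in Hy. apply ex_CInt_continuous. intros t _.
        apply Ccontinuous_mult; [|apply Hk].
        apply (continuous_comp (path y) F); [apply Hpc|apply HFc, Hd; lra].
      + apply ex_CInt_continuous. intros t _. apply Hcx.
    (* The antiderivative -i F(path) / x degenerates at x = 0, where the integrand minus constants
       is f(a) zeta and has its own antiderivative. *)
    - destruct (Req_dec x 0) as [E|E].
      + apply (CInt_closed_curve (fun t => f a * (- Ci * circle_pt r t))%C);
          [|exact Hcx|rewrite circle_pt_closed; reflexivity].
        intros t. replace (path x t) with a by (unfold path; rewrite E; cring).
        replace (f a * circle_pt r t)%C with ((Ci * circle_pt r t) * (f a * - Ci))%C.
        * apply (is_curve_derive_comp (fun w => f a * (- Ci * w))%C (circle_pt r));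
            [|apply is_curve_derive_circle_pt].
          cderive. cring.
        * transitivity (- (Ci * Ci) * (f a * circle_pt r t))%C; [cring|].
          rewrite Ci_sqr. cring.
      + assert (Ex : RtoC x <> RtoC 0) by (intros H; apply E; injection H; trivial).
        apply (CInt_closed_curve (fun t => F (path x t) * (- Ci / x))%C);
          [|exact Hcx|unfold path; rewrite circle_pt_closed; reflexivity].
        intros t.
        replace (f (path x t) * circle_pt r t)%C with
          ((Ci * circle_pt r t * x) * (f (path x t) * (- Ci / x)))%C.
        * apply (is_curve_derive_comp (fun w => F w * (- Ci / x))%C (path x)).
          -- eapply is_cderive_eq; [apply is_cderive_mult; [apply HF, Hd; lra|apply is_cderive_const]|].
             unfold path; cbv beta; cring.
          -- apply (is_curve_derive_comp (fun w => a + x * (w - a))%C (circle_pt r));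
             [|apply is_curve_derive_circle_pt].
             cderive. cring.
        * transitivity (- (Ci * Ci) * (f (path x t) * circle_pt r t))%C; [cfield; exact Ex|].
          rewrite Ci_sqr. cring. }
  unfold cauchy_integral. transitivity (g 1).
  - apply CInt_ext. intros t _. unfold path, ker.
    replace (a + 1 * (circle_pt r t - a))%C with (circle_pt r t) by cring.
    assert (Hn := circle_pt_minus_neq_0 r t a Ha). simpl. cfield. exact Hn.
  - rewrite <- Hg. rewrite <- (CInt_circle_kernel r a Ha).
    rewrite <- CInt_mult_l by (apply ex_CInt_continuous; intros; apply Hk).
    apply CInt_ext. intros t _. unfold path.
    replace (a + 0 * (circle_pt r t - a))%C with a by cring. reflexivity.
Qed.

Lemma holomorphic_disc_continuous (f : C -> C) : holomorphic f -> disc_continuous f.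
Proof. intros Hf z Hz. apply holomorphic_continuous; assumption. Qed.

Lemma is_cderive_div_const (f : C -> C) (z l c : C) :
  is_cderive f z l -> is_cderive (fun w => f w / c)%C z (l / c)%C.
Proof.
  intros H. eapply is_cderive_eq.
  - apply (is_cderive_mult f (fun _ => / c)%C); [exact H|apply is_cderive_const].
  - cbv beta. unfold Cdiv. cring.
Qed.

Lemma RtoC_2PI_neq_0 : RtoC (2 * PI) <> RtoC 0.
Proof. intros H. injection H. generalize two_PI_pos; lra. Qed.

Lemma near_in_disc_of_radius (r : R) (a : C) :
  Cmod a < r -> exists d, 0 < d /\ forall w, Cmod (w - a) < d -> Cmod w < r.
Proof.
  intros Ha. exists (r - Cmod a). split; [lra|]. intros w Hw.
  assert (H := Cmod_triangle_inv w a). lra.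
Qed.

(** Nothing is known yet about continuity of f', so the homotopy is applied not to [f] but to its
    primitive [F], whose derivative is continuous. Differentiating the formula for [F] gives the
    order-two integral of [F], which integration by parts turns into the order-one integral of
    [f]. *)
Lemma cauchy_formula (f : C -> C) (r : R) (a : C) :
  holomorphic f -> Cmod a < r -> r < 1 ->
  f a = (cauchy_integral f r 1 a / RtoC (2 * PI))%C.
Proof.
  intros Hf Ha Hr.
  assert (Hc := holomorphic_disc_continuous f Hf).
  set (F := segment_integral f (RtoC 0)).
  assert (HF : forall z, unit_disc z -> is_cderive F z (f z))
    by (intros; apply is_cderive_segment_integral; assumption).
  assert (HFc : disc_continuous F)
    by (intros z Hz; eapply is_cderive_continuous, HF, Hz).
  apply (is_cderive_unique F a).
  - apply HF. unfold unit_disc; lra.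
  - rewrite <- (circle_kernel_by_parts F f) by assumption.
    apply (is_cderive_ext_loc (fun z => cauchy_integral F r 1 z / RtoC (2 * PI))%C).
    + destruct (near_in_disc_of_radius r a Ha) as [d [Hd H]]. exists d. split; [exact Hd|].
      intros w Hw. rewrite (circle_kernel_homotopy F f) by (try assumption; apply H, Hw).
      cfield. apply RtoC_2PI_neq_0.
    + apply is_cderive_div_const, is_cderive_circle_kernel_1; assumption.
Qed.

Lemma cauchy_formula_derive (f : C -> C) (r : R) (a : C) :
  holomorphic f -> Cmod a < r -> r < 1 ->
  C_derive f a = (cauchy_integral f r 2 a / RtoC (2 * PI))%C.
Proof.
  intros Hf Ha Hr. apply is_C_derive_unique.
  apply (is_cderive_ext_loc (fun z => cauchy_integral f r 1 z / RtoC (2 * PI))%C).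
  - destruct (near_in_disc_of_radius r a Ha) as [d [Hd H]]. exists d. split; [exact Hd|].
    intros w Hw. symmetry. apply cauchy_formula; try assumption. apply H, Hw.
  - apply is_cderive_div_const, is_cderive_circle_kernel_1; try assumption.
    apply holomorphic_disc_continuous, Hf.
Qed.

Lemma holomorphic_C_derive (f : C -> C) : holomorphic f -> holomorphic (C_derive f).
Proof.
  intros Hf z Hz. unfold unit_disc in Hz. set (r := (1 + Cmod z) / 2).
  eexists.
  apply (is_cderive_ext_loc (fun z => cauchy_integral f r 2 z / RtoC (2 * PI))%C).
  - destruct (near_in_disc_of_radius r z) as [d [Hd H]]; [unfold r; lra|].
    exists d. split; [exact Hd|].
    intros w Hw. symmetry. apply cauchy_formula_derive; [exact Hf|apply H, Hw|unfold r; lra].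
  - apply is_cderive_div_const, is_cderive_circle_kernel_2; [|unfold r; lra|unfold r; lra].
    apply holomorphic_disc_continuous, Hf.
Qed.

(** * The operator T *)

Lemma holomorphic_mult (f g : C -> C) :
  holomorphic f -> holomorphic g -> holomorphic (fun z => f z * g z)%C.
Proof.
  intros Hf Hg z Hz. eexists.
  apply is_cderive_mult; apply holomorphic_is_cderive; assumption.
Qed.

Lemma T_segment_integral (g f : C -> C) (z : C) :
  T g f z = segment_integral (fun w => f w * C_derive g w)%C (RtoC 0) z.
Proof.
  unfold T, segment_integral. apply CInt_ext. intros s _.
  replace (0 + s * (z - 0))%C with (s * z)%C by cring.
  replace (z - 0)%C with z by cring. reflexivity.
Qed.

Lemma is_cderive_T (g f : C -> C) (z : C) :
  holomorphic f -> holomorphic g -> unit_disc z ->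
  is_cderive (T g f) z (f z * C_derive g z)%C.
Proof.
  intros Hf Hg Hz.
  apply (is_cderive_ext_loc (segment_integral (fun w => f w * C_derive g w)%C (RtoC 0))).
  - exists 1. split; [lra|]. intros w _. symmetry. apply T_segment_integral.
  - apply (is_cderive_segment_integral (fun w => f w * C_derive g w)%C); [|exact Hz].
    apply holomorphic_mult; [exact Hf|apply holomorphic_C_derive, Hg].
Qed.

Lemma holomorphic_T (g f : C -> C) :
  holomorphic f -> holomorphic g -> holomorphic (T g f).
Proof. intros Hf Hg z Hz. eexists. apply is_cderive_T; assumption. Qed.

Lemma T_primitive (g f F : C -> C) :
  holomorphic f -> holomorphic g ->
  (forall z, unit_disc z -> is_cderive F z (f z * C_derive g z)%C) ->
  forall z, unit_disc z -> T g f z = (F z - F (RtoC 0))%C.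
Proof.
  intros Hf Hg HF z Hz. rewrite T_segment_integral.
  apply segment_integral_primitive; try assumption; [|apply unit_disc_0].
  apply holomorphic_disc_continuous, holomorphic_mult;
    [exact Hf|apply holomorphic_C_derive, Hg].
Qed.

Lemma near_in_disc (z : C) :
  unit_disc z -> exists d, 0 < d /\ forall w, Cmod (w - z) < d -> unit_disc w.
Proof. apply near_in_disc_of_radius. Qed.

Lemma C_derive_of_T_representation (g h k : C -> C) (c z : C) :
  holomorphic k -> holomorphic h ->
  (forall w, unit_disc w -> g w = (T h k w + c)%C) ->
  unit_disc z -> C_derive g z = (k z * C_derive h z)%C.
Proof.
  intros Hk Hh Hg Hz. apply is_C_derive_unique.
  destruct (near_in_disc z Hz) as [d [Hd Hn]].
  apply (is_cderive_ext_loc (fun w => T h k w + c)%C).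
  - exists d. split; [exact Hd|]. intros w Hw. symmetry. apply Hg, Hn, Hw.
  - eapply is_cderive_eq.
    + apply (is_cderive_plus (T h k) (fun _ => c)); [apply is_cderive_T; assumption|apply is_cderive_const].
    + cring.
Qed.

Lemma hardy_iff (p : R) (f : C -> C) :
  hardy p f <->
  holomorphic f /\ exists M, forall r, 0 <= r < 1 -> integral_mean p f r <= M.
Proof.
  unfold hardy, hardy_normp.
  set (E := fun x => exists r : R, 0 <= r < 1 /\ x = integral_mean p f r).
  destruct (Lub_Rbar_correct E) as [Hub Hlub].
  split; intros [Hf H]; (split; [exact Hf|]).
  - destruct (Lub_Rbar E) as [M| |] eqn:EM; [|contradiction|].
    + exists M. intros r Hr. apply (Hub (integral_mean p f r)). exists r. split; auto.
    + exfalso. apply (Hub (integral_mean p f 0)). exists 0. split; [lra|auto].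
  - destruct H as [M HM].
    apply Rbar_le_lt_trans with (Finite M); [|exact I].
    apply Hlub. intros x [r [Hr ->]]. apply HM, Hr.
Qed.

(** The representations differentiate to g1' = k1 g2' and g2' = k2 g1'; as g1' has no zero, k1 k2 =
    1. *)
Lemma representation_inverse (g1 g2 k1 k2 : C -> C) (c1 c2 : C) :
  holomorphic k1 -> holomorphic k2 -> locally_univalent g1 -> locally_univalent g2 ->
  (forall z, unit_disc z -> g1 z = (T g2 k1 z + c1)%C) ->
  (forall z, unit_disc z -> g2 z = (T g1 k2 z + c2)%C) ->
  forall z, unit_disc z -> k1 z <> 0%C /\ k2 z = (1 / k1 z)%C.
Proof.
  intros H1 H2 [Hg1 Hn1] [Hg2 Hn2] E1 E2 z Hz.
  assert (D1 := C_derive_of_T_representation g1 g2 k1 c1 z H1 Hg2 E1 Hz).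
  assert (D2 := C_derive_of_T_representation g2 g1 k2 c2 z H2 Hg1 E2 Hz).
  specialize (Hn1 z Hz). specialize (Hn2 z Hz).
  assert (Hk : k1 z <> 0%C).
  { intros E. apply Hn1. rewrite D1, E. cring. }
  split; [exact Hk|].
  assert (P : (k1 z * k2 z)%C = RtoC 1).
  { replace (k1 z * k2 z)%C with (k1 z * (k2 z * C_derive g1 z) / C_derive g1 z)%C
      by (cfield; exact Hn1).
    rewrite <- D2, <- D1. cfield. exact Hn1. }
  replace (k2 z) with (k1 z * k2 z / k1 z)%C by (cfield; exact Hk). rewrite P. reflexivity.
Qed.

(** * Superharmonic functions of a pair of holomorphic functions *)

Definition continuous_2d_at (h : R -> R -> R) (x t : R) : Prop :=
  continuous (fun q : R * R => h (fst q) (snd q)) (x, t).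

Lemma continuous_2d_slice (h : R -> R -> R) (x t : R) :
  continuous_2d_at h x t -> continuous (h x) t.
Proof.
  intros H. apply (continuous_comp_2 (fun _ : R => x) (fun t : R => t) h);
    [apply continuous_const|apply continuous_id|].
  exact H.
Qed.

Lemma RInt_le_0 (h : R -> R) (a b : R) :
  a <= b -> (forall t, continuous h t) -> (forall t, h t <= 0) -> RInt h a b <= 0.
Proof.
  intros Hab Hc Hh. replace 0 with (RInt (fun _ => 0) a b).
  - apply RInt_le; [exact Hab| |apply ex_RInt_const|intros; apply Hh].
    apply ex_RInt_Rcontinuous; intros; apply Hc.
  - rewrite RInt_const. unfold scal; simpl; unfold mult; simpl. ring.
Qed.

(* A function with non-positive Laplacian in logarithmic polar coordinates
   (tau, t) has circular means that are concave in tau; being bounded near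
   tau = -oo, they decrease. *)
Lemma mean_superharmonic (V V1 V2 V11 V22 : R -> R -> R) (K tau1 : R) :
  (forall x t, x < 0 -> is_derive (fun x => V x t) x (V1 x t)) ->
  (forall x t, x < 0 -> is_derive (fun x => V1 x t) x (V11 x t)) ->
  (forall x t, x < 0 -> is_derive (V x) t (V2 x t)) ->
  (forall x t, x < 0 -> is_derive (V2 x) t (V22 x t)) ->
  (forall x t, x < 0 -> continuous_2d_at V1 x t) ->
  (forall x t, x < 0 -> continuous_2d_at V11 x t) ->
  (forall x t, x < 0 -> continuous_2d_at V22 x t) ->
  (forall x, x < 0 -> V2 x (2 * PI) = V2 x 0) ->
  (forall x t, x < 0 -> V11 x t + V22 x t <= 0) ->
  (forall x t, x < 0 -> x <= tau1 -> Rabs (V x t) <= K) ->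
  forall x, x < 0 -> RInt (V x) 0 (2 * PI) <= 2 * PI * K.
Proof.
  intros D1 D11 D2 D22 C1 C11 C22 P2 L HK.
  assert (Hpi := two_PI_pos).
  set (m := fun x => RInt (V x) 0 (2 * PI)).
  set (m1 := fun x => RInt (V1 x) 0 (2 * PI)).
  set (m11 := fun x => RInt (V11 x) 0 (2 * PI)).
  assert (CV : forall x t, x < 0 -> continuous (V x) t).
  { intros x t Hx. apply ex_derive_Rcontinuous.
    eexists. apply D2, Hx. }
  assert (IV : forall x, x < 0 -> ex_RInt (V x) 0 (2 * PI)).
  { intros x Hx. apply ex_RInt_Rcontinuous. intros; apply CV, Hx. }
  assert (I1 : forall x, x < 0 -> ex_RInt (V1 x) 0 (2 * PI)).
  { intros x Hx. apply ex_RInt_Rcontinuous.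
    intros; apply continuous_2d_slice, C1, Hx. }
  assert (Habs : forall x y, x < 0 -> Rabs (y - x) < - x -> y < 0)
    by (intros x y Hx Hy; apply Rabs_def2 in Hy; lra).
  assert (Dm : forall x, x < 0 -> is_derive m x (m1 x)).
  { intros x Hx. apply (is_derive_RInt_2d V V1 0 (2 * PI) x (- x)); [lra| | |].
    - intros y t Hy. apply D1, (Habs x); assumption.
    - intros t. apply C1, Hx.
    - intros y Hy. apply IV, (Habs x); assumption. }
  assert (Dm1 : forall x, x < 0 -> is_derive m1 x (m11 x)).
  { intros x Hx. apply (is_derive_RInt_2d V1 V11 0 (2 * PI) x (- x)); [lra| | |].
    - intros y t Hy. apply D11, (Habs x); assumption.
    - intros t. apply C11, Hx.
    - intros y Hy. apply I1, (Habs x); assumption. }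
  assert (Hm11 : forall x, x < 0 -> m11 x <= 0).
  { intros x Hx.
    (* By periodicity the angular second derivative has mean zero, so [m11] is the mean of the whole
       Laplacian. *)
    assert (I22 : is_RInt (V22 x) 0 (2 * PI) (V2 x (2 * PI) - V2 x 0)).
    { apply (is_RInt_derive (V := R_CompleteNormedModule) (V2 x)).
      - intros t _. apply D22, Hx.
      - intros t _. apply continuous_2d_slice, C22, Hx. }
    rewrite P2, Rminus_diag in I22 by exact Hx.
    assert (E : m11 x = RInt (fun t => V11 x t + V22 x t) 0 (2 * PI)).
    { rewrite (RInt_plus (V := R_CompleteNormedModule) (V11 x) (V22 x)).
      - rewrite (is_RInt_unique _ _ _ _ I22). symmetry. apply Rplus_0_r.
      - apply ex_RInt_Rcontinuous.
        intros; apply continuous_2d_slice, C11, Hx.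
      - eexists; exact I22. }
    rewrite E. apply RInt_le_0; [lra| |intros; apply L, Hx].
    intros t. apply (continuous_Rplus (V11 x) (V22 x));
      apply continuous_2d_slice; [apply C11, Hx|apply C22, Hx]. }
  assert (MVT : forall (f df : R -> R) x y, x < y -> y < 0 ->
     (forall z, z < 0 -> is_derive f z (df z)) -> exists z, x <= z <= y /\ f y - f x = df z * (y - x)).
  { intros f df x y Hxy Hy Hf.
    destruct (MVT_gen f x y df) as [z [Hz E]].
    - intros z Hz. rewrite Rmin_left, Rmax_right in Hz by lra. apply Hf; lra.
    - intros z Hz. rewrite Rmin_left, Rmax_right in Hz by lra.
      apply continuity_pt_filterlim.
      apply ex_derive_Rcontinuous.
      eexists. apply Hf; lra.
    - rewrite Rmin_left, Rmax_right in Hz by lra. exists z. split; [lra|exact E]. }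
  assert (Hmb : forall x, x < 0 -> x <= tau1 -> Rabs (m x) <= 2 * PI * K).
  { intros x Hx Hx1. unfold m.
    eapply Rle_trans; [apply (abs_RInt_le_const (V x) 0 (2 * PI) K)|].
    - lra.
    - apply IV, Hx.
    - intros t _. apply HK; assumption.
    - right; ring. }
  assert (Hm1 : forall x, x < 0 -> m1 x <= 0).
  { intros x Hx. apply Rnot_lt_le. intros Hpos.
    (* By concavity the slope to the left of [x] is at least [m1 x]. Going left by K' / m1 x
       therefore lowers [m] below -2 pi K, against its bound near -oo. *)
    set (K' := Rabs (m x) + 2 * PI * K + 1).
    assert (HK' : 0 < K').
    { assert (Hb : 0 <= 2 * PI * K).
      { set (y := Rmin x tau1). assert (y <= x) by apply Rmin_l. assert (y <= tau1) by apply Rmin_r.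
        assert (H' := Hmb y ltac:(lra) ltac:(lra)). generalize (Rabs_pos (m y)); lra. }
      unfold K'. generalize (Rabs_pos (m x)); lra. }
    set (y := Rmin (x - K' / m1 x) tau1).
    assert (Hq : 0 < K' / m1 x) by (apply Rdiv_lt_0_compat; lra).
    assert (Hy1 : y <= x - K' / m1 x) by apply Rmin_l.
    assert (Hy2 : y <= tau1) by apply Rmin_r.
    destruct (MVT m m1 y x ltac:(lra) Hx Dm) as [z [Hz E]].
    assert (Hz1 : m1 x <= m1 z).
    { destruct (Req_dec z x) as [->|Hne]; [lra|].
      destruct (MVT m1 m11 z x ltac:(lra) Hx Dm1) as [w [Hw E']].
      assert (m11 w * (x - z) <= 0); [|lra].
      assert (H' := Hm11 w ltac:(lra)). 
      replace 0 with (0 * (x - z)) by ring. apply Rmult_le_compat_r; lra. }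
    assert (Hbig : K' <= m1 z * (x - y)).
    { apply Rle_trans with (m1 x * (K' / m1 x)); [right; field; lra|].
      apply Rmult_le_compat; lra. }
    assert (Hb := Hmb y ltac:(lra) Hy2).
    generalize (Rle_abs (m x)) (Rle_abs (- m y)). rewrite Rabs_Ropp. unfold K' in Hbig. lra. }
  intros x Hx. change (m x <= 2 * PI * K).
  set (y := Rmin (x - 1) tau1).
  assert (Hy1 : y <= x - 1) by apply Rmin_l.
  assert (Hy2 : y <= tau1) by apply Rmin_r.
  destruct (MVT m m1 y x ltac:(lra) Hx Dm) as [z [Hz E]].
  assert (H1 := Hm1 z ltac:(lra)).
  assert (m1 z * (x - y) <= 0).
  { replace 0 with (0 * (x - y)) by ring. apply Rmult_le_compat_r; lra. }
  assert (Hb := Hmb y ltac:(lra) Hy2). generalize (Rle_abs (m y)). lra.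
Qed.

(** Differentiability is encoded as the chain rule along curves: existence of partial derivatives
    would not give it, and u is only ever differentiated along curves. The sign conditions concern
    the single point [t], so no one-sided derivatives arise on the boundary of the quadrant. *)
Definition has_gradient (u ua ub : R -> R -> R) : Prop :=
  forall (x y : R -> R) (t x' y' : R), 0 <= x t -> 0 <= y t ->
    is_derive x t x' -> is_derive y t y' ->
    is_derive (fun s => u (x s) (y s)) t (ua (x t) (y t) * x' + ub (x t) (y t) * y').

Definition quadrant_continuous (u : R -> R -> R) : Prop :=
  forall (T : UniformSpace) (x y : T -> R) (q : T), 0 <= x q -> 0 <= y q ->
    continuous x q -> continuous y q -> continuous (fun q => u (x q) (y q)) q.

(** Up to constants and a factor [a], all majorants used are sums of such powers, and
    differentiation stays within the family. The summand 1 keeps the base positive on the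
    quadrant. *)
Definition power_block (l m s a b : R) : R := Rpower (1 + l * a + m * b) s.

Lemma is_derive_Rpower (x s : R) :
  0 < x -> is_derive (fun x => Rpower x s) x (s * Rpower x (s - 1)).
Proof. intros Hx. apply is_derive_Reals, derivable_pt_lim_power, Hx. Qed.

Lemma has_gradient_power_block (l m s : R) :
  0 <= l -> 0 <= m ->
  has_gradient (power_block l m s) (fun a b => s * l * power_block l m (s - 1) a b)
    (fun a b => s * m * power_block l m (s - 1) a b).
Proof.
  intros Hl Hm x y t x' y' Hx Hy Dx Dy. unfold power_block.
  assert (HW : 0 < 1 + l * x t + m * y t).
  { assert (0 <= l * x t) by (apply Rmult_le_pos; assumption).
    assert (0 <= m * y t) by (apply Rmult_le_pos; assumption). lra. }
  replace (s * l * Rpower (1 + l * x t + m * y t) (s - 1) * x' +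
    s * m * Rpower (1 + l * x t + m * y t) (s - 1) * y') with
    ((l * x' + m * y') * (s * Rpower (1 + l * x t + m * y t) (s - 1))) by ring.
  apply (is_derive_comp (K := R_AbsRing) (V := R_NormedModule)
    (fun w => Rpower w s) (fun t => 1 + l * x t + m * y t)).
  - apply is_derive_Rpower, HW.
  - auto_derive.
    + split; [eexists; exact Dx|split; [eexists; exact Dy|exact I]].
    + replace (Derive (fun x0 => x x0) t) with x' by (symmetry; apply is_derive_unique, Dx).
      replace (Derive (fun x0 => y x0) t) with y' by (symmetry; apply is_derive_unique, Dy).
      ring.
Qed.

Lemma continuous_Rpower (x s : R) : 0 < x -> continuous (fun x => Rpower x s) x.
Proof.
  intros Hx. apply ex_derive_Rcontinuous.
  eexists. apply is_derive_Rpower, Hx.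
Qed.

Lemma quadrant_continuous_power_block (l m s : R) :
  0 <= l -> 0 <= m -> quadrant_continuous (power_block l m s).
Proof.
  intros Hl Hm T x y q Hx Hy Cx Cy. unfold power_block.
  apply (continuous_comp (fun q => 1 + l * x q + m * y q) (fun w => Rpower w s)).
  - rcont.
  - apply continuous_Rpower.
    assert (0 <= l * x q) by (apply Rmult_le_pos; assumption).
    assert (0 <= m * y q) by (apply Rmult_le_pos; assumption). lra.
Qed.

Lemma has_gradient_plus (u ua ub v va vb : R -> R -> R) :
  has_gradient u ua ub -> has_gradient v va vb ->
  has_gradient (fun a b => u a b + v a b) (fun a b => ua a b + va a b)
    (fun a b => ub a b + vb a b).
Proof.
  intros Hu Hv x y t x' y' Hx Hy Dx Dy.
  match goal with |- is_derive _ _ ?l =>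
  replace l with ((ua (x t) (y t) * x' + ub (x t) (y t) * y') +
    (va (x t) (y t) * x' + vb (x t) (y t) * y')) by ring end.
  apply (is_derive_plus (K := R_AbsRing) (V := R_NormedModule));
    [apply Hu|apply Hv]; assumption.
Qed.

Lemma has_gradient_scal (c : R) (u ua ub : R -> R -> R) :
  has_gradient u ua ub ->
  has_gradient (fun a b => c * u a b) (fun a b => c * ua a b) (fun a b => c * ub a b).
Proof.
  intros Hu x y t x' y' Hx Hy Dx Dy.
  match goal with |- is_derive _ _ ?l =>
  replace l with (c * (ua (x t) (y t) * x' + ub (x t) (y t) * y')) by ring end.
  apply is_derive_scal. apply Hu; assumption.
Qed.

Lemma has_gradient_mult_fst (u ua ub : R -> R -> R) :
  has_gradient u ua ub ->
  has_gradient (fun a b => a * u a b) (fun a b => u a b + a * ua a b) (fun a b => a * ub a b).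
Proof.
  intros Hu x y t x' y' Hx Hy Dx Dy.
  match goal with |- is_derive _ _ ?l =>
  replace l with (x' * u (x t) (y t) + x t * (ua (x t) (y t) * x' + ub (x t) (y t) * y')) by ring end.
  apply (is_derive_mult (K := R_AbsRing) x (fun s => u (x s) (y s)));
    [exact Dx|apply Hu; assumption|intros; apply Rmult_comm].
Qed.

Lemma quadrant_continuous_plus (u v : R -> R -> R) :
  quadrant_continuous u -> quadrant_continuous v -> quadrant_continuous (fun a b => u a b + v a b).
Proof.
  intros Hu Hv T x y q Hx Hy Cx Cy. rcont; [apply Hu|apply Hv]; assumption.
Qed.

Lemma quadrant_continuous_scal (c : R) (u : R -> R -> R) :
  quadrant_continuous u -> quadrant_continuous (fun a b => c * u a b).
Proof.
  intros Hu T x y q Hx Hy Cx Cy. rcont. apply Hu; assumption.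
Qed.

Lemma quadrant_continuous_mult_fst (u : R -> R -> R) :
  quadrant_continuous u -> quadrant_continuous (fun a b => a * u a b).
Proof.
  intros Hu T x y q Hx Hy Cx Cy. rcont. apply Hu; assumption.
Qed.

Ltac quadrant_continuity :=
  repeat lazymatch goal with
  | |- quadrant_continuous (fun a b => @?u a b + @?v a b) =>
      refine (quadrant_continuous_plus u v _ _)
  | |- quadrant_continuous (fun a b => a * @?u a b) =>
      refine (quadrant_continuous_mult_fst u _)
  | |- quadrant_continuous (fun a b => ?c * @?u a b) =>
      refine (quadrant_continuous_scal c u _)
  | |- quadrant_continuous (fun a b => power_block ?l ?m ?s a b) =>
      refine (quadrant_continuous_power_block l m s _ _); lra
  end.

(* If F, G are holomorphic, a = |F|^2, b = |G|^2, h = |F'|, l = |G'| and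
   c = Re (conj(F) F' conj(conj(G) G')), the last condition says that
   u(|F|^2, |G|^2) is superharmonic whenever |G'| <= |F'|. *)
Record bellman (u ua ub uaa uab ubb : R -> R -> R) : Prop := {
  bellman_grad : has_gradient u ua ub;
  bellman_grad_a : has_gradient ua uaa uab;
  bellman_grad_b : has_gradient ub uab ubb;
  bellman_cont : quadrant_continuous u;
  bellman_cont_a : quadrant_continuous ua;
  bellman_cont_b : quadrant_continuous ub;
  bellman_cont_aa : quadrant_continuous uaa;
  bellman_cont_ab : quadrant_continuous uab;
  bellman_cont_bb : quadrant_continuous ubb;
  bellman_levi : forall a b h l c, 0 <= a -> 0 <= b -> 0 <= l <= h ->
    Rabs c <= sqrt a * sqrt b * h * l ->
    uaa a b * a * h ^ 2 + 2 * uab a b * c + ubb a b * b * l ^ 2 +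
      ua a b * h ^ 2 + ub a b * l ^ 2 <= 0
}.

Lemma has_gradient_ext (u ua ub va vb : R -> R -> R) :
  has_gradient u va vb -> (forall a b, va a b = ua a b) -> (forall a b, vb a b = ub a b) ->
  has_gradient u ua ub.
Proof.
  intros H Ha Hb x y t x' y' Hx Hy Dx Dy. rewrite <- Ha, <- Hb. apply H; assumption.
Qed.

Lemma Rpower_minus_1 (x s : R) : 0 < x -> x * Rpower x (s - 1) = Rpower x s.
Proof.
  intros Hx. rewrite <- (Rpower_1 x Hx) at 1. rewrite <- Rpower_plus. f_equal; ring.
Qed.

Lemma Rpower_pos (x s : R) : 0 < Rpower x s.
Proof. apply exp_pos. Qed.

Lemma Rpower_1_l (s : R) : Rpower 1 s = 1.
Proof. unfold Rpower. rewrite ln_1, Rmult_0_r. apply exp_0. Qed.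

Lemma Rpower_2_r (x : R) : 0 < x -> Rpower x 2 = x ^ 2.
Proof. apply (Rpower_pow 2). Qed.

Lemma Rpower_le_of_nonpos (x y s : R) : 0 < x <= y -> s <= 0 -> Rpower y s <= Rpower x s.
Proof.
  intros [Hx Hxy] Hs. replace s with (- - s) by ring.
  rewrite (Rpower_Ropp y (- s)), (Rpower_Ropp x (- s)).
  apply Rinv_le_contravar; [apply Rpower_pos|].
  apply Rle_Rpower_l; lra.
Qed.

(** At the most negative admissible c the form is the square of sqrt(a) h - sqrt(b) l. *)
Lemma quadratic_form_nonneg (a b h l c : R) :
  0 <= a -> 0 <= b -> 0 <= l <= h -> Rabs c <= sqrt a * sqrt b * h * l ->
  0 <= a * h ^ 2 + 2 * c + b * l ^ 2.
Proof.
  intros Ha Hb Hl Hc. apply Rabs_le_between in Hc.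
  assert (Sa := sqrt_sqrt a Ha). assert (Sb := sqrt_sqrt b Hb).
  assert (0 <= (sqrt a * h - sqrt b * l) ^ 2) by apply pow2_ge_0.
  nra.
Qed.

(** Write W = 1+a+b and v = 1+a. Since s <= 1, the form of W^s is at most s W^(s-1) (h^2 + l^2) <= 2
    s v^(s-1) h^2: its second-order part is nonpositive and W^(s-1) <= v^(s-1). The form of v^s is s
    (1 + s a) v^(s-2) h^2 >= s^2 v^(s-1) h^2. The factor 2 / s balances the two. *)
Lemma bellman_small_exponent (s : R) :
  0 < s <= 1 ->
  bellman (fun a b => power_block 1 1 s a b + - (2 / s) * power_block 1 0 s a b)
    (fun a b => s * power_block 1 1 (s - 1) a b + - (2 / s) * (s * power_block 1 0 (s - 1) a b))
    (fun a b => s * power_block 1 1 (s - 1) a b)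
    (fun a b => s * (s - 1) * power_block 1 1 (s - 2) a b +
       - (2 / s) * (s * (s - 1) * power_block 1 0 (s - 2) a b))
    (fun a b => s * (s - 1) * power_block 1 1 (s - 2) a b)
    (fun a b => s * (s - 1) * power_block 1 1 (s - 2) a b).
Proof.
  intros Hs.
  assert (E2 : s - 1 - 1 = s - 2) by ring.
  constructor.
  - eapply has_gradient_ext; [apply has_gradient_plus; [apply has_gradient_power_block; lra|apply has_gradient_scal, has_gradient_power_block; lra]| |];
      intros; simpl; ring.
  - eapply has_gradient_ext; [apply has_gradient_plus; apply has_gradient_scal; [apply has_gradient_power_block; lra|apply has_gradient_scal, has_gradient_power_block; lra]| |];
      intros; simpl; rewrite E2; ring.
  - eapply has_gradient_ext; [apply has_gradient_scal, has_gradient_power_block; lra| |]; intros; simpl; rewrite E2; ring.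
  - quadrant_continuity.
  - quadrant_continuity.
  - quadrant_continuity.
  - quadrant_continuity.
  - quadrant_continuity.
  - quadrant_continuity.
  - intros a b h l c Ha Hb Hl Hc.
    assert (HQ := quadratic_form_nonneg a b h l c Ha Hb Hl Hc).
    unfold power_block.
    replace (1 + 1 * a + 1 * b) with (1 + a + b) by ring.
    replace (1 + 1 * a + 0 * b) with (1 + a) by ring.
    set (W := 1 + a + b). set (v := 1 + a).
    assert (Hv : 1 <= v) by (unfold v; lra). assert (HW : v <= W) by (unfold v, W; lra).
    assert (P1 := Rpower_minus_1 v (s - 1) ltac:(lra)).
    replace (s - 1 - 1) with (s - 2) in P1 by ring.
    assert (P2 := Rpower_le_of_nonpos v W (s - 1) ltac:(lra) ltac:(lra)).
    assert (Z1 := Rpower_pos W (s - 2)). assert (Z2 := Rpower_pos v (s - 2)).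
    assert (Z3 := Rpower_pos W (s - 1)). assert (Z4 := Rpower_pos v (s - 1)).
    set (w2 := Rpower W (s - 2)) in *. set (w1 := Rpower W (s - 1)) in *.
    set (v2 := Rpower v (s - 2)) in *. set (v1 := Rpower v (s - 1)) in *.
    match goal with |- ?e <= 0 => replace e with
      (s * (s - 1) * w2 * (a * h ^ 2 + 2 * c + b * l ^ 2) + s * w1 * (h ^ 2 + l ^ 2)
       - 2 * ((s - 1) * (v2 * a) + v1) * h ^ 2) by (field; lra) end.
    assert (A1 : s * (s - 1) * w2 * (a * h ^ 2 + 2 * c + b * l ^ 2) <= 0).
    { assert (0 <= s * (1 - s) * w2 * (a * h ^ 2 + 2 * c + b * l ^ 2)).
      { repeat apply Rmult_le_pos; lra. }
      lra. }
    assert (Hh : 0 <= h ^ 2) by apply pow2_ge_0.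
    assert (Hlh : l ^ 2 <= h ^ 2) by (apply pow_incr; lra).
    assert (A2 : s * w1 * (h ^ 2 + l ^ 2) <= s * v1 * (2 * h ^ 2)).
    { apply Rmult_le_compat; [apply Rmult_le_pos; lra|generalize (pow2_ge_0 l); lra| |lra].
      apply Rmult_le_compat_l; lra. }
    assert (A3 : s * v1 <= (s - 1) * (v2 * a) + v1).
    { assert (v2 * a <= v1) by (rewrite <- P1; unfold v; lra).
      assert ((1 - s) * (v2 * a) <= (1 - s) * v1) by (apply Rmult_le_compat_l; lra). lra. }
    assert (A4 : 2 * (s * v1) * h ^ 2 <= 2 * ((s - 1) * (v2 * a) + v1) * h ^ 2)
      by (apply Rmult_le_compat_r; lra).
    lra.
Qed.

(** Write w = 1+b and v = 1+a. The form of w^s is at most s^2 w^m h^2. The form of a w^m is never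
    negative, and it is at least half of w^m h^2 when w >= 16 m^2 v; this gives A = 2 s^2. When w <
    16 m^2 v, the power w^m is dominated by (16 m^2 + 1)^m v^m, which the form of v^s covers; this
    gives B. The 1 added to 16 m^2 keeps the base positive at m = 0. *)
Lemma bellman_large_exponent (s : R) :
  1 <= s -> let m := s - 1 in let A := 2 * s ^ 2 in
  let B := s * Rpower (16 * m ^ 2 + 1) m in
  bellman (fun a b => power_block 0 1 s a b + - A * (a * power_block 0 1 m a b)
             + - B * power_block 1 0 s a b)
    (fun a b => - A * power_block 0 1 m a b + - B * (s * power_block 1 0 m a b))
    (fun a b => s * power_block 0 1 m a b + - A * (m * (a * power_block 0 1 (m - 1) a b)))
    (fun a b => - B * (s * m * power_block 1 0 (m - 1) a b))
    (fun a b => - A * m * power_block 0 1 (m - 1) a b)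
    (fun a b => s * m * power_block 0 1 (m - 1) a b +
       - A * (m * (m - 1) * (a * power_block 0 1 (m - 2) a b))).
Proof.
  intros Hs m A B.
  assert (E2 : m - 1 - 1 = m - 2) by ring.
  assert (E1 : s - 1 = m) by reflexivity.
  assert (Hm : 0 <= m) by (unfold m; lra).
  constructor.
  - eapply has_gradient_ext; [apply has_gradient_plus; [apply has_gradient_plus;
      [apply has_gradient_power_block; lra|apply has_gradient_scal, has_gradient_mult_fst, has_gradient_power_block; lra]
      |apply has_gradient_scal, has_gradient_power_block; lra]| |];
      intros; simpl; rewrite ?E1; ring.
  - eapply has_gradient_ext; [apply has_gradient_plus; apply has_gradient_scal;
     [apply has_gradient_power_block; lra|apply has_gradient_scal, has_gradient_power_block; lra]| |];
      intros; simpl; ring.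
  - eapply has_gradient_ext; [apply has_gradient_plus; apply has_gradient_scal;
     [apply has_gradient_power_block; lra|apply has_gradient_scal, has_gradient_mult_fst, has_gradient_power_block; lra]| |];
      intros; simpl; rewrite ?E2; ring.
  - quadrant_continuity.
  - quadrant_continuity.
  - quadrant_continuity.
  - quadrant_continuity.
  - quadrant_continuity.
  - quadrant_continuity.
  - intros a b h l c Ha Hb Hl Hc. unfold power_block.
    replace (1 + 0 * a + 1 * b) with (1 + b) by ring.
    replace (1 + 1 * a + 0 * b) with (1 + a) by ring.
    set (w := 1 + b). set (v := 1 + a).
    assert (Hv : 1 <= v) by (unfold v; lra). assert (Hw : 1 <= w) by (unfold w; lra).
    assert (P1 := Rpower_minus_1 w (m - 1) ltac:(lra)). rewrite E2 in P1.
    assert (P2 := Rpower_minus_1 w m ltac:(lra)).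
    rewrite <- P1 in P2.
    assert (Q1 := Rpower_minus_1 v m ltac:(lra)).
    rewrite <- P2, <- P1, <- Q1.
    assert (Zw := Rpower_pos w (m - 2)). assert (Zv := Rpower_pos v (m - 1)).
    assert (HB : 0 < B) by (apply Rmult_lt_0_compat; [lra|apply Rpower_pos]).
    set (Z := Rpower w (m - 2)) in *. set (Y := Rpower v (m - 1)) in *.
    assert (Hh : 0 <= h ^ 2) by apply pow2_ge_0.
    assert (Hlh : l ^ 2 <= h ^ 2) by (apply pow_incr; lra).
    assert (Hl2 := pow2_ge_0 l).
    set (E := w ^ 2 * h ^ 2 + 2 * m * w * c + a * m * l ^ 2 * (1 + m * b)).
    match goal with |- ?e <= 0 => replace e with
      ((s * m * w * b + s * w ^ 2) * Z * l ^ 2 - A * Z * E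
       - B * s * (m * a + v) * Y * h ^ 2) by (unfold E, w; ring) end.
    set (k := sqrt a * sqrt b). 
    assert (Hk : 0 <= k) by (apply Rmult_le_pos; apply sqrt_pos).
    assert (Hk2 : k * k = a * b).
    { unfold k. transitivity ((sqrt a * sqrt a) * (sqrt b * sqrt b)); [ring|].
      rewrite !sqrt_sqrt by assumption. reflexivity. }
    fold k in Hc. apply Rabs_le_between in Hc.
    assert (Hmw : 0 <= 2 * m * w) by (repeat apply Rmult_le_pos; lra).
    assert (Hcc : 2 * m * w * - (k * h * l) <= 2 * m * w * c) by (apply Rmult_le_compat_l; lra).
    (* At the worst value c = -k h l, E equals (w h - m k l)^2 + a m l^2. *)
    assert (HE0 : 0 <= E).
    { unfold E.
      assert (0 <= (w * h - m * k * l) ^ 2) by apply pow2_ge_0.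
      assert (0 <= a * m * l ^ 2) by (repeat apply Rmult_le_pos; lra).
      replace ((w * h - m * k * l) ^ 2) with
        (w ^ 2 * h ^ 2 + 2 * m * w * - (k * h * l) + m ^ 2 * (k * k) * l ^ 2) in H by ring.
      rewrite Hk2 in H. lra. }
    assert (S1 : (s * m * w * b + s * w ^ 2) * Z * l ^ 2 <= s ^ 2 * w ^ 2 * Z * h ^ 2).
    { apply Rmult_le_compat; try lra.
      - apply Rmult_le_pos; [|lra]. apply Rplus_le_le_0_compat; repeat apply Rmult_le_pos; lra.
      - apply Rmult_le_compat_r; [lra|].
        assert (s * m * w * b <= s * m * w * w).
        { apply Rmult_le_compat_l; [repeat apply Rmult_le_pos; lra|unfold w; lra]. }
        replace (s ^ 2 * w ^ 2) with (s * m * w * w + s * w ^ 2) by (unfold m; ring). lra. }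
    assert (S3 : 0 <= B * s * (m * a + v) * Y * h ^ 2).
    { assert (0 <= m * a) by (apply Rmult_le_pos; lra).
      assert (0 <= B * s) by (apply Rmult_le_pos; lra).
      apply Rmult_le_pos; [|lra]. apply Rmult_le_pos; [|lra]. apply Rmult_le_pos; lra. }
    (* In the first case (4 m k)^2 = 16 m^2 a b <= 16 m^2 v w <= w^2, so the cross term of E is at
       most half of w^2 h^2. *)
    destruct (Rle_dec (16 * m ^ 2 * v) w) as [Hcase|Hcase].
    + assert (Hkw : 4 * m * k <= w).
      { apply Rsqr_incr_0; [|apply Rmult_le_pos; lra|lra]. unfold Rsqr.
        replace (4 * m * k * (4 * m * k)) with (16 * m ^ 2 * (k * k)) by ring. rewrite Hk2.
        apply Rle_trans with (16 * m ^ 2 * v * w); [|apply Rmult_le_compat_r; lra].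
        replace (16 * m ^ 2 * v * w) with (16 * m ^ 2 * (v * w)) by ring.
        apply Rmult_le_compat_l; [generalize (pow2_ge_0 m); lra|].
        apply Rmult_le_compat; unfold v, w; lra. }
      assert (HE : w ^ 2 * h ^ 2 <= 2 * E).
      { unfold E.
        assert (0 <= a * m * l ^ 2 * (1 + m * b)).
        { assert (0 <= m * b) by (apply Rmult_le_pos; lra). repeat apply Rmult_le_pos; lra. }
        assert (4 * m * w * (k * h * l) <= w ^ 2 * h ^ 2).
        { replace (4 * m * w * (k * h * l)) with ((4 * m * k) * (w * h * l)) by ring.
          replace (w ^ 2 * h ^ 2) with (w * (w * h * h)) by ring.
          apply Rmult_le_compat; try lra.
          - apply Rmult_le_pos; lra.
          - repeat apply Rmult_le_pos; lra.
          - apply Rmult_le_compat_l; [apply Rmult_le_pos; lra|lra]. }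
        lra. }
      assert (S2 : s ^ 2 * w ^ 2 * Z * h ^ 2 <= A * Z * E).
      { unfold A. replace (s ^ 2 * w ^ 2 * Z * h ^ 2) with (s ^ 2 * Z * (w ^ 2 * h ^ 2)) by ring.
        replace (2 * s ^ 2 * Z * E) with (s ^ 2 * Z * (2 * E)) by ring.
        apply Rmult_le_compat_l; [apply Rmult_le_pos; [apply pow2_ge_0|lra]|exact HE]. }
      lra.
    + assert (S2 : 0 <= A * Z * E).
      { unfold A. repeat apply Rmult_le_pos; try lra. }
      assert (Hp : w ^ 2 * Z <= Rpower (16 * m ^ 2 + 1) m * (v * Y)).
      { replace (w ^ 2 * Z) with (w * (w * Z)) by ring. rewrite P2, Q1.
        rewrite Rpower_mult_distr; [|generalize (pow2_ge_0 m); lra|lra].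
        apply Rle_Rpower_l; [exact Hm|]. split; [lra|].
        replace ((16 * m ^ 2 + 1) * v) with (16 * m ^ 2 * v + v) by ring. lra. }
      assert (S4 : s ^ 2 * w ^ 2 * Z * h ^ 2 <= B * s * (m * a + v) * Y * h ^ 2).
      { apply Rmult_le_compat_r; [lra|].
        apply Rle_trans with (s ^ 2 * (Rpower (16 * m ^ 2 + 1) m * (v * Y))).
        - replace (s ^ 2 * w ^ 2 * Z) with (s ^ 2 * (w ^ 2 * Z)) by ring.
          apply Rmult_le_compat_l; [apply pow2_ge_0|exact Hp].
        - replace (s ^ 2 * (Rpower (16 * m ^ 2 + 1) m * (v * Y))) with (B * s * (v * Y))
            by (unfold B; ring).
          replace (B * s * (m * a + v) * Y) with (B * s * ((m * a + v) * Y)) by ring.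
          apply Rmult_le_compat_l; [apply Rmult_le_pos; lra|].
          apply Rmult_le_compat_r; [lra|]. assert (0 <= m * a) by (apply Rmult_le_pos; lra). lra. }
      lra.
Qed.

(** * Log-polar coordinates and the Laplacian of u(|F|^2, |G|^2) *)

Definition cdot (z w : C) : R := fst z * fst w + snd z * snd w.

Definition sqnorm (z : C) : R := fst z ^ 2 + snd z ^ 2.

Lemma sqnorm_ge_0 (z : C) : 0 <= sqnorm z.
Proof. unfold sqnorm. generalize (pow2_ge_0 (fst z)) (pow2_ge_0 (snd z)). lra. Qed.

Lemma sqrt_sqnorm (z : C) : sqrt (sqnorm z) = Cmod z.
Proof. reflexivity. Qed.

Lemma sqnorm_Cmod (z : C) : sqnorm z = Cmod z ^ 2.
Proof. rewrite <- sqrt_sqnorm, <- Rsqr_pow2, Rsqr_sqrt by apply sqnorm_ge_0. reflexivity. Qed.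

Lemma cdot_self (z : C) : cdot z z = sqnorm z.
Proof. unfold cdot, sqnorm. ring. Qed.

Lemma is_derive_cdot (c d : R -> C) (t : R) (c' d' : C) :
  is_curve_derive c t c' -> is_curve_derive d t d' ->
  is_derive (fun s => cdot (c s) (d s)) t (cdot c' (d t) + cdot (c t) d').
Proof.
  intros Hc Hd. unfold cdot.
  replace (fst c' * fst (d t) + snd c' * snd (d t) + (fst (c t) * fst d' + snd (c t) * snd d'))
    with ((fst c' * fst (d t) + fst (c t) * fst d') + (snd c' * snd (d t) + snd (c t) * snd d'))
    by ring.
  apply (is_derive_plus (K := R_AbsRing) (V := R_NormedModule)).
  - apply (is_derive_mult (K := R_AbsRing) (fun s => fst (c s)) (fun s => fst (d s)));
      [apply is_curve_derive_fst, Hc|apply is_curve_derive_fst, Hd|intros; apply Rmult_comm].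
  - apply (is_derive_mult (K := R_AbsRing) (fun s => snd (c s)) (fun s => snd (d s)));
      [apply is_curve_derive_snd, Hc|apply is_curve_derive_snd, Hd|intros; apply Rmult_comm].
Qed.

Lemma is_derive_sqnorm (c : R -> C) (t : R) (c' : C) :
  is_curve_derive c t c' -> is_derive (fun s => sqnorm (c s)) t (2 * cdot (c t) c').
Proof.
  intros Hc. apply (is_derive_ext (fun s => cdot (c s) (c s))).
  - intros s. apply cdot_self.
  - replace (2 * cdot (c t) c') with (cdot c' (c t) + cdot (c t) c') by (unfold cdot; ring).
    apply is_derive_cdot; exact Hc.
Qed.

Lemma continuous_cdot {T : UniformSpace} (c d : T -> C) (x : T) :
  Ccontinuous c x -> Ccontinuous d x -> continuous (fun y => cdot (c y) (d y)) x.
Proof.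
  intros Hc Hd. unfold cdot.
  rcont; (apply Ccontinuous_fst || apply Ccontinuous_snd); assumption.
Qed.

Lemma continuous_sqnorm {T : UniformSpace} (c : T -> C) (x : T) :
  Ccontinuous c x -> continuous (fun y => sqnorm (c y)) x.
Proof.
  intros Hc. apply (continuous_ext (fun y => cdot (c y) (c y))).
  - intros y. apply cdot_self.
  - apply continuous_cdot; exact Hc.
Qed.

(** This is exp(x + i t). The map is conformal, so the sign of the Laplacian is that of V_xx + V_tt,
    without the first-order term that ordinary polar coordinates would bring. *)
Definition log_polar (x t : R) : C := circle_pt (exp x) t.

Lemma unit_disc_log_polar (x t : R) : x < 0 -> unit_disc (log_polar x t).
Proof.
  intros Hx. apply unit_disc_circle_pt. split; [left; apply exp_pos|].
  rewrite <- exp_0. apply exp_increasing, Hx.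
Qed.

Lemma is_curve_derive_log_polar_fst (x t : R) :
  is_curve_derive (fun x => log_polar x t) x (log_polar x t).
Proof.
  apply is_curve_derive_pair; unfold log_polar, circle_pt; cbn [fst snd];
    auto_derive; try exact I; ring.
Qed.

Lemma continuous_log_polar (q : R * R) :
  Ccontinuous (fun q : R * R => log_polar (fst q) (snd q)) q.
Proof.
  apply Ccontinuous_pair; unfold log_polar, circle_pt; cbn [fst snd];
  apply continuous_Rmult.
  - apply continuous_R2_fst, continuous_exp.
  - apply continuous_R2_snd, continuous_cos.
  - apply continuous_R2_fst, continuous_exp.
  - apply continuous_R2_snd, continuous_sin.
Qed.

(** The derivative of f(e^zeta) in zeta: in log-polar coordinates the derivative in x is [euler f]
    and the one in t is i times it. *)
Definition euler (f : C -> C) (z : C) : C := (z * C_derive f z)%C.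

Lemma holomorphic_euler (f : C -> C) : holomorphic f -> holomorphic (euler f).
Proof.
  intros Hf. apply (holomorphic_mult (fun z => z)).
  - intros z _. eexists. apply is_cderive_id.
  - apply holomorphic_C_derive, Hf.
Qed.

Lemma is_curve_derive_holomorphic_fst (f : C -> C) (x t : R) :
  holomorphic f -> x < 0 ->
  is_curve_derive (fun x => f (log_polar x t)) x (euler f (log_polar x t)).
Proof.
  intros Hf Hx. apply (is_curve_derive_comp f (fun x => log_polar x t)).
  - apply holomorphic_is_cderive; [exact Hf|apply unit_disc_log_polar, Hx].
  - apply is_curve_derive_log_polar_fst.
Qed.

Lemma is_curve_derive_holomorphic_snd (f : C -> C) (x t : R) :
  holomorphic f -> x < 0 ->
  is_curve_derive (fun t => f (log_polar x t)) t (Ci * euler f (log_polar x t))%C.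
Proof.
  intros Hf Hx. unfold euler. rewrite Cmult_assoc.
  apply (is_curve_derive_comp f (log_polar x)).
  - apply holomorphic_is_cderive; [exact Hf|apply unit_disc_log_polar, Hx].
  - apply is_curve_derive_circle_pt.
Qed.

Lemma continuous_holomorphic_log_polar (f : C -> C) (x t : R) :
  holomorphic f -> x < 0 ->
  Ccontinuous (fun q : R * R => f (log_polar (fst q) (snd q))) (x, t).
Proof.
  intros Hf Hx.
  apply (continuous_comp (fun q : R * R => log_polar (fst q) (snd q)) f).
  - apply continuous_log_polar.
  - apply holomorphic_continuous; [exact Hf|apply unit_disc_log_polar, Hx].
Qed.

Lemma is_curve_derive_Ci_mult (c : R -> C) (t : R) (l : C) :
  is_curve_derive c t l -> is_curve_derive (fun s => Ci * c s)%C t (Ci * l)%C.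
Proof.
  intros H. rewrite Cmult_comm. apply (is_curve_derive_comp (fun w => Ci * w)%C c); [|exact H].
  cderive. cring.
Qed.

Lemma cdot_levi_bound (f f1 g g1 : C) :
  Rabs (cdot f f1 * cdot g g1 + cdot f (Ci * f1)%C * cdot g (Ci * g1)%C) <=
  sqrt (sqnorm f) * sqrt (sqnorm g) * Cmod f1 * Cmod g1.
Proof.
  rewrite !sqrt_sqnorm.
  replace (cdot f f1 * cdot g g1 + cdot f (Ci * f1)%C * cdot g (Ci * g1)%C) with
    (fst (Cconj f * f1 * Cconj (Cconj g * g1))%C).
  - eapply Rle_trans; [apply Rabs_fst_le_Cmod|].
    rewrite Cmod_mult, Cmod_conj, !Cmod_mult, !Cmod_conj. right; ring.
  - destruct f, f1, g, g1. unfold cdot, Ci, Cconj, Cmult; simpl. ring.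
Qed.

Section BellmanMean.

Variables (u ua ub uaa uab ubb : R -> R -> R) (F G : C -> C).
Hypothesis HB : bellman u ua ub uaa uab ubb.
Hypothesis HF : holomorphic F.
Hypothesis HG : holomorphic G.
Hypothesis Hsub : forall z, unit_disc z -> Cmod (C_derive G z) <= Cmod (C_derive F z).

Let a z := sqnorm (F z).
Let b z := sqnorm (G z).
Let F1 := euler F.
Let F2 := euler (euler F).
Let G1 := euler G.
Let G2 := euler (euler G).

(* First and second derivative of u(|F|^2, |G|^2) along a curve through z along
   which F has derivatives d1, d2 and G has derivatives e1, e2. *)
Let first_order (d1 e1 z : C) : R :=
  ua (a z) (b z) * (2 * cdot (F z) d1) + ub (a z) (b z) * (2 * cdot (G z) e1).

Let second_order (d1 e1 d2 e2 z : C) : R :=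
  (uaa (a z) (b z) * (2 * cdot (F z) d1) + uab (a z) (b z) * (2 * cdot (G z) e1))
    * (2 * cdot (F z) d1) + ua (a z) (b z) * (2 * (cdot d1 d1 + cdot (F z) d2)) +
  ((uab (a z) (b z) * (2 * cdot (F z) d1) + ubb (a z) (b z) * (2 * cdot (G z) e1))
    * (2 * cdot (G z) e1) + ub (a z) (b z) * (2 * (cdot e1 e1 + cdot (G z) e2))).

Let is_derive_first (c : R -> C) (t : R) (d1 e1 : C) :
  is_curve_derive (fun s => F (c s)) t d1 -> is_curve_derive (fun s => G (c s)) t e1 ->
  is_derive (fun s => u (a (c s)) (b (c s))) t (first_order d1 e1 (c t)).
Proof.
  intros D E. apply (bellman_grad _ _ _ _ _ _ HB); try apply sqnorm_ge_0;
    apply is_derive_sqnorm; assumption.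
Qed.

Let is_derive_second (c d e : R -> C) (t : R) (d2 e2 : C) :
  is_curve_derive (fun s => F (c s)) t (d t) -> is_curve_derive (fun s => G (c s)) t (e t) ->
  is_curve_derive d t d2 -> is_curve_derive e t e2 ->
  is_derive (fun s => first_order (d s) (e s) (c s)) t (second_order (d t) (e t) d2 e2 (c t)).
Proof.
  intros D E D2 E2. unfold first_order, second_order.
  assert (Da := is_derive_sqnorm (fun s => F (c s)) t (d t) D).
  assert (Db := is_derive_sqnorm (fun s => G (c s)) t (e t) E).
  apply (is_derive_plus (K := R_AbsRing) (V := R_NormedModule));
  [ apply (is_derive_mult (K := R_AbsRing) (fun s => ua (a (c s)) (b (c s)))
      (fun s => 2 * cdot (F (c s)) (d s))); [| |intros; apply Rmult_comm]
  | apply (is_derive_mult (K := R_AbsRing) (fun s => ub (a (c s)) (b (c s)))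
      (fun s => 2 * cdot (G (c s)) (e s))); [| |intros; apply Rmult_comm] ].
  - apply (bellman_grad_a _ _ _ _ _ _ HB); try apply sqnorm_ge_0; assumption.
  - apply is_derive_scal. apply (is_derive_cdot (fun s => F (c s)) d); assumption.
  - apply (bellman_grad_b _ _ _ _ _ _ HB); try apply sqnorm_ge_0; assumption.
  - apply is_derive_scal. apply (is_derive_cdot (fun s => G (c s)) e); assumption.
Qed.

Let continuous_coefficient (v : R -> R -> R) (x t : R) :
  quadrant_continuous v -> x < 0 ->
  continuous (fun q : R * R => v (a (log_polar (fst q) (snd q))) (b (log_polar (fst q) (snd q)))) (x, t).
Proof.
  intros Hv Hx. apply Hv; try apply sqnorm_ge_0;
    apply continuous_sqnorm, continuous_holomorphic_log_polar; assumption.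
Qed.

Let continuous_first (d e : R * R -> C) (x t : R) :
  x < 0 -> Ccontinuous d (x, t) -> Ccontinuous e (x, t) ->
  continuous (fun q : R * R => first_order (d q) (e q) (log_polar (fst q) (snd q))) (x, t).
Proof.
  intros Hx Hd He. unfold first_order.
  assert (CF := continuous_holomorphic_log_polar F x t HF Hx).
  assert (CG := continuous_holomorphic_log_polar G x t HG Hx).
  assert (Ca := continuous_coefficient ua x t (bellman_cont_a _ _ _ _ _ _ HB) Hx).
  assert (Cb := continuous_coefficient ub x t (bellman_cont_b _ _ _ _ _ _ HB) Hx).
  assert (K1 := continuous_cdot _ _ _ CF Hd). assert (K2 := continuous_cdot _ _ _ CG He).
  rcont.
Qed.

Let continuous_second (d e d2 e2 : R * R -> C) (x t : R) :
  x < 0 -> Ccontinuous d (x, t) -> Ccontinuous e (x, t) ->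
  Ccontinuous d2 (x, t) -> Ccontinuous e2 (x, t) ->
  continuous (fun q : R * R =>
    second_order (d q) (e q) (d2 q) (e2 q) (log_polar (fst q) (snd q))) (x, t).
Proof.
  intros Hx Hd He Hd2 He2. unfold second_order.
  assert (CF := continuous_holomorphic_log_polar F x t HF Hx).
  assert (CG := continuous_holomorphic_log_polar G x t HG Hx).
  assert (Ca := continuous_coefficient ua x t (bellman_cont_a _ _ _ _ _ _ HB) Hx).
  assert (Cb := continuous_coefficient ub x t (bellman_cont_b _ _ _ _ _ _ HB) Hx).
  assert (Caa := continuous_coefficient uaa x t (bellman_cont_aa _ _ _ _ _ _ HB) Hx).
  assert (Cab := continuous_coefficient uab x t (bellman_cont_ab _ _ _ _ _ _ HB) Hx).
  assert (Cbb := continuous_coefficient ubb x t (bellman_cont_bb _ _ _ _ _ _ HB) Hx).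
  assert (K1 := continuous_cdot _ _ _ CF Hd). assert (K2 := continuous_cdot _ _ _ CG He).
  assert (K3 := continuous_cdot _ _ _ CF Hd2). assert (K4 := continuous_cdot _ _ _ CG He2).
  assert (K5 := continuous_cdot _ _ _ Hd Hd). assert (K6 := continuous_cdot _ _ _ He He).
  rcont.
Qed.

(** The second derivatives F2 and G2 cancel between the two directions because i * i = -1; what is
    left is four times the form of [bellman_levi]. *)
Let laplacian_nonpos (z : C) :
  unit_disc z ->
  second_order (F1 z) (G1 z) (F2 z) (G2 z) z +
  second_order (Ci * F1 z)%C (Ci * G1 z)%C (Ci * (Ci * F2 z))%C (Ci * (Ci * G2 z))%C z <= 0.
Proof.
  intros Hz.
  set (c := cdot (F z) (F1 z) * cdot (G z) (G1 z) +
    cdot (F z) (Ci * F1 z)%C * cdot (G z) (Ci * G1 z)%C).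
  assert (L := bellman_levi _ _ _ _ _ _ HB (a z) (b z) (Cmod (F1 z)) (Cmod (G1 z)) c
    (sqnorm_ge_0 _) (sqnorm_ge_0 _)).
  rewrite <- !sqnorm_Cmod in L.
  match goal with |- ?e <= 0 => replace e with (4 * (uaa (a z) (b z) * a z * sqnorm (F1 z) +
    2 * uab (a z) (b z) * c + ubb (a z) (b z) * b z * sqnorm (G1 z) +
    ua (a z) (b z) * sqnorm (F1 z) + ub (a z) (b z) * sqnorm (G1 z))) end.
  - assert (L' := L ltac:(split; [apply Cmod_ge_0|]; unfold F1, G1, euler; rewrite !Cmod_mult;
      apply Rmult_le_compat_l; [apply Cmod_ge_0|apply Hsub, Hz]) (cdot_levi_bound _ _ _ _)).
    lra.
  - clear L. unfold second_order, c, a, b.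
    set (x1 := uaa _ _). set (x2 := uab _ _). set (x3 := ubb _ _).
    set (x4 := ua _ _). set (x5 := ub _ _). clearbody x1 x2 x3 x4 x5.
    destruct (F z), (G z), (F1 z), (G1 z), (F2 z), (G2 z).
    unfold sqnorm, cdot, Ci, Cmult; cbn [fst snd]. ring.
Qed.

Lemma bellman_mean_bounded :
  exists K, forall r, 0 < r < 1 ->
    RInt (fun t => u (sqnorm (F (circle_pt r t))) (sqnorm (G (circle_pt r t)))) 0 (2 * PI) <= K.
Proof.
  set (v := fun z : R * R => u (a z) (b z)).
  assert (HF1 : holomorphic F1) by apply (holomorphic_euler F HF).
  assert (HG1 : holomorphic G1) by apply (holomorphic_euler G HG).
  assert (HF2 : holomorphic F2) by apply (holomorphic_euler F1 HF1).
  assert (HG2 : holomorphic G2) by apply (holomorphic_euler G1 HG1).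
  assert (Ci_mult : forall (f : R * R -> C) q, Ccontinuous f q -> Ccontinuous (fun q => Ci * f q)%C q)
    by (intros f q H; apply (Ccontinuous_mult (fun _ => Ci) f q); [apply continuous_const|exact H]).
  assert (Cv : continuous v (RtoC 0)).
  { apply (bellman_cont _ _ _ _ _ _ HB); try apply sqnorm_ge_0;
    apply continuous_sqnorm, holomorphic_continuous; try assumption; apply unit_disc_0. }
  specialize (Cv _ (locally_ball _ (mkposreal 1 Rlt_0_1))).
  apply (locally_C_eps (RtoC 0)) in Cv. destruct Cv as [d [Hd Hv]].
  (* The means decrease outwards from the centre, so a bound for [v] near 0, supplied by continuity,
     bounds them all. *)
  exists (2 * PI * (Rabs (v (RtoC 0)) + 1)). intros r Hr.
  rewrite <- (exp_ln r) by lra.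
  assert (Hlr : ln r < 0) by (rewrite <- ln_1; apply ln_increasing; lra).
  apply (mean_superharmonic
    (fun x t => u (a (log_polar x t)) (b (log_polar x t)))
    (fun x t => first_order (F1 (log_polar x t)) (G1 (log_polar x t)) (log_polar x t))
    (fun x t => first_order (Ci * F1 (log_polar x t))%C (Ci * G1 (log_polar x t))%C (log_polar x t))
    (fun x t => second_order (F1 (log_polar x t)) (G1 (log_polar x t))
       (F2 (log_polar x t)) (G2 (log_polar x t)) (log_polar x t))
    (fun x t => second_order (Ci * F1 (log_polar x t))%C (Ci * G1 (log_polar x t))%C
       (Ci * (Ci * F2 (log_polar x t)))%C (Ci * (Ci * G2 (log_polar x t)))%C (log_polar x t))
    _ (ln d - 1)); try exact Hlr; clear r Hr Hlr; intros x t Hx || intros x Hx.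
  - apply (is_derive_first (fun x => log_polar x t));
      apply is_curve_derive_holomorphic_fst; assumption.
  - apply (is_derive_second (fun x => log_polar x t) (fun x => F1 (log_polar x t))
      (fun x => G1 (log_polar x t)));
      apply is_curve_derive_holomorphic_fst; try assumption; apply holomorphic_euler; assumption.
  - apply (is_derive_first (log_polar x)); apply is_curve_derive_holomorphic_snd; assumption.
  - apply (is_derive_second (log_polar x) (fun t => Ci * F1 (log_polar x t))%C
      (fun t => Ci * G1 (log_polar x t))%C).
    + apply is_curve_derive_holomorphic_snd; assumption.
    + apply is_curve_derive_holomorphic_snd; assumption.
    + apply (is_curve_derive_Ci_mult (fun t => F1 (log_polar x t))),
        is_curve_derive_holomorphic_snd; [apply holomorphic_euler|]; assumption.
    + apply (is_curve_derive_Ci_mult (fun t => G1 (log_polar x t))),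
        is_curve_derive_holomorphic_snd; [apply holomorphic_euler|]; assumption.
  - exact (continuous_first _ _ x t Hx (continuous_holomorphic_log_polar F1 x t HF1 Hx)
      (continuous_holomorphic_log_polar G1 x t HG1 Hx)).
  - exact (continuous_second _ _ _ _ x t Hx (continuous_holomorphic_log_polar F1 x t HF1 Hx)
      (continuous_holomorphic_log_polar G1 x t HG1 Hx)
      (continuous_holomorphic_log_polar F2 x t HF2 Hx)
      (continuous_holomorphic_log_polar G2 x t HG2 Hx)).
  - refine (continuous_second _ _ _ _ x t Hx
      (Ci_mult _ _ (continuous_holomorphic_log_polar F1 x t HF1 Hx))
      (Ci_mult _ _ (continuous_holomorphic_log_polar G1 x t HG1 Hx))
      (Ci_mult _ _ (Ci_mult _ _ (continuous_holomorphic_log_polar F2 x t HF2 Hx)))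
      (Ci_mult _ _ (Ci_mult _ _ (continuous_holomorphic_log_polar G2 x t HG2 Hx)))).
  - unfold log_polar. rewrite circle_pt_closed. reflexivity.
  - apply laplacian_nonpos, unit_disc_log_polar, Hx.
  - intros Hx1. change (Rabs (v (log_polar x t)) <= Rabs (v (RtoC 0)) + 1).
    assert (Hb : Rabs (v (log_polar x t) - v (RtoC 0)) < 1).
    { apply Hv. replace (log_polar x t - 0)%C with (log_polar x t) by cring.
      unfold log_polar. rewrite Cmod_circle_pt by (left; apply exp_pos).
      rewrite <- (exp_ln d) by exact Hd. apply exp_increasing. lra. }
    replace (v (log_polar x t)) with (v (log_polar x t) - v (RtoC 0) + v (RtoC 0)) by ring.
    eapply Rle_trans; [apply Rabs_triang|]. lra.
Qed.

End BellmanMean.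

(** * Multipliers of derivatives: sufficiency of boundedness *)

Lemma rpow_0 (p : R) : rpow 0 p = 0.
Proof. unfold rpow. destruct (Req_EM_T 0 0); [reflexivity|contradiction]. Qed.

Lemma rpow_Rpower (x p : R) : 0 < x -> rpow x p = Rpower x p.
Proof. intros Hx. unfold rpow. destruct (Req_EM_T x 0); [lra|reflexivity]. Qed.

Lemma rpow_ge_0 (x p : R) : 0 <= rpow x p.
Proof. unfold rpow. destruct (Req_EM_T x 0); [lra|left; apply Rpower_pos]. Qed.

Lemma rpow_le (x y p : R) : 0 <= p -> 0 <= x <= y -> rpow x p <= rpow y p.
Proof.
  intros Hp [Hx Hxy]. destruct (Req_dec x 0) as [->|Hx0].
  - rewrite rpow_0. apply rpow_ge_0.
  - rewrite !rpow_Rpower by lra. apply Rle_Rpower_l; lra.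
Qed.

Lemma rpow_mult (x y p : R) : 0 <= x -> 0 <= y -> rpow (x * y) p = rpow x p * rpow y p.
Proof.
  intros Hx Hy. destruct (Req_dec x 0) as [->|Hx0].
  - rewrite Rmult_0_l, rpow_0. ring.
  - destruct (Req_dec y 0) as [->|Hy0].
    + rewrite Rmult_0_r, rpow_0. ring.
    + assert (0 < x * y) by (apply Rmult_lt_0_compat; lra).
      rewrite !rpow_Rpower by lra. symmetry. apply Rpower_mult_distr; lra.
Qed.

(** The composition with [Rpower] works only for a positive base; at a zero of [h] the modulus of
    continuity eps^(1/p) is used directly. *)
Lemma continuous_rpow {T : UniformSpace} (h : T -> R) (p : R) (q : T) :
  0 < p -> (forall x, 0 <= h x) -> continuous h q -> continuous (fun x => rpow (h x) p) q.
Proof.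
  intros Hp Hh Hc. destruct (Rle_lt_or_eq_dec 0 (h q) (Hh q)) as [Hq|Hq].
  - refine (continuous_ext_loc _ (fun x => Rpower (h x) p) q _ _).
    + assert (Hl := Hc _ (locally_ball _ (mkposreal _ Hq))). unfold filtermap in Hl.
      generalize Hl. apply filter_imp. intros x Hx.
      change (Rabs (h x - h q) < h q) in Hx. apply Rabs_def2 in Hx.
      symmetry. apply rpow_Rpower. lra.
    + apply (continuous_comp h (fun x => Rpower x p)); [exact Hc|].
      apply continuous_Rpower, Hq.
  - intros P [eps HP]. unfold filtermap.
    assert (He := cond_pos eps).
    assert (Hl := Hc _ (locally_ball _ (mkposreal _ (Rpower_pos eps (/ p))))).
    unfold filtermap in Hl. generalize Hl. apply filter_imp. intros x Hx.
    change (Rabs (h x - h q) < Rpower eps (/ p)) in Hx.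
    apply HP. change (Rabs (rpow (h x) p - rpow (h q) p) < eps).
    rewrite <- Hq, Rminus_0_r in Hx. rewrite <- Hq, rpow_0, Rminus_0_r.
    rewrite Rabs_pos_eq in Hx by apply Hh. rewrite Rabs_pos_eq by apply rpow_ge_0.
    destruct (Req_dec (h x) 0) as [->|Hx0]; [rewrite rpow_0; exact He|].
    assert (Hx1 := Hh x). rewrite rpow_Rpower by lra.
    replace (pos eps) with (Rpower (Rpower eps (/ p)) p).
    + apply Rlt_Rpower_l; lra.
    + rewrite Rpower_mult, Rinv_l, Rpower_1 by lra. reflexivity.
Qed.

Lemma Rpower_sqr (x s : R) : 0 < x -> Rpower (x ^ 2) s = Rpower x (2 * s).
Proof.
  intros Hx. rewrite <- Rpower_2_r by exact Hx. apply Rpower_mult.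
Qed.

Lemma rpow_le_Rpower (x p : R) : 0 <= p -> 0 <= x -> rpow x p <= Rpower (1 + x ^ 2) (p / 2).
Proof.
  intros Hp Hx. destruct (Req_dec x 0) as [->|Hx0].
  - rewrite rpow_0. left; apply Rpower_pos.
  - rewrite rpow_Rpower by lra. replace p with (2 * (p / 2)) at 1 by field.
    rewrite <- Rpower_sqr by lra.
    assert (0 < x ^ 2) by (apply pow_lt; lra). apply Rle_Rpower_l; lra.
Qed.

Lemma Rpower_le_rpow (x p : R) :
  0 <= p -> 0 <= x -> Rpower (1 + x ^ 2) (p / 2) <= Rpower 2 (p / 2) * (1 + rpow x p).
Proof.
  intros Hp Hx. assert (H2 := Rpower_pos 2 (p / 2)). assert (H0 := rpow_ge_0 x p).
  assert (Hx2 := pow2_ge_0 x).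
  destruct (Rle_dec x 1) as [H1|H1].
  - apply Rle_trans with (Rpower 2 (p / 2)).
    + apply Rle_Rpower_l; [lra|]. split; [lra|].
      assert (x ^ 2 <= 1 ^ 2) by (apply pow_incr; lra). lra.
    + rewrite <- (Rmult_1_r (Rpower 2 (p / 2))) at 1. apply Rmult_le_compat_l; lra.
  - apply Rle_trans with (Rpower 2 (p / 2) * rpow x p); [|apply Rmult_le_compat_l; lra].
    rewrite rpow_Rpower by lra. replace p with (2 * (p / 2)) at 3 by field.
    assert (1 ^ 2 <= x ^ 2) by (apply pow_incr; lra).
    rewrite <- Rpower_sqr, Rpower_mult_distr by lra.
    apply Rle_Rpower_l; lra.
Qed.

Lemma continuous_mean_integrand (p r t : R) (f : C -> C) :
  0 < p -> disc_continuous f -> 0 <= r < 1 ->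
  continuous (fun t => rpow (Cmod (f (circle_pt r t))) p) t.
Proof.
  intros Hp Hf Hr. apply continuous_rpow; [exact Hp|intros; apply Cmod_ge_0|].
  apply Ccontinuous_Cmod, Ccontinuous_circle_comp; assumption.
Qed.

Lemma ex_RInt_mean_integrand (p r : R) (f : C -> C) :
  0 < p -> disc_continuous f -> 0 <= r < 1 ->
  ex_RInt (fun t => rpow (Cmod (f (circle_pt r t))) p) 0 (2 * PI).
Proof.
  intros. apply ex_RInt_Rcontinuous.
  intros t _. apply continuous_mean_integrand; assumption.
Qed.

Lemma RInt_mult_l (f : R -> R) (a b c : R) :
  ex_RInt f a b -> RInt (fun t => c * f t) a b = c * RInt f a b.
Proof. apply (RInt_scal (V := R_CompleteNormedModule)). Qed.

Lemma integral_mean_RInt (p r : R) (f : C -> C) :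
  0 < p -> disc_continuous f -> 0 <= r < 1 ->
  integral_mean p f r = RInt (fun t => rpow (Cmod (f (circle_pt r t))) p) 0 (2 * PI) / (2 * PI).
Proof.
  intros Hp Hf Hr. unfold integral_mean.
  transitivity (/ (2 * PI) * RInt (fun t => rpow (Cmod (f (circle_pt r t))) p) 0 (2 * PI));
    [|apply Rmult_comm].
  rewrite <- RInt_mult_l by (apply ex_RInt_mean_integrand; assumption).
  apply RInt_ext. intros t _. apply Rmult_comm.
Qed.

Lemma hardy_RInt_iff (p : R) (f : C -> C) :
  0 < p ->
  hardy p f <->
  holomorphic f /\ exists M, forall r, 0 < r < 1 ->
    RInt (fun t => rpow (Cmod (f (circle_pt r t))) p) 0 (2 * PI) <= M.
Proof.
  intros Hp. rewrite hardy_iff. assert (Hpi := two_PI_pos).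
  split; intros [Hf [M HM]]; (split; [exact Hf|]);
    assert (Hc := holomorphic_disc_continuous f Hf).
  - exists (2 * PI * M). intros r Hr. specialize (HM r ltac:(lra)).
    rewrite integral_mean_RInt in HM by (try assumption; lra).
    apply (Rmult_le_compat_l (2 * PI)) in HM; [|lra].
    eapply Rle_trans; [|exact HM].
    match goal with |- ?x <= _ => set (I := x : R) end. right; field; lra.
  - exists (Rmax (M / (2 * PI)) (integral_mean p f 0)). intros r Hr.
    destruct (Req_dec r 0) as [->|Hr0]; [apply Rmax_r|].
    eapply Rle_trans; [|apply Rmax_l].
    rewrite integral_mean_RInt by assumption.
    apply Rmult_le_compat_r; [left; apply Rinv_0_lt_compat; lra|apply HM; lra].
Qed.

(** The means of u(|F|^2, |G|^2) are bounded above, so integrating the majorisation bounds those of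
    |G|^p by those of |F|^p. The constant [c] leaves room for a share of (1+b)^(p/2) that the
    negative terms of u consume. *)
Lemma hardy_subordinate_of_bellman (p c K : R) (u ua ub uaa uab ubb : R -> R -> R) (F G : C -> C) :
  1 <= p -> bellman u ua ub uaa uab ubb -> 0 < c -> 0 <= K ->
  (forall a b, 0 <= a -> 0 <= b ->
    c * Rpower (1 + b) (p / 2) <= u a b + K * Rpower (1 + a) (p / 2)) ->
  holomorphic G -> (forall z, unit_disc z -> Cmod (C_derive G z) <= Cmod (C_derive F z)) ->
  hardy p F -> hardy p G.
Proof.
  intros Hp HB Hc HK Hmaj HG Hsub HF.
  rewrite hardy_RInt_iff in HF |- * by lra. destruct HF as [HF [M HM]].
  split; [exact HG|].
  destruct (bellman_mean_bounded u ua ub uaa uab ubb F G HB HF HG Hsub) as [N HN].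
  set (L := K * Rpower 2 (p / 2)).
  exists (/ c * (N + L * (2 * PI + M))). intros r Hr.
  assert (HFc := holomorphic_disc_continuous F HF).
  assert (HGc := holomorphic_disc_continuous G HG).
  specialize (HM r Hr). specialize (HN r Hr).
  set (f := fun t => rpow (Cmod (F (circle_pt r t))) p) in *.
  set (w := fun t => u (sqnorm (F (circle_pt r t))) (sqnorm (G (circle_pt r t)))) in *.
  assert (If : ex_RInt f 0 (2 * PI)) by (apply ex_RInt_mean_integrand; try assumption; lra).
  assert (Iw : ex_RInt w 0 (2 * PI)).
  { apply ex_RInt_Rcontinuous. intros t _.
    apply (bellman_cont _ _ _ _ _ _ HB); try apply sqnorm_ge_0;
      apply continuous_sqnorm, Ccontinuous_circle_comp; try assumption; lra. }
  assert (Hpi := two_PI_pos).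
  assert (HL : 0 <= L) by (apply Rmult_le_pos; [exact HK|left; apply Rpower_pos]).
  assert (I1 : is_RInt (fun t => / c * (w t + L * (1 + f t))) 0 (2 * PI)
    (/ c * (RInt w 0 (2 * PI) + L * ((2 * PI - 0) * 1 + RInt f 0 (2 * PI))))).
  { apply is_RInt_Rscal, is_RInt_Rplus.
    - apply RInt_Rcorrect, Iw.
    - apply is_RInt_Rscal, is_RInt_Rplus.
      + apply is_RInt_Rconst.
      + apply RInt_Rcorrect, If. }
  apply Rle_trans with (RInt (fun t => / c * (w t + L * (1 + f t))) 0 (2 * PI)).
  - apply RInt_le; [lra|apply ex_RInt_mean_integrand; try assumption; lra|eexists; exact I1|].
    intros t _.
    set (x := Cmod (F (circle_pt r t))). set (y := Cmod (G (circle_pt r t))).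
    assert (Hx : 0 <= x) by apply Cmod_ge_0. assert (Hy : 0 <= y) by apply Cmod_ge_0.
    assert (H1 := Hmaj (x ^ 2) (y ^ 2) (pow2_ge_0 _) (pow2_ge_0 _)).
    assert (H2 := rpow_le_Rpower y p ltac:(lra) Hy).
    assert (H3 := Rpower_le_rpow x p ltac:(lra) Hx).
    unfold x, y in H1. rewrite <- !sqnorm_Cmod in H1. fold (w t) in H1.
    unfold x in H3. rewrite <- sqnorm_Cmod in H3. fold (f t) in H3.
    unfold y in H2. rewrite <- sqnorm_Cmod in H2. fold y in H2.
    apply (Rmult_le_compat_l K) in H3; [|exact HK]. rewrite <- Rmult_assoc in H3. fold L in H3.
    apply (Rmult_le_compat_l c) in H2; [|lra].
    apply Rmult_le_reg_l with c; [exact Hc|].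
    rewrite <- Rmult_assoc, Rinv_r, Rmult_1_l by lra. fold y. lra.
  - rewrite (is_RInt_unique _ _ _ _ I1).
    apply Rmult_le_compat_l; [left; apply Rinv_0_lt_compat, Hc|].
    apply Rplus_le_compat; [exact HN|].
    apply Rmult_le_compat_l; [exact HL|]. lra.
Qed.

Lemma hardy_subordinate (p : R) (F G : C -> C) :
  1 <= p -> holomorphic G ->
  (forall z, unit_disc z -> Cmod (C_derive G z) <= Cmod (C_derive F z)) ->
  hardy p F -> hardy p G.
Proof.
  intros Hp HG Hsub HF. set (s := p / 2).
  destruct (Rle_dec s 1) as [Hs|Hs].
  - assert (Hs0 : 0 < s <= 1) by (unfold s in *; lra).
    assert (B := bellman_small_exponent s Hs0).
    refine (hardy_subordinate_of_bellman p 1 (2 / s) _ _ _ _ _ _ F G Hp B Rlt_0_1 _ _ HG Hsub HF).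
    + left. apply Rdiv_lt_0_compat; lra.
    + intros a b Ha Hb. fold s. unfold power_block.
      replace (1 + 1 * a + 1 * b) with (1 + a + b) by ring.
      replace (1 + 1 * a + 0 * b) with (1 + a) by ring.
      assert (Rpower (1 + b) s <= Rpower (1 + a + b) s) by (apply Rle_Rpower_l; lra). lra.
  - assert (Hs1 : 1 <= s) by lra.
    assert (B := bellman_large_exponent s Hs1). cbv zeta in B.
    set (m := s - 1) in B. set (A := 2 * s ^ 2) in B.
    set (K := s * Rpower (16 * m ^ 2 + 1) m) in B.
    assert (HA : 0 < A) by (unfold A; assert (1 ^ 2 <= s ^ 2) by (apply pow_incr; lra); lra).
    assert (HK : 0 < K) by (apply Rmult_lt_0_compat; [lra|apply Rpower_pos]).
    (* Half of (1+b)^s is given up to absorb A a (1+b)^m. This suffices if 2 A a <= 1 + b; otherwise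
       1 + b <= (2 A + 1) (1 + a), which produces the second constant. *)
    refine (hardy_subordinate_of_bellman p (1 / 2) (K + A * Rpower (2 * A + 1) m)
      _ _ _ _ _ _ F G Hp B _ _ _ HG Hsub HF); [lra| |].
    + apply Rplus_le_le_0_compat; [lra|]. apply Rmult_le_pos; [lra|left; apply Rpower_pos].
    + intros a b Ha Hb. fold s. unfold power_block.
      replace (1 + 0 * a + 1 * b) with (1 + b) by ring.
      replace (1 + 1 * a + 0 * b) with (1 + a) by ring.
      assert (P1 := Rpower_minus_1 (1 + b) s ltac:(lra)). fold m in P1.
      assert (P2 := Rpower_minus_1 (1 + a) s ltac:(lra)). fold m in P2.
      assert (Zb := Rpower_pos (1 + b) m). assert (Za := Rpower_pos (1 + a) s).
      cut (A * (a * Rpower (1 + b) m) <= 1 / 2 * Rpower (1 + b) s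
        + A * Rpower (2 * A + 1) m * Rpower (1 + a) s); [lra|].
      destruct (Rle_dec (2 * A * a) (1 + b)) as [H|H].
      * assert (0 <= A * Rpower (2 * A + 1) m * Rpower (1 + a) s).
        { apply Rmult_le_pos; [apply Rmult_le_pos; [lra|left; apply Rpower_pos]|lra]. }
        assert (A * (a * Rpower (1 + b) m) <= 1 / 2 * ((1 + b) * Rpower (1 + b) m)); [|lra].
        replace (A * (a * Rpower (1 + b) m)) with ((1 / 2 * (2 * A * a)) * Rpower (1 + b) m) by field.
        replace (1 / 2 * ((1 + b) * Rpower (1 + b) m)) with (1 / 2 * (1 + b) * Rpower (1 + b) m) by ring.
        apply Rmult_le_compat_r; lra.
      * assert (0 < Rpower (1 + b) s) by apply Rpower_pos.
        assert (A * (a * Rpower (1 + b) m) <= A * (Rpower (2 * A + 1) m * Rpower (1 + a) s)); [|lra].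
        apply Rmult_le_compat_l; [lra|]. rewrite <- P2.
        replace (Rpower (2 * A + 1) m * ((1 + a) * Rpower (1 + a) m)) with
          ((1 + a) * (Rpower (2 * A + 1) m * Rpower (1 + a) m)) by ring.
        apply Rmult_le_compat; [lra|lra|lra|].
        rewrite Rpower_mult_distr by lra.
        apply Rle_Rpower_l; [unfold m; lra|]. split; [lra|].
        assert (0 <= A * a) by (apply Rmult_le_pos; lra). lra.
Qed.

Lemma hardy_scal (p : R) (F : C -> C) (M : R) :
  0 < p -> 0 <= M -> hardy p F -> hardy p (fun z => RtoC M * F z)%C.
Proof.
  intros Hp HM0. rewrite !hardy_RInt_iff by exact Hp. intros [HF [M' HM]].
  split.
  - apply (holomorphic_mult (fun _ => RtoC M)); [|exact HF].
    intros z _. eexists. apply is_cderive_const.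
  - exists (rpow M p * M'). intros r Hr.
    assert (HFc := holomorphic_disc_continuous F HF).
    replace (RInt (fun t => rpow (Cmod (RtoC M * F (circle_pt r t))) p) 0 (2 * PI)) with
      (rpow M p * RInt (fun t => rpow (Cmod (F (circle_pt r t))) p) 0 (2 * PI)).
    + apply Rmult_le_compat_l; [apply rpow_ge_0|apply HM, Hr].
    + rewrite <- (RInt_scal (V := R_CompleteNormedModule))
        by (apply ex_RInt_mean_integrand; try assumption; lra).
      apply RInt_ext. intros t _.
      rewrite Cmod_mult, Cmod_R, (Rabs_pos_eq M), rpow_mult by (try assumption; apply Cmod_ge_0).
      reflexivity.
Qed.

(** The derivative of T g2 f is k times that of T g1 f, so M T g1 f dominates it whenever M bounds
    k. *)
Lemma optimal_domain_incl (p : R) (g1 g2 k : C -> C) :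
  1 <= p -> holomorphic g1 -> holomorphic g2 -> hardy_infty k ->
  (forall z, unit_disc z -> C_derive g2 z = (k z * C_derive g1 z)%C) ->
  forall f, optimal_domain g1 p f -> optimal_domain g2 p f.
Proof.
  intros Hp Hg1 Hg2 [Hk [M HM]] Hd f [Hf Hh]. split; [exact Hf|].
  assert (HM0 : 0 <= M).
  { eapply Rle_trans; [apply Cmod_ge_0|apply (HM (RtoC 0)), unit_disc_0]. }
  apply (hardy_subordinate p (fun z => RtoC M * T g1 f z)%C).
  - exact Hp.
  - apply holomorphic_T; assumption.
  - intros z Hz.
    rewrite (is_C_derive_unique _ z _ (is_cderive_T g2 f z Hf Hg2 Hz)).
    assert (E : C_derive (fun z => RtoC M * T g1 f z)%C z = (RtoC M * (f z * C_derive g1 z))%C).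
    { apply is_C_derive_unique. eapply is_cderive_eq.
      - apply (is_cderive_mult (fun _ => RtoC M) (T g1 f)); [apply is_cderive_const|].
        apply is_cderive_T; assumption.
      - cbv beta. cring. }
    rewrite E, Hd, !Cmod_mult, Cmod_R, Rabs_pos_eq by assumption.
    specialize (HM z Hz).
    replace (Cmod (f z) * (Cmod (k z) * Cmod (C_derive g1 z))) with
      (Cmod (k z) * (Cmod (f z) * Cmod (C_derive g1 z))) by ring.
    apply Rmult_le_compat_r; [apply Rmult_le_pos; apply Cmod_ge_0|exact HM].
  - apply hardy_scal; [lra|exact HM0|exact Hh].
Qed.

(** * Growth of derivatives and test functions *)

Lemma Cmod_sqr (z : C) : Cmod z ^ 2 = fst z ^ 2 + snd z ^ 2.
Proof. rewrite <- sqnorm_Cmod. reflexivity. Qed.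

(* The Poisson kernel is the real part of 2 zeta / (zeta - a) - 1. *)
Lemma is_RInt_inv_sqr_kernel (r : R) (a : C) :
  Cmod a < r ->
  is_RInt (fun t => / Cmod (circle_pt r t - a) ^ 2) 0 (2 * PI) (2 * PI / (r ^ 2 - Cmod a ^ 2)).
Proof.
  intros Ha. assert (Ha0 := Cmod_ge_0 a).
  assert (Hd : 0 < r ^ 2 - Cmod a ^ 2).
  { replace (r ^ 2 - Cmod a ^ 2) with ((r - Cmod a) * (r + Cmod a)) by ring.
    apply Rmult_lt_0_compat; lra. }
  assert (Hk : is_RInt (fun t => fst (circle_pt r t / (circle_pt r t - a))%C) 0 (2 * PI) (2 * PI)).
  { assert (I : ex_CInt (fun t => circle_pt r t / (circle_pt r t - a))%C 0 (2 * PI)).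
    { apply ex_CInt_continuous. intros t _. assert (Hz := Ccontinuous_circle_pt r t). ccont.
      apply circle_pt_minus_neq_0, Ha. }
    apply CInt_correct in I.
    rewrite CInt_circle_kernel in I by exact Ha.
    apply is_CInt_pair in I. apply I. }
  apply (is_RInt_ext (fun t => / (r ^ 2 - Cmod a ^ 2) *
    (2 * fst (circle_pt r t / (circle_pt r t - a))%C - 1))).
  - intros t _. assert (Hn := circle_pt_minus_neq_0 r t a Ha). apply Cmod_gt_0 in Hn.
    assert (Hz : Cmod (circle_pt r t) ^ 2 = r ^ 2) by (rewrite Cmod_circle_pt by lra; reflexivity).
    assert (Hn2 : 0 < Cmod (circle_pt r t - a) ^ 2) by (apply pow_lt, Hn).
    rewrite <- Hz in Hd |- *. rewrite (Cmod_sqr (circle_pt r t - a)) in Hn2 |- *.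
    rewrite (Cmod_sqr (circle_pt r t)), (Cmod_sqr a) in Hd |- *.
    destruct (circle_pt r t) as [x y], a as [c d].
    unfold Cdiv, Cinv, Cminus, Cplus, Copp, Cmult in *; cbn [fst snd] in *.
    match goal with |- @eq _ ?l ?m => change (@eq R l m) end.
    field. split; lra.
  - replace (2 * PI / (r ^ 2 - Cmod a ^ 2)) with
      (/ (r ^ 2 - Cmod a ^ 2) * (2 * (2 * PI) - (2 * PI - 0) * 1)) by (field; lra).
    apply is_RInt_Rscal, (is_RInt_minus (V := R_NormedModule)).
    + apply is_RInt_Rscal, Hk.
    + apply is_RInt_Rconst.
Qed.

(** A substitute for Hölder's inequality: values below the threshold [c] are bounded by [c], larger
    ones by their p-th power, and [c] remains free for optimisation. *)
Lemma le_rpow_scaled (x c p : R) :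
  1 <= p -> 0 <= x -> 0 < c -> x <= c + Rpower c (1 - p) * rpow x p.
Proof.
  intros Hp Hx Hc.
  assert (H0 : 0 <= Rpower c (1 - p) * rpow x p)
    by (apply Rmult_le_pos; [left; apply Rpower_pos|apply rpow_ge_0]).
  destruct (Rle_dec x c) as [H|H]; [lra|].
  assert (x <= Rpower c (1 - p) * rpow x p); [|lra].
  rewrite rpow_Rpower by lra.
  replace p with ((p - 1) + 1) at 2 by ring. rewrite Rpower_plus, Rpower_1 by lra.
  rewrite <- Rmult_assoc. rewrite <- (Rmult_1_l x) at 1. apply Rmult_le_compat_r; [lra|].
  replace (1 - p) with (- (p - 1)) by ring. rewrite Rpower_Ropp.
  apply Rmult_le_reg_l with (Rpower c (p - 1)); [apply Rpower_pos|].
  rewrite <- Rmult_assoc, Rinv_r, Rmult_1_l, Rmult_1_r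
    by (apply Rgt_not_eq, Rpower_pos).
  apply Rle_Rpower_l; lra.
Qed.

(** Cauchy's formula for h' on the circle halfway between [a] and the boundary. With d = 1 - |a|,
    the threshold c = d^(-1/p) is the size of h expected at distance d; it makes both contributions,
    of orders c / d and c^(1-p) / d^2, equal to d^(-1-1/p). *)
Lemma hardy_C_derive_bound (p : R) (h : C -> C) :
  1 <= p -> hardy p h ->
  exists K, forall a, unit_disc a -> Cmod (C_derive h a) <= K * Rpower (1 - Cmod a) (- 1 - / p).
Proof.
  intros Hp Hh. rewrite hardy_RInt_iff in Hh by lra. destruct Hh as [Hh [M HM]].
  assert (Hpi := two_PI_pos).
  exists ((2 * PI * 4 + 4 * M) / (2 * PI)). intros a Ha. unfold unit_disc in Ha.
  assert (Ha0 := Cmod_ge_0 a).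
  set (d := 1 - Cmod a). set (r := 1 - d / 2). set (c := Rpower d (- / p)).
  assert (Hd : 0 < d <= 1) by (unfold d; lra).
  assert (Hr : 0 < r < 1) by (unfold r; lra).
  assert (Har : Cmod a < r) by (unfold r, d; lra).
  assert (Hra : r - Cmod a = d / 2) by (unfold r, d; lra).
  assert (Hc : 0 < c) by apply Rpower_pos.
  specialize (HM r Hr).
  assert (Hhc := holomorphic_disc_continuous h Hh).
  set (f := fun t => rpow (Cmod (h (circle_pt r t))) p) in *.
  assert (If : ex_RInt f 0 (2 * PI)) by (apply ex_RInt_mean_integrand; try assumption; lra).
  rewrite (cauchy_formula_derive h r a Hh Har) by lra.
  rewrite Cmod_div, Cmod_R, Rabs_pos_eq by (try lra; apply RtoC_2PI_neq_0).
  replace ((2 * PI * 4 + 4 * M) / (2 * PI) * Rpower d (- 1 - / p)) with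
    ((2 * PI * 4 + 4 * M) * Rpower d (- 1 - / p) / (2 * PI)) by (field; lra).
  apply Rmult_le_compat_r; [left; apply Rinv_0_lt_compat, Hpi|].
  set (e := Rpower c (1 - p)).
  assert (He : 0 < e) by apply Rpower_pos.
  assert (I1 : is_RInt (fun t => c * / Cmod (circle_pt r t - a) ^ 2 + e * (4 / d ^ 2) * f t) 0 (2 * PI)
    (c * (2 * PI / (r ^ 2 - Cmod a ^ 2)) + e * (4 / d ^ 2) * RInt f 0 (2 * PI))).
  { apply is_RInt_Rplus; apply is_RInt_Rscal.
    - apply is_RInt_inv_sqr_kernel, Har.
    - apply RInt_Rcorrect, If. }
  assert (Hd2 : 0 < d ^ 2) by (apply pow_lt; lra).
  unfold cauchy_integral.
  eapply Rle_trans; [apply (Cmod_CInt_le _ (fun t => c * / Cmod (circle_pt r t - a) ^ 2 + e * (4 / d ^ 2) * f t))|].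
  - lra.
  - intros t _. set (z := circle_pt r t).
    assert (Hz : Cmod z = r) by (apply Cmod_circle_pt; lra).
    assert (Hn := circle_pt_minus_neq_0 r t a Har). fold z in Hn.
    assert (Hw : d / 2 <= Cmod (z - a)) by (assert (H := Cmod_triangle_inv z a); lra).
    rewrite Cmod_div, Cmod_mult, Cmod_pow, Hz by (apply Cpow_neq_0, Hn).
    set (w := Cmod (z - a)) in *.
    assert (Hw2 : (d / 2) ^ 2 <= w ^ 2) by (apply pow_incr; lra).
    assert (Hwp : 0 < w ^ 2) by (apply pow_lt; lra).
    assert (Hx := le_rpow_scaled (Cmod (h z)) c p Hp (Cmod_ge_0 _) Hc). fold e (f t) in Hx.
    change (rpow (Cmod (h z)) p) with (f t) in Hx.
    assert (Hft : 0 <= f t) by apply rpow_ge_0.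
    assert (Hiw : / w ^ 2 <= 4 / d ^ 2).
    { replace (4 / d ^ 2) with (/ (d / 2) ^ 2) by (field; lra).
      apply Rinv_le_contravar; [apply pow_lt; lra|exact Hw2]. }
    apply Rle_trans with ((c + e * f t) * / w ^ 2).
    + apply Rmult_le_compat_r; [left; apply Rinv_0_lt_compat, Hwp|].
      eapply Rle_trans; [|exact Hx]. rewrite <- (Rmult_1_r (Cmod (h z))) at 2.
      apply Rmult_le_compat_l; [apply Cmod_ge_0|lra].
    + rewrite Rmult_plus_distr_r. apply Rplus_le_compat_l.
      replace (e * (4 / d ^ 2) * f t) with (e * f t * (4 / d ^ 2)) by ring.
      apply Rmult_le_compat_l; [apply Rmult_le_pos; lra|exact Hiw].
  - apply ex_circle_kernel; try assumption; lra.
  - eexists; exact I1.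
  - rewrite (is_RInt_unique _ _ _ _ I1).
    assert (P1 : c * / d = Rpower d (- 1 - / p)).
    { unfold c. rewrite <- (Rpower_1 d) at 2 by lra. rewrite <- Rpower_Ropp, <- Rpower_plus.
      f_equal; ring. }
    assert (P2 : e / d ^ 2 = Rpower d (- 1 - / p)).
    { unfold e, c. rewrite Rpower_mult. rewrite <- Rpower_2_r by lra.
      unfold Rdiv. rewrite <- Rpower_Ropp, <- Rpower_plus. f_equal. field. lra. }
    set (X := Rpower d (- 1 - / p)) in *.
    replace ((2 * PI * 4 + 4 * M) * X) with (2 * PI * 4 * X + 4 * X * M) by ring.
    apply Rplus_le_compat.
    (* Here r - |a| = d/2 and r + |a| >= 1/2, so r^2 - |a|^2 is at least d/4. *)
    + rewrite <- P1.
      replace (r ^ 2 - Cmod a ^ 2) with ((r - Cmod a) * (r + Cmod a)) by ring. rewrite Hra.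
      replace (2 * PI * 4 * (c * / d)) with (c * (2 * PI / (d / 4))) by (field; lra).
      apply Rmult_le_compat_l; [lra|].
      apply Rmult_le_compat_l; [lra|].
      apply Rinv_le_contravar; [lra|].
      assert (1 / 2 <= r + Cmod a) by (unfold r, d; lra).
      replace (d / 4) with (d / 2 * (1 / 2)) by field. apply Rmult_le_compat_l; lra.
    + replace (e * (4 / d ^ 2)) with (4 * (e / d ^ 2)) by (field; lra). rewrite P2.
      apply Rmult_le_compat_l; [|exact HM].
      assert (0 < X) by apply Rpower_pos. lra.
Qed.

(** The exponent 2 - 1/p bounds these functions in H^p uniformly in a, while the derivative at a is
    at least (1 - |a|^2)^(-1-1/p), the order of the general growth bound. The factor z keeps that
    derivative nonzero at a = 0. *)
Definition peak (p : R) (a z : C) : C :=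
  (RtoC (Rpower (1 - Cmod a ^ 2) (2 - / p)) * (z / ((1 - Cconj a * z) * (1 - Cconj a * z))))%C.

Definition peak_derive (p : R) (a z : C) : C :=
  (RtoC (Rpower (1 - Cmod a ^ 2) (2 - / p)) *
   ((1 + Cconj a * z) / ((1 - Cconj a * z) * (1 - Cconj a * z) * (1 - Cconj a * z))))%C.

Lemma one_minus_conj_mult_bound (a z : C) :
  unit_disc a -> unit_disc z ->
  1 - Cmod z <= Cmod (1 - Cconj a * z) /\ 1 - Cmod a <= Cmod (1 - Cconj a * z) /\
  0 < Cmod (1 - Cconj a * z).
Proof.
  unfold unit_disc; intros Ha Hz.
  assert (H := Cmod_triangle_inv 1 (Cconj a * z)). rewrite Cmod_1, Cmod_mult, Cmod_conj in H.
  assert (Ha0 := Cmod_ge_0 a). assert (Hz0 := Cmod_ge_0 z).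
  assert (Cmod a * Cmod z <= 1 * Cmod z) by (apply Rmult_le_compat_r; lra).
  assert (Cmod a * Cmod z <= Cmod a * 1) by (apply Rmult_le_compat_l; lra).
  repeat split; lra.
Qed.

Lemma one_minus_conj_mult_neq_0 (a z : C) :
  unit_disc a -> unit_disc z -> (1 - Cconj a * z)%C <> RtoC 0.
Proof. intros Ha Hz. apply Cmod_gt_0, one_minus_conj_mult_bound; assumption. Qed.

Lemma one_minus_sqr_bound (x : R) : 0 <= x < 1 -> 0 < 1 - x ^ 2 <= 2 * (1 - x).
Proof.
  intros Hx. replace (1 - x ^ 2) with ((1 + x) * (1 - x)) by ring. split.
  - apply Rmult_lt_0_compat; lra.
  - apply Rmult_le_compat_r; lra.
Qed.

Lemma one_minus_sqr_Cmod_bound (a : C) :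
  unit_disc a -> 0 < 1 - Cmod a ^ 2 <= 2 * (1 - Cmod a).
Proof. intros Ha. apply one_minus_sqr_bound. split; [apply Cmod_ge_0|exact Ha]. Qed.

Lemma is_cderive_peak (p : R) (a z : C) :
  unit_disc a -> unit_disc z -> is_cderive (peak p a) z (peak_derive p a z).
Proof.
  intros Ha Hz. assert (Hn := one_minus_conj_mult_neq_0 a z Ha Hz).
  unfold peak, peak_derive. cderive.
  - apply Cmult_neq_0; exact Hn.
  - cfield. exact Hn.
Qed.

Lemma Rpower_1_minus_sqr_le_1 (a : C) (e : R) :
  unit_disc a -> 0 <= e -> Rpower (1 - Cmod a ^ 2) e <= 1.
Proof.
  intros Ha He. assert (H := one_minus_sqr_Cmod_bound a Ha).
  apply Rle_trans with (Rpower 1 e).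
  - apply Rle_Rpower_l; [exact He|]. generalize (pow2_ge_0 (Cmod a)). lra.
  - rewrite Rpower_1_l. lra.
Qed.

Lemma inv_p_bound (p : R) : 1 <= p -> 0 < / p <= 1.
Proof.
  intros Hp. split; [apply Rinv_0_lt_compat; lra|].
  rewrite <- Rinv_1. apply Rinv_le_contravar; lra.
Qed.

Lemma Cmod_peak_le (p : R) (a z : C) :
  1 <= p -> unit_disc a -> unit_disc z -> Cmod (peak p a z) <= / (1 - Cmod z) ^ 2.
Proof.
  intros Hp Ha Hz. destruct (one_minus_conj_mult_bound a z Ha Hz) as [B1 [_ B]].
  assert (Hip := inv_p_bound p Hp).
  assert (HA := Rpower_1_minus_sqr_le_1 a (2 - / p) Ha ltac:(lra)).
  assert (Hn := one_minus_conj_mult_neq_0 a z Ha Hz).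
  unfold unit_disc in Hz. assert (Hz0 := Cmod_ge_0 z).
  unfold peak. rewrite Cmod_mult, Cmod_R, Rabs_pos_eq by (left; apply Rpower_pos).
  rewrite Cmod_div, Cmod_mult by (apply Cmult_neq_0; exact Hn).
  set (w := Cmod (1 - Cconj a * z)) in *.
  assert (0 < w * w) by (apply Rmult_lt_0_compat; lra).
  apply Rle_trans with (1 * (1 * / (w * w))).
  - apply Rmult_le_compat; [left; apply Rpower_pos| |exact HA|].
    + apply Rmult_le_pos; [lra|left; apply Rinv_0_lt_compat; lra].
    + apply Rmult_le_compat_r; [left; apply Rinv_0_lt_compat; lra|lra].
  - rewrite !Rmult_1_l. apply Rinv_le_contravar; [apply pow_lt; lra|].
    simpl. rewrite Rmult_1_r. apply Rmult_le_compat; lra.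
Qed.

Lemma Rpower_conjugate_weights (x p : R) :
  0 < x -> Rpower x (2 - / p) * Rpower x (1 + / p) = x ^ 3.
Proof.
  intros Hx. rewrite <- Rpower_plus, <- Rpower_pow by exact Hx. f_equal. simpl. ring.
Qed.

(** Both 1 - |a|^2 and 1 - |b|^2 are at most twice w = |1 - conj(a) b|, and their exponents add up
    to 3. The numerator is at most 2, so the bound is 2 * 2^3 = 16. *)
Lemma Cmod_peak_derive_le (p : R) (a b : C) :
  1 <= p -> unit_disc a -> unit_disc b ->
  Cmod (peak_derive p a b) * Rpower (1 - Cmod b ^ 2) (1 + / p) <= 16.
Proof.
  intros Hp Ha Hb. destruct (one_minus_conj_mult_bound a b Ha Hb) as [B1 [B2 B]].
  assert (Hip := inv_p_bound p Hp).
  assert (Wa := one_minus_sqr_Cmod_bound a Ha). assert (Wb := one_minus_sqr_Cmod_bound b Hb).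
  assert (Hn := one_minus_conj_mult_neq_0 a b Ha Hb).
  unfold peak_derive. rewrite Cmod_mult, Cmod_R, Rabs_pos_eq by (left; apply Rpower_pos).
  rewrite Cmod_div, !Cmod_mult by (repeat apply Cmult_neq_0; exact Hn).
  assert (Hnum : Cmod (1 + Cconj a * b) <= 2).
  { eapply Rle_trans; [apply Cmod_triangle|]. rewrite Cmod_1, Cmod_mult, Cmod_conj.
    unfold unit_disc in *. generalize (Cmod_ge_0 a) (Cmod_ge_0 b). intros.
    assert (Cmod a * Cmod b <= 1 * 1) by (apply Rmult_le_compat; lra). lra. }
  set (w := Cmod (1 - Cconj a * b)) in *.
  assert (Hw3 : 0 < w * w * w) by (repeat apply Rmult_lt_0_compat; lra).
  assert (Q1 : Rpower (1 - Cmod a ^ 2) (2 - / p) <= Rpower (2 * w) (2 - / p))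
    by (apply Rle_Rpower_l; lra).
  assert (Q2 : Rpower (1 - Cmod b ^ 2) (1 + / p) <= Rpower (2 * w) (1 + / p))
    by (apply Rle_Rpower_l; lra).
  assert (Q3 := Rpower_conjugate_weights (2 * w) p ltac:(lra)).
  set (X := Rpower (1 - Cmod a ^ 2) (2 - / p)) in *.
  set (Y := Rpower (1 - Cmod b ^ 2) (1 + / p)) in *.
  assert (HX : 0 < X) by apply Rpower_pos. assert (HY : 0 < Y) by apply Rpower_pos.
  assert (HXY : X * Y <= 8 * (w * w * w)) by (replace (8 * (w * w * w)) with ((2 * w) ^ 3) by ring; rewrite <- Q3; apply Rmult_le_compat; lra).
  apply Rmult_le_reg_r with (w * w * w); [exact Hw3|].
  replace (X * (Cmod (1 + Cconj a * b) / (w * w * w)) * Y * (w * w * w)) with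
    (Cmod (1 + Cconj a * b) * (X * Y)) by (field; lra).
  replace (16 * (w * w * w)) with (2 * (8 * (w * w * w))) by ring.
  apply Rmult_le_compat; [apply Cmod_ge_0|apply Rmult_le_pos; lra|exact Hnum|exact HXY].
Qed.

Lemma Cmod_peak_derive_diag (p : R) (a : C) :
  1 <= p -> unit_disc a ->
  1 <= Cmod (peak_derive p a a) * Rpower (1 - Cmod a ^ 2) (1 + / p).
Proof.
  intros Hp Ha.
  assert (Wa := one_minus_sqr_Cmod_bound a Ha).
  assert (Hn := one_minus_conj_mult_neq_0 a a Ha Ha).
  assert (E : (Cconj a * a)%C = RtoC (Cmod a ^ 2)).
  { rewrite Cmod_sqr. destruct a as [x y]. unfold Cconj, Cmult, RtoC; cbn [fst snd].
    f_equal; ring. }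
  unfold peak_derive. rewrite E in Hn |- *.
  rewrite <- RtoC_minus in Hn |- *. rewrite <- RtoC_plus, <- !RtoC_mult.
  assert (Hq := pow2_ge_0 (Cmod a)).
  set (q := 1 - Cmod a ^ 2) in *.
  rewrite <- RtoC_div by (repeat apply Rmult_integral_contrapositive_currified; lra).
  rewrite <- RtoC_mult, Cmod_R.
  assert (Q3 := Rpower_conjugate_weights q p ltac:(lra)).
  assert (Hq3 : 0 < q * q * q) by (repeat apply Rmult_lt_0_compat; lra).
  rewrite Rabs_pos_eq.
  - replace (Rpower q (2 - / p) * ((1 + Cmod a ^ 2) / (q * q * q)) * Rpower q (1 + / p)) with
      (Rpower q (2 - / p) * Rpower q (1 + / p) * ((1 + Cmod a ^ 2) / (q * q * q))) by ring.
    rewrite Q3. replace (q ^ 3 * ((1 + Cmod a ^ 2) / (q * q * q))) with (1 + Cmod a ^ 2)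
      by (field; lra). lra.
  - apply Rmult_le_pos; [left; apply Rpower_pos|].
    apply Rmult_le_pos; [lra|left; apply Rinv_0_lt_compat, Hq3].
Qed.

(** Conjugation followed by multiplication by e^(it) turns one into the other. The right side is the
    kernel on the unit circle for the interior point r a, whose inverse square has a known
    integral. *)
Lemma Cmod_one_minus_conj_circle (a : C) (r t : R) :
  Cmod (1 - Cconj a * circle_pt r t) = Cmod (circle_pt 1 t - RtoC r * a).
Proof.
  replace (circle_pt 1 t - RtoC r * a)%C with
    (circle_pt 1 t * Cconj (1 - Cconj a * circle_pt r t))%C.
  - rewrite Cmod_mult, Cmod_conj, Cmod_circle_pt by lra. ring.
  - assert (H := sin2_cos2 t). unfold Rsqr in H.
    destruct a as [x y].
    unfold circle_pt, Cconj, Cmult, Cminus, Cplus, Copp, RtoC; cbn [fst snd].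
    f_equal; [replace (r * x) with (r * x * (sin t * sin t + cos t * cos t)) by (rewrite H; ring)
      |replace (r * y) with (r * y * (sin t * sin t + cos t * cos t)) by (rewrite H; ring)]; ring.
Qed.

(** Of the 2p factors 1/w, where w = |1 - conj(a) z|, two form the Poisson kernel; the other 2p - 2
    >= 0 are absorbed by (1 - |a|^2) / w <= 2. *)
Lemma rpow_peak_le (p : R) (a z : C) :
  1 <= p -> unit_disc a -> unit_disc z ->
  rpow (Cmod (peak p a z)) p <=
  Rpower 2 (2 * p - 2) * ((1 - Cmod a ^ 2) * / Cmod (1 - Cconj a * z) ^ 2).
Proof.
  intros Hp Ha Hz. destruct (one_minus_conj_mult_bound a z Ha Hz) as [_ [B2 B]].
  assert (Hip := inv_p_bound p Hp).
  assert (Wa := one_minus_sqr_Cmod_bound a Ha).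
  assert (Hn := one_minus_conj_mult_neq_0 a z Ha Hz).
  set (q := 1 - Cmod a ^ 2) in *. set (w := Cmod (1 - Cconj a * z)) in *.
  assert (Hw2 : 0 < w ^ 2) by (apply pow_lt, B).
  assert (H1 : Cmod (peak p a z) <= Rpower q (2 - / p) * / w ^ 2).
  { unfold peak. rewrite Cmod_mult, Cmod_R, Rabs_pos_eq by (left; apply Rpower_pos).
    apply Rmult_le_compat_l; [left; apply Rpower_pos|].
    rewrite Cmod_div, Cmod_mult by (apply Cmult_neq_0; exact Hn). fold w.
    replace (w * w) with (w ^ 2) by ring.
    rewrite <- (Rmult_1_l (/ w ^ 2)). apply Rmult_le_compat_r;
      [left; apply Rinv_0_lt_compat, Hw2|]. unfold unit_disc in Hz. lra. }
  eapply Rle_trans; [apply rpow_le; [lra|split; [apply Cmod_ge_0|exact H1]]|].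
  assert (Hiw : 0 < / w ^ 2) by (apply Rinv_0_lt_compat, Hw2).
  rewrite rpow_Rpower by (apply Rmult_lt_0_compat; [apply Rpower_pos|exact Hiw]).
  rewrite <- Rpower_mult_distr by (try exact Hiw; apply Rpower_pos).
  rewrite Rpower_mult. replace ((2 - / p) * p) with ((2 * p - 2) + 1) by (field; lra).
  rewrite Rpower_plus, Rpower_1 by lra.
  assert (E : Rpower (/ w ^ 2) p = / Rpower w (2 * p - 2) * / w ^ 2).
  { replace (/ w ^ 2) with (Rpower w (- (2))).
    - rewrite Rpower_mult, <- Rpower_Ropp, <- Rpower_plus. f_equal. ring.
    - rewrite Rpower_Ropp, Rpower_2_r by exact B. reflexivity. }
  rewrite E.
  replace (Rpower q (2 * p - 2) * q * (/ Rpower w (2 * p - 2) * / w ^ 2)) with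
    (Rpower q (2 * p - 2) * / Rpower w (2 * p - 2) * (q * / w ^ 2)) by ring.
  apply Rmult_le_compat_r; [apply Rmult_le_pos; lra|].
  assert (Hwp := Rpower_pos w (2 * p - 2)).
  apply Rmult_le_reg_r with (Rpower w (2 * p - 2)); [exact Hwp|].
  rewrite Rmult_assoc, Rinv_l, Rmult_1_r by lra.
  rewrite Rpower_mult_distr by lra.
  apply Rle_Rpower_l; lra.
Qed.

Lemma holomorphic_peak (p : R) (a : C) : unit_disc a -> holomorphic (peak p a).
Proof. intros Ha z Hz. eexists. apply is_cderive_peak; assumption. Qed.

Lemma RInt_peak_le (p r : R) (a : C) :
  1 <= p -> unit_disc a -> 0 < r < 1 ->
  RInt (fun t => rpow (Cmod (peak p a (circle_pt r t))) p) 0 (2 * PI) <=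
  Rpower 2 (2 * p - 2) * (2 * PI).
Proof.
  intros Hp Ha Hr. assert (Hpi := two_PI_pos).
  assert (Wa := one_minus_sqr_Cmod_bound a Ha).
  assert (Hra : Cmod (RtoC r * a) < 1).
  { rewrite Cmod_mult, Cmod_R, Rabs_pos_eq by lra. unfold unit_disc in Ha.
    generalize (Cmod_ge_0 a). intros.
    assert (r * Cmod a <= 1 * Cmod a) by (apply Rmult_le_compat_r; lra). lra. }
  assert (I := is_RInt_inv_sqr_kernel 1 (RtoC r * a) Hra).
  apply (is_RInt_Rscal _ _ _ (1 - Cmod a ^ 2)) in I.
  apply (is_RInt_Rscal _ _ _ (Rpower 2 (2 * p - 2))) in I.
  eapply Rle_trans; [apply (RInt_le _ (fun t => Rpower 2 (2 * p - 2) *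
    ((1 - Cmod a ^ 2) * / Cmod (circle_pt 1 t - RtoC r * a) ^ 2)))|].
  - lra.
  - apply ex_RInt_mean_integrand; [lra| |lra].
    apply holomorphic_disc_continuous, holomorphic_peak, Ha.
  - eexists; exact I.
  - intros t _. rewrite <- Cmod_one_minus_conj_circle.
    apply rpow_peak_le; try assumption. apply unit_disc_circle_pt. lra.
  - apply (is_RInt_unique (V := R_CompleteNormedModule)) in I.
    eapply Rle_trans; [right; exact I|].
    apply Rmult_le_compat_l; [left; apply Rpower_pos|].
    change ((1 - Cmod a ^ 2) * (2 * PI / (1 ^ 2 - Cmod (RtoC r * a) ^ 2)) <= 2 * PI).
    rewrite Cmod_mult, Cmod_R, Rabs_pos_eq by lra.
    replace ((r * Cmod a) ^ 2) with (r ^ 2 * Cmod a ^ 2) by ring.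
    assert (r ^ 2 * Cmod a ^ 2 <= 1 * Cmod a ^ 2).
    { apply Rmult_le_compat_r; [apply pow2_ge_0|].
      assert (r ^ 2 <= 1 ^ 2) by (apply pow_incr; lra). lra. }
    apply Rmult_le_reg_r with (1 ^ 2 - r ^ 2 * Cmod a ^ 2); [lra|].
    replace ((1 - Cmod a ^ 2) * (2 * PI / (1 ^ 2 - r ^ 2 * Cmod a ^ 2)) * (1 ^ 2 - r ^ 2 * Cmod a ^ 2))
      with (2 * PI * (1 - Cmod a ^ 2)) by (field; lra).
    apply Rmult_le_compat_l; lra.
Qed.

(** * Multipliers of derivatives: necessity of boundedness *)

Lemma le_0_of_geometric (x D : R) : (forall n, x <= D * / 2 ^ n) -> x <= 0.
Proof.
  intros H. apply Rnot_lt_le. intros Hx.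
  destruct (geometric_small D x Hx) as [n Hn]. specialize (H n). lra.
Qed.

Lemma disc_continuous_limit (fn : nat -> C -> C) (f : C -> C) :
  (forall n, disc_continuous (fn n)) ->
  (forall rho, 0 <= rho < 1 -> exists D, forall z, Cmod z <= rho ->
     forall n, Cmod (fn n z - f z) <= D * / 2 ^ n) ->
  disc_continuous f.
Proof.
  intros Hn Hlim z Hz. apply Ccontinuous_eps; intros eps He.
  unfold unit_disc in Hz. assert (Hz0 := Cmod_ge_0 z).
  set (rho := (1 + Cmod z) / 2).
  destruct (Hlim rho) as [D HD]; [unfold rho; lra|].
  destruct (geometric_small D (eps / 3)) as [n Hsmall]; [lra|].
  assert (Hc := proj1 (Ccontinuous_eps _ _) (Hn n z Hz) (eps / 3) ltac:(lra)).
  apply locally_C_eps in Hc. destruct Hc as [d [Hd Hc]].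
  apply locally_C_eps. exists (Rmin d (rho - Cmod z)).
  split; [apply Rmin_pos; [lra|unfold rho; lra]|].
  intros w Hw.
  assert (H1 := Rlt_le_trans _ _ _ Hw (Rmin_l _ _)).
  assert (H2 := Rlt_le_trans _ _ _ Hw (Rmin_r _ _)).
  assert (H3 := Cmod_triangle_inv w z).
  assert (Ew := HD w ltac:(lra) n). assert (Ez := HD z ltac:(unfold rho; lra) n).
  specialize (Hc w H1).
  replace (f w - f z)%C with ((fn n w - fn n z) - (fn n w - f w) + (fn n z - f z))%C by cring.
  eapply Rle_lt_trans; [apply Cmod_triangle|].
  eapply Rle_lt_trans; [apply Rplus_le_compat_r, Cmod_minus_triangle|]. lra.
Qed.

Lemma circle_kernel_diff_le (f g : C -> C) (r e : R) (j : nat) (a : C) :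
  disc_continuous f -> disc_continuous g -> Cmod a < r -> r < 1 ->
  (forall z, Cmod z <= r -> Cmod (f z - g z) <= e) ->
  Cmod (cauchy_integral f r j a - cauchy_integral g r j a) <=
  2 * PI * (e * (r / (r - Cmod a) ^ j)).
Proof.
  intros Hf Hg Ha Hr He. unfold cauchy_integral.
  assert (Ha0 := Cmod_ge_0 a). assert (Hpi := two_PI_pos).
  assert (If := ex_circle_kernel f r j a Hf Ha Hr).
  assert (Ig := ex_circle_kernel g r j a Hg Ha Hr).
  rewrite <- CInt_minus by assumption.
  replace (2 * PI) with (2 * PI - 0) at 2 by ring.
  apply Cmod_CInt_le_const; [lra| |apply (ex_RInt_minus (V := C_R_NormedModule)); assumption].
  intros t _. assert (Hn := circle_pt_minus_neq_0 r t a Ha).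
  set (z := circle_pt r t) in *.
  assert (Hz : Cmod z = r) by (apply Cmod_circle_pt; lra).
  assert (Hnj := Cpow_neq_0 (z - a)%C j Hn).
  replace (f z * z / (z - a) ^ j - g z * z / (z - a) ^ j)%C with
    ((f z - g z) * (z / (z - a) ^ j))%C by (cfield; exact Hnj).
  rewrite Cmod_mult, Cmod_div, Cmod_pow, Hz by exact Hnj.
  assert (Hd : 0 < (r - Cmod a) ^ j) by (apply pow_lt; lra).
  assert (Hw : r - Cmod a <= Cmod (z - a)) by (assert (H := Cmod_triangle_inv z a); lra).
  apply Rmult_le_compat; [apply Cmod_ge_0| |apply He; lra|].
  - apply Rmult_le_pos; [lra|left; apply Rinv_0_lt_compat, pow_lt; lra].
  - apply Rmult_le_compat_l; [lra|]. apply Rinv_le_contravar; [exact Hd|].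
    apply pow_incr; lra.
Qed.

(** Weierstrass' theorem: Cauchy's formula passes to the limit, and the limit is then differentiated
    under the integral. Geometric rates stand in for uniform convergence and carry over to the
    derivatives. *)
Lemma holomorphic_limit (fn : nat -> C -> C) (f : C -> C) :
  (forall n, holomorphic (fn n)) ->
  (forall rho, 0 <= rho < 1 -> exists D, forall z, Cmod z <= rho ->
     forall n, Cmod (fn n z - f z) <= D * / 2 ^ n) ->
  holomorphic f /\
  forall a, unit_disc a -> exists D, forall n,
    Cmod (C_derive (fn n) a - C_derive f a) <= D * / 2 ^ n.
Proof.
  intros Hn Hlim.
  assert (Hnc : forall n, disc_continuous (fn n))
    by (intros n; apply holomorphic_disc_continuous, Hn).
  assert (Hc := disc_continuous_limit fn f Hnc Hlim).
  assert (Hpi := two_PI_pos).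
  assert (Hk : forall r a j, Cmod a < r -> r < 1 -> exists D, forall n,
    Cmod (cauchy_integral (fn n) r j a / RtoC (2 * PI) -
      cauchy_integral f r j a / RtoC (2 * PI)) <= D * / 2 ^ n).
  { intros r a j Ha Hr. assert (Ha0 := Cmod_ge_0 a).
    destruct (Hlim r ltac:(lra)) as [D HD].
    exists (D * (r / (r - Cmod a) ^ j)). intros n.
    assert (Hpi0 := RtoC_2PI_neq_0).
    replace (cauchy_integral (fn n) r j a / RtoC (2 * PI) -
      cauchy_integral f r j a / RtoC (2 * PI))%C with
      ((cauchy_integral (fn n) r j a - cauchy_integral f r j a) / RtoC (2 * PI))%C
      by (cfield; exact Hpi0).
    rewrite Cmod_div, Cmod_R, Rabs_pos_eq by (try exact Hpi0; lra).
    apply Rmult_le_reg_r with (2 * PI); [exact Hpi|].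
    unfold Rdiv at 1. rewrite Rmult_assoc, Rinv_l, Rmult_1_r by lra.
    eapply Rle_trans; [apply (circle_kernel_diff_le (fn n) f r (D * / 2 ^ n))|];
      try assumption; try apply Hnc.
    - intros z Hz. apply HD, Hz.
    - right; ring. }
  assert (Hcf : forall r a, Cmod a < r -> r < 1 ->
    f a = (cauchy_integral f r 1 a / RtoC (2 * PI))%C).
  { intros r a Ha Hr. assert (Ha0 := Cmod_ge_0 a).
    destruct (Hk r a 1%nat Ha Hr) as [D1 H1].
    destruct (Hlim r ltac:(lra)) as [D2 H2].
    set (K := (cauchy_integral f r 1 a / RtoC (2 * PI))%C) in *.
    assert (E : Cmod (f a - K) <= 0).
    { apply (le_0_of_geometric _ (D1 + D2)). intros n.
      specialize (H1 n). specialize (H2 a ltac:(lra) n).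
      rewrite <- (cauchy_formula (fn n) r a (Hn n) Ha Hr) in H1.
      replace (f a - K)%C with ((fn n a - K) - (fn n a - f a))%C by cring.
      eapply Rle_trans; [apply Cmod_minus_triangle|]. lra. }
    assert (E0 : (f a - K)%C = RtoC 0)
      by (apply Cmod_eq_0, Rle_antisym; [exact E|apply Cmod_ge_0]).
    replace (f a) with (f a - K + K)%C by cring. rewrite E0. cring. }
  assert (Hd : forall r a, Cmod a < r -> r < 1 ->
    is_cderive f a (cauchy_integral f r 2 a / RtoC (2 * PI))%C).
  { intros r a Ha Hr.
    apply (is_cderive_ext_loc (fun z => cauchy_integral f r 1 z / RtoC (2 * PI))%C).
    - destruct (near_in_disc_of_radius r a Ha) as [d [Hd H]]. exists d. split; [exact Hd|].
      intros w Hw. symmetry. apply Hcf; [apply H, Hw|exact Hr].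
    - apply is_cderive_div_const, is_cderive_circle_kernel_1; assumption. }
  split.
  - intros z Hz. unfold unit_disc in Hz. eexists. apply (Hd ((1 + Cmod z) / 2)); lra.
  - intros a Ha. unfold unit_disc in Ha. set (r := (1 + Cmod a) / 2).
    assert (Har : Cmod a < r) by (unfold r; lra). assert (Hr : r < 1) by (unfold r; lra).
    destruct (Hk r a 2%nat Har Hr) as [D HD]. exists D. intros n. specialize (HD n).
    rewrite <- (cauchy_formula_derive (fn n) r a (Hn n) Har Hr) in HD.
    rewrite (is_C_derive_unique f a _ (Hd r a Har Hr)). exact HD.
Qed.

(** * Signed sums and the series of peaks *)

Fixpoint csum (u : nat -> C) (N : nat) : C :=
  match N with O => RtoC 0 | S N => (csum u N + u N)%C end.

Fixpoint rsum (u : nat -> R) (N : nat) : R :=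
  match N with O => 0 | S N => rsum u N + u N end.

(* Choosing each sign according to the partial sum obtained so far prevents the
   n-th partial sum from being smaller than its last term. *)
Lemma sign_choice (w : nat -> R) (v : nat -> nat -> C) :
  exists c : nat -> R, forall n, Rabs (c n) = Rabs (w n) /\
    Rabs (w n) * Cmod (v n n) <= Cmod (csum (fun m => RtoC (c m) * v m n)%C (S n)).
Proof.
  set (pick := fun (n : nat) (s : C) =>
    if Rle_dec (Rabs (w n) * Cmod (v n n)) (Cmod (s + RtoC (w n) * v n n)) then w n else - w n).
  (* [acc n k] is the sum of the first n terms in column k. All columns are tracked together,
     because the n-th sign is dictated by column n but enters every column. *)
  set (acc := fix acc (n : nat) : nat -> C := match n with
    | O => fun _ => RtoC 0
    | S n => fun k => (acc n k + RtoC (pick n (acc n n)) * v n k)%C end).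
  exists (fun n => pick n (acc n n)). intros n.
  assert (E : forall N k, csum (fun m => RtoC (pick m (acc m m)) * v m k)%C N = acc N k).
  { intros N k. induction N as [|N IH]; [reflexivity|]. cbn [csum]. rewrite IH. reflexivity. }
  split.
  - unfold pick. destruct (Rle_dec _ _); [reflexivity|apply Rabs_Ropp].
  - cbn [csum]. rewrite E. set (s := acc n n). unfold pick.
    destruct (Rle_dec _ _) as [H|H]; [exact H|].
    (* If |s + x| < |x|, then |s - x| >= 2 |x| - |s + x| > |x|. *)
    apply Rnot_le_lt in H. rewrite RtoC_opp.
    set (x := (RtoC (w n) * v n n)%C) in *.
    assert (Hx : Rabs (w n) * Cmod (v n n) = Cmod x)
      by (unfold x; rewrite Cmod_mult, Cmod_R; reflexivity).
    rewrite Hx in *.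
    replace (s + - RtoC (w n) * v n n)%C with (s + x - (x + x))%C by (unfold x; cring).
    rewrite Cmod_minus_sym. eapply Rle_trans; [|apply Cmod_triangle_inv].
    replace (x + x)%C with (RtoC 2 * x)%C by cring.
    rewrite Cmod_mult, Cmod_R, Rabs_pos_eq by lra. lra.
Qed.

Lemma Cmod_csum_le (u : nat -> C) (x : nat -> R) (N : nat) :
  (forall n, Cmod (u n) <= x n) -> Cmod (csum u N) <= rsum x N.
Proof.
  intros H. induction N; simpl; [rewrite Cmod_0; lra|].
  eapply Rle_trans; [apply Cmod_triangle|]. apply Rplus_le_compat; [exact IHN|apply H].
Qed.

Lemma rsum_shift (u : nat -> R) (N : nat) : rsum u (S N) = u O + rsum (fun n => u (S n)) N.
Proof.
  induction N; [simpl; ring|].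
  change (rsum u (S (S N))) with (rsum u (S N) + u (S N)). rewrite IHN. simpl. ring.
Qed.

Lemma rsum_scal (c : R) (u : nat -> R) (N : nat) :
  rsum (fun n => c * u n) N = c * rsum u N.
Proof. induction N; simpl; [ring|rewrite IHN; ring]. Qed.

Lemma rsum_ge_0 (u : nat -> R) (N : nat) : (forall n, 0 <= u n) -> 0 <= rsum u N.
Proof. intros H. induction N; simpl; [lra|]. specialize (H N). lra. Qed.

Lemma rsum_ext (u v : nat -> R) (N : nat) : (forall n, u n = v n) -> rsum u N = rsum v N.
Proof. intros H. induction N; simpl; [reflexivity|]. rewrite IHN, H. reflexivity. Qed.

Lemma rpow_plus_le (x y p : R) :
  0 <= p -> 0 <= x -> 0 <= y -> rpow (x + y) p <= rpow 2 p * (rpow x p + rpow y p).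
Proof.
  intros Hp Hx Hy.
  assert (H2 := rpow_ge_0 2 p). assert (Px := rpow_ge_0 x p). assert (Py := rpow_ge_0 y p).
  destruct (Rle_dec x y) as [H|H].
  - apply Rle_trans with (rpow (2 * y) p); [apply rpow_le; lra|].
    rewrite rpow_mult by lra. apply Rmult_le_compat_l; lra.
  - apply Rle_trans with (rpow (2 * x) p); [apply rpow_le; lra|].
    rewrite rpow_mult by lra. apply Rmult_le_compat_l; lra.
Qed.

Lemma rpow_1_l (p : R) : rpow 1 p = 1.
Proof. rewrite rpow_Rpower by lra. apply Rpower_1_l. Qed.

(** Peeling off the first term costs a factor 2^p from the crude triangle inequality for p-th
    powers. Each remaining term gains 64^-p, and (2 / 64)^p <= 1/32 because p >= 1; so the cost does
    not accumulate and Minkowski's inequality is avoided. *)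
Lemma rpow_rsum_le (p : R) (x : nat -> R) (N : nat) :
  1 <= p -> (forall n, 0 <= x n) ->
  rpow (rsum (fun n => / 64 ^ n * x n) N) p <=
  rpow 2 p * rsum (fun n => / 32 ^ n * rpow (x n) p) N.
Proof.
  intros Hp. assert (H2 := rpow_ge_0 2 p).
  revert x. induction N; intros x Hx.
  - simpl. rewrite rpow_0. lra.
  - rewrite !rsum_shift.
    set (y := rsum (fun n => / 64 ^ n * x (S n)) N).
    assert (Hy : 0 <= y).
    { apply rsum_ge_0. intros n. apply Rmult_le_pos; [|apply Hx].
      left; apply Rinv_0_lt_compat, pow_lt; lra. }
    replace (rsum (fun n => / 64 ^ S n * x (S n)) N) with (/ 64 * y).
    2: { unfold y. rewrite <- rsum_scal. apply rsum_ext. intros n. simpl. field.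
         apply pow_nonzero; lra. }
    replace (rsum (fun n => / 32 ^ S n * rpow (x (S n)) p) N) with
      (/ 32 * rsum (fun n => / 32 ^ n * rpow (x (S n)) p) N).
    2: { rewrite <- rsum_scal. apply rsum_ext. intros n. simpl. field.
         apply pow_nonzero; lra. }
    specialize (IHN (fun n => x (S n)) (fun n => Hx (S n))). fold y in IHN.
    set (Z := rsum (fun n => / 32 ^ n * rpow (x (S n)) p) N) in *.
    replace (/ 64 ^ 0 * x 0%nat) with (x 0%nat) by (simpl; field).
    replace (/ 32 ^ 0 * rpow (x 0%nat) p) with (rpow (x 0%nat) p) by (simpl; field).
    eapply Rle_trans; [apply rpow_plus_le; [lra|apply Hx|lra]|].
    apply Rmult_le_compat_l; [exact H2|]. apply Rplus_le_compat_l.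
    rewrite rpow_mult by lra.
    assert (H32 : rpow (/ 64) p * rpow 2 p <= / 32).
    { rewrite <- rpow_mult by lra. replace (/ 64 * 2) with (/ 32) by field.
      rewrite rpow_Rpower by lra.
      rewrite <- (Rpower_1 (/ 32)) at 2 by lra.
      replace p with (1 + (p - 1)) by ring. rewrite Rpower_plus.
      rewrite <- (Rmult_1_r (Rpower (/ 32) 1)) at 2.
      apply Rmult_le_compat_l; [left; apply Rpower_pos|].
      apply Rle_trans with (Rpower 1 (p - 1)); [apply Rle_Rpower_l; lra|].
      rewrite Rpower_1_l. lra. }
    assert (HZ : 0 <= Z).
    { apply rsum_ge_0. intros n. apply Rmult_le_pos; [|apply rpow_ge_0].
      left; apply Rinv_0_lt_compat, pow_lt; lra. }
    apply Rle_trans with (rpow (/ 64) p * rpow 2 p * Z).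
    + rewrite Rmult_assoc. apply Rmult_le_compat_l; [apply rpow_ge_0|exact IHN].
    + apply Rmult_le_compat_r; assumption.
Qed.

Lemma RInt_rsum_le (f : nat -> R -> R) (w : nat -> R) (a b K : R) (N : nat) :
  (forall n, 0 <= w n) -> (forall n, ex_RInt (f n) a b) -> (forall n, RInt (f n) a b <= K) ->
  exists I, is_RInt (fun t => rsum (fun n => w n * f n t) N) a b I /\ I <= rsum w N * K.
Proof.
  intros Hw Hf HK. induction N as [|N [I [HI IH]]].
  - exists ((b - a) * 0). split; [|simpl; lra].
    exact (is_RInt_Rconst a b 0).
  - exists (I + w N * RInt (f N) a b). split.
    + simpl. apply is_RInt_Rplus; [exact HI|].
      apply is_RInt_Rscal, RInt_Rcorrect, Hf.
    + simpl. rewrite Rmult_plus_distr_r. apply Rplus_le_compat; [exact IH|].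
      apply Rmult_le_compat_l; [apply Hw|apply HK].
Qed.

Lemma rsum_inv_pow_le (q : R) (N : nat) : 2 <= q -> rsum (fun n => / q ^ n) N <= 2.
Proof.
  intros Hq.
  assert (H : rsum (fun n => / q ^ n) N <= 2 - / q ^ N * 2).
  { induction N; [simpl; lra|]. cbn [rsum].
    assert (Hp : 0 < / q ^ N) by (apply Rinv_0_lt_compat, pow_lt; lra).
    assert (/ q ^ S N <= / q ^ N / 2).
    { simpl. rewrite Rinv_mult, Rmult_comm. apply Rmult_le_compat_l; [lra|].
      apply Rinv_le_contravar; lra. }
    lra. }
  assert (0 < / q ^ N) by (apply Rinv_0_lt_compat, pow_lt; lra). lra.
Qed.

Lemma is_cderive_csum (u u' : nat -> C -> C) (z : C) (N : nat) :
  (forall n, is_cderive (u n) z (u' n z)) ->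
  is_cderive (fun z => csum (fun n => u n z) N) z (csum (fun n => u' n z) N).
Proof.
  intros H. induction N; simpl; [apply is_cderive_const|].
  apply (is_cderive_plus (fun z => csum (fun n => u n z) N) (u N)); [exact IHN|apply H].
Qed.

Lemma inv_pow64_le (n : nat) : / 64 ^ n <= / 2 ^ n.
Proof.
  apply Rinv_le_contravar; [apply pow_lt; lra|]. apply pow_incr; lra.
Qed.

Lemma inv_pow64_pos (n : nat) : 0 < / 64 ^ n.
Proof. apply Rinv_0_lt_compat, pow_lt; lra. Qed.

Section PeakSeries.

Variables (p : R) (a : nat -> C) (c : nat -> R).
Hypothesis Hp : 1 <= p.
Hypothesis Ha : forall n, unit_disc (a n).
Hypothesis Hc : forall n, Rabs (c n) = / 64 ^ n.

Definition peak_sum (N : nat) (z : C) : C :=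
  csum (fun m => RtoC (c m) * peak p (a m) z)%C N.

Definition peak_derive_sum (N : nat) (z : C) : C :=
  csum (fun m => RtoC (c m) * peak_derive p (a m) z)%C N.

Lemma is_cderive_peak_sum (N : nat) (z : C) :
  unit_disc z -> is_cderive (peak_sum N) z (peak_derive_sum N z).
Proof.
  intros Hz. apply (is_cderive_csum (fun m z => RtoC (c m) * peak p (a m) z)%C
    (fun m z => RtoC (c m) * peak_derive p (a m) z)%C).
  intros n. eapply is_cderive_eq.
  - apply (is_cderive_mult (fun _ => RtoC (c n)) (peak p (a n)));
      [apply is_cderive_const|apply is_cderive_peak; [apply Ha|exact Hz]].
  - cbv beta. cring.
Qed.

Lemma holomorphic_peak_sum (N : nat) : holomorphic (peak_sum N).
Proof. intros z Hz. eexists. apply is_cderive_peak_sum, Hz. Qed.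

Lemma peak_series_converges :
  exists f : C -> C, forall z, unit_disc z ->
    forall N, Cmod (peak_sum N z - f z) <= 4 * / (1 - Cmod z) ^ 2 * / 2 ^ N.
Proof.
  apply (functional_choice (fun z l => unit_disc z ->
    forall N, Cmod (peak_sum N z - l) <= 4 * / (1 - Cmod z) ^ 2 * / 2 ^ N)).
  (* Outside the disc any value serves as the limit. *)
  intros z. destruct (classic (unit_disc z)) as [Hz|Hz]; [|exists z; contradiction].
  destruct (geometric_cauchy_C (fun N => peak_sum N z) (/ (1 - Cmod z) ^ 2)) as [l Hl].
  - intros N. unfold peak_sum. cbn [csum].
    match goal with |- Cmod (?s + ?x - ?s)%C <= _ => replace (s + x - s)%C with x by cring end.
    rewrite Cmod_mult, Cmod_R, Hc, Rmult_comm.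
    apply Rmult_le_compat; [apply Cmod_ge_0|left; apply inv_pow64_pos| |apply inv_pow64_le].
    apply Cmod_peak_le; [exact Hp|apply Ha|exact Hz].
  - exists l. intros _. exact Hl.
Qed.

Variable f : C -> C.
Hypothesis Hf : forall z, unit_disc z ->
  forall N, Cmod (peak_sum N z - f z) <= 4 * / (1 - Cmod z) ^ 2 * / 2 ^ N.

Lemma peak_series_locally_uniform (rho : R) :
  0 <= rho < 1 -> exists D, forall z, Cmod z <= rho ->
    forall N, Cmod (peak_sum N z - f z) <= D * / 2 ^ N.
Proof.
  intros Hrho. exists (4 * / (1 - rho) ^ 2). intros z Hz N.
  eapply Rle_trans; [apply Hf; unfold unit_disc; lra|].
  apply Rmult_le_compat_r; [left; apply inv_pow2_pos|].
  apply Rmult_le_compat_l; [lra|]. apply Rinv_le_contravar; [apply pow_lt; lra|].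
  apply pow_incr. lra.
Qed.

(** On the circle of radius r the function is within 1 of some partial sum. How many terms this
    takes depends on r, but the p-th means of all partial sums have a common bound. *)
Lemma hardy_peak_series : hardy p f.
Proof.
  destruct (holomorphic_limit peak_sum f holomorphic_peak_sum peak_series_locally_uniform)
    as [Hhol _].
  assert (Hpi := two_PI_pos).
  apply hardy_RInt_iff; [lra|]. split; [exact Hhol|].
  set (K := Rpower 2 (2 * p - 2) * (2 * PI)).
  assert (HK : 0 < K) by (apply Rmult_lt_0_compat; [apply Rpower_pos|lra]).
  set (q := rpow 2 p). assert (Hq : 0 <= q) by apply rpow_ge_0.
  (* One factor q = 2^p comes from splitting off the error below 1, the other from [rpow_rsum_le]; 2
     bounds the sum of the weights 32^-n. *)
  exists (q * (q * (2 * K) + (2 * PI - 0) * 1)). intros r Hr.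
  destruct (peak_series_locally_uniform r ltac:(lra)) as [D HD].
  destruct (geometric_small D 1 Rlt_0_1) as [N HN].
  set (y := fun n t => rpow (Cmod (peak p (a n) (circle_pt r t))) p).
  destruct (RInt_rsum_le y (fun n => / 32 ^ n) 0 (2 * PI) K N) as [I [HI IK]].
  - intros n. left; apply Rinv_0_lt_compat, pow_lt; lra.
  - intros n. apply ex_RInt_mean_integrand; [lra| |lra].
    apply holomorphic_disc_continuous, holomorphic_peak, Ha.
  - intros n. apply RInt_peak_le; [exact Hp|apply Ha|exact Hr].
  - assert (I2 : is_RInt (fun t => q * (q * rsum (fun n => / 32 ^ n * y n t) N + 1)) 0 (2 * PI)
      (q * (q * I + (2 * PI - 0) * 1))).
    { apply is_RInt_Rscal, is_RInt_Rplus.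
      - apply is_RInt_Rscal, HI.
      - apply is_RInt_Rconst. }
    apply Rle_trans with (q * (q * I + (2 * PI - 0) * 1)).
    + apply (is_RInt_le (fun t => rpow (Cmod (f (circle_pt r t))) p)
        (fun t => q * (q * rsum (fun n => / 32 ^ n * y n t) N + 1)) 0 (2 * PI)); [lra| |exact I2|].
      * apply RInt_Rcorrect, ex_RInt_mean_integrand; [lra| |lra].
        apply holomorphic_disc_continuous, Hhol.
      * intros t _. set (z := circle_pt r t).
        assert (Hz : Cmod z = r) by (apply Cmod_circle_pt; lra).
        assert (H1 := HD z ltac:(lra) N).
        assert (H2 := Cmod_triangle_inv (f z) (peak_sum N z)). rewrite Cmod_minus_sym in H2.
        assert (H3 : Cmod (peak_sum N z) <= rsum (fun n => / 64 ^ n * Cmod (peak p (a n) z)) N).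
        { apply Cmod_csum_le. intros n. rewrite Cmod_mult, Cmod_R, Hc. lra. }
        assert (H4 := rpow_rsum_le p (fun n => Cmod (peak p (a n) z)) N Hp (fun n => Cmod_ge_0 _)).
        set (s := rsum (fun n => / 64 ^ n * Cmod (peak p (a n) z)) N) in *.
        assert (Hs : 0 <= s) by (eapply Rle_trans; [apply Cmod_ge_0|exact H3]).
        apply Rle_trans with (rpow (s + 1) p).
        -- apply rpow_le; [lra|]. split; [apply Cmod_ge_0|lra].
        -- eapply Rle_trans; [apply rpow_plus_le; lra|]. rewrite rpow_1_l.
           apply Rmult_le_compat_l; [exact Hq|]. apply Rplus_le_compat_r. exact H4.
    + apply Rmult_le_compat_l; [exact Hq|]. apply Rplus_le_compat_r.
      apply Rmult_le_compat_l; [exact Hq|]. eapply Rle_trans; [exact IK|].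
      apply Rmult_le_compat_r; [lra|]. apply rsum_inv_pow_le. lra.
Qed.

Hypothesis Hsign : forall n, / 64 ^ n * Cmod (peak_derive p (a n) (a n)) <=
  Cmod (peak_derive_sum (S n) (a n)).

(** At a_n the terms up to index n contribute at least 64^-n by the choice of signs, whatever the
    earlier peaks do there. The later ones contribute at most 16 (64^-(n+1) + 64^-(n+2) + ...) =
    (16/63) 64^-n, and 1 - 16/63 = 47/63 exceeds 1/2. *)
Lemma peak_series_derive_lower_bound (n : nat) :
  / 2 * / 64 ^ n <= Cmod (C_derive f (a n)) * Rpower (1 - Cmod (a n) ^ 2) (1 + / p).
Proof.
  destruct (holomorphic_limit peak_sum f holomorphic_peak_sum peak_series_locally_uniform)
    as [_ Hder].
  destruct (Hder (a n) (Ha n)) as [D HD].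
  set (W := Rpower (1 - Cmod (a n) ^ 2) (1 + / p)).
  assert (HW : 0 < W) by apply Rpower_pos.
  assert (Htail : forall j, Cmod (peak_derive_sum (S n + j) (a n) - peak_derive_sum (S n) (a n)) * W <=
    16 / 63 * (/ 64 ^ n - / 64 ^ (n + j))).
  { induction j.
    - rewrite !Nat.add_0_r.
      match goal with |- Cmod ?x * _ <= _ => replace x with (RtoC 0) by cring end.
      rewrite Cmod_0. lra.
    - replace (S n + S j)%nat with (S (S n + j)) by lia.
      replace (n + S j)%nat with (S (n + j)) by lia.
      unfold peak_derive_sum at 1. cbn [csum]. fold (peak_derive_sum (S n + j) (a n)).
      set (x := (RtoC (c (S n + j)%nat) * peak_derive p (a (S n + j)%nat) (a n))%C).
      replace (peak_derive_sum (S n + j) (a n) + x - peak_derive_sum (S n) (a n))%C with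
        ((peak_derive_sum (S n + j) (a n) - peak_derive_sum (S n) (a n)) + x)%C by cring.
      assert (Hx : Cmod x * W <= / 64 ^ S (n + j) * 16).
      { unfold x. rewrite Cmod_mult, Cmod_R, Hc, Rmult_assoc.
        apply Rmult_le_compat_l; [left; apply inv_pow64_pos|].
        apply Cmod_peak_derive_le; [exact Hp|apply Ha|apply Ha]. }
      assert (Ht := Cmod_triangle (peak_derive_sum (S n + j) (a n) - peak_derive_sum (S n) (a n)) x).
      apply (Rmult_le_compat_r W) in Ht; [|lra].
      assert (E : / 64 ^ (n + j) = 64 * / 64 ^ S (n + j)).
      { simpl. field. apply pow_nonzero; lra. }
      rewrite E in IHj. lra. }
  assert (Hdiag := Cmod_peak_derive_diag p (a n) Hp (Ha n)). fold W in Hdiag.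
  assert (Hn := inv_pow64_pos n).
  assert (Hmain : 47 / 63 * / 64 ^ n - Cmod (C_derive f (a n)) * W <= 0).
  { apply (le_0_of_geometric _ (D * / 2 ^ S n * W)). intros j.
    specialize (HD (S n + j)%nat). specialize (Htail j).
    rewrite (is_C_derive_unique _ _ _ (is_cderive_peak_sum (S n + j) (a n) (Ha n))) in HD.
    assert (Hs := Hsign n).
    set (A := peak_derive_sum (S n + j) (a n)) in *. set (B := peak_derive_sum (S n) (a n)) in *.
    set (F := C_derive f (a n)) in *.
    assert (HB : Cmod B <= Cmod (A - B) + Cmod (A - F) + Cmod F).
    { replace B with (- (A - B) + ((A - F) + F))%C by cring.
      eapply Rle_trans; [apply Cmod_triangle|]. rewrite Cmod_opp.
      replace (- (A - B) + (A - F + F))%C with B by cring.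
      assert (H := Cmod_triangle (A - F) F). lra. }
    apply (Rmult_le_compat_r W) in HB; [|lra].
    apply (Rmult_le_compat_r W) in HD; [|lra].
    apply (Rmult_le_compat_r W) in Hs; [|lra].
    apply (Rmult_le_compat_l (/ 64 ^ n)) in Hdiag; [|lra].
    rewrite pow_add, Rinv_mult in HD.
    assert (0 < / 64 ^ (n + j)) by apply inv_pow64_pos. lra. }
  lra.
Qed.

End PeakSeries.

(* Uniform boundedness: were k unbounded, say |k(a_n)| >= n 64^n, the series of
   64^-n times peaks at a_n, with suitable signs, would be a function in H^p
   whose derivative times k violates the growth bound for derivatives of H^p
   functions. *)
Lemma multiplier_bounded (p : R) (k : C -> C) :
  1 <= p ->
  (forall F, hardy p F -> exists h, hardy p h /\
     forall z, unit_disc z -> C_derive h z = (k z * C_derive F z)%C) ->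
  exists M, forall z, unit_disc z -> Cmod (k z) <= M.
Proof.
  intros Hp Hk. apply NNPP. intros Hunb.
  assert (Hex : forall n : nat, exists a, unit_disc a /\ INR n * 64 ^ n <= Cmod (k a)).
  { intros n. apply NNPP. intros H. apply Hunb. exists (INR n * 64 ^ n). intros z Hz.
    apply Rnot_lt_le. intros Hlt. apply H. exists z. split; [exact Hz|lra]. }
  apply functional_choice in Hex. destruct Hex as [a Ha'].
  assert (Ha := fun n => proj1 (Ha' n)). assert (Hka := fun n => proj2 (Ha' n)).
  destruct (sign_choice (fun n => / 64 ^ n) (fun m n => peak_derive p (a m) (a n))) as [c Hc'].
  assert (Hpos : forall n, Rabs (/ 64 ^ n) = / 64 ^ n)
    by (intros n; apply Rabs_pos_eq; left; apply inv_pow64_pos).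
  assert (Hc : forall n, Rabs (c n) = / 64 ^ n)
    by (intros n; rewrite <- Hpos; apply Hc').
  assert (Hsign : forall n, / 64 ^ n * Cmod (peak_derive p (a n) (a n)) <=
    Cmod (peak_derive_sum p a c (S n) (a n))).
  { intros n. rewrite <- Hpos. apply (Hc' n). }
  destruct (peak_series_converges p a c Hp Ha Hc) as [f Hf].
  assert (Hhf := hardy_peak_series p a c Hp Ha Hc f Hf).
  destruct (Hk f Hhf) as [h [Hh Hhd]].
  destruct (hardy_C_derive_bound p h Hp Hh) as [K HK].
  (* The growth bound caps |k(a_n)| |f'(a_n)| W by K 2^(1+1/p), the power of 2 coming from 1 - |a|^2
     <= 2 (1 - |a|). The choice of a_n and the lower bound for f' make the same product at least
     n/2. *)
  destruct (INR_unbounded (2 * (K * Rpower 2 (1 + / p)))) as [n Hn].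
  specialize (HK (a n) (Ha n)). rewrite (Hhd _ (Ha n)), Cmod_mult in HK.
  assert (Hlow := peak_series_derive_lower_bound p a c Hp Ha Hc f Hf Hsign n).
  specialize (Hka n).
  assert (Wa := one_minus_sqr_Cmod_bound (a n) (Ha n)).
  assert (Hip := inv_p_bound p Hp).
  set (W := Rpower (1 - Cmod (a n) ^ 2) (1 + / p)) in *.
  assert (HW : 0 < W) by apply Rpower_pos.
  set (X := Rpower (1 - Cmod (a n)) (- 1 - / p)) in *.
  assert (HX : 0 < X) by apply Rpower_pos.
  assert (HWX : X * W <= Rpower 2 (1 + / p)).
  { apply Rle_trans with (X * Rpower (2 * (1 - Cmod (a n))) (1 + / p)).
    - apply Rmult_le_compat_l; [lra|]. apply Rle_Rpower_l; lra.
    - rewrite <- Rpower_mult_distr by lra. unfold X.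
      replace (- 1 - / p) with (- (1 + / p)) by ring. rewrite Rpower_Ropp.
      right. field. apply Rgt_not_eq, Rpower_pos. }
  assert (Hk0 := Cmod_ge_0 (k (a n))). assert (Hf0 := Cmod_ge_0 (C_derive f (a n))).
  assert (HK0 : 0 <= K).
  { apply Rmult_le_reg_r with X; [exact HX|]. rewrite Rmult_0_l.
    eapply Rle_trans; [|exact HK]. apply Rmult_le_pos; assumption. }
  apply (Rmult_le_compat_r W) in HK; [|lra].
  assert (Hup : K * X * W <= K * Rpower 2 (1 + / p))
    by (rewrite Rmult_assoc; apply Rmult_le_compat_l; assumption).
  assert (H64 := inv_pow64_pos n).
  assert (Hdown : INR n * 64 ^ n * (/ 2 * / 64 ^ n) <=
    Cmod (k (a n)) * (Cmod (C_derive f (a n)) * W)).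
  { apply Rmult_le_compat; [|lra|exact Hka|exact Hlow].
    apply Rmult_le_pos; [apply pos_INR|left; apply pow_lt; lra]. }
  replace (INR n * 64 ^ n * (/ 2 * / 64 ^ n)) with (INR n / 2) in Hdown
    by (field; apply pow_nonzero; lra).
  lra.
Qed.

(** * Quotients of derivatives and the equivalence *)

Lemma holomorphic_quotient (f g : C -> C) :
  holomorphic f -> holomorphic g -> (forall z, unit_disc z -> g z <> RtoC 0) ->
  holomorphic (fun z => f z / g z)%C.
Proof.
  intros Hf Hg Hn z Hz. eexists.
  apply (is_cderive_mult f (fun w => / g w)%C).
  - apply holomorphic_is_cderive; assumption.
  - apply is_cderive_inv; [apply holomorphic_is_cderive; assumption|apply Hn, Hz].
Qed.

(** Since h' has no zero, each F in H^p yields the test function f = F'/h' of the optimal domain of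
    h. The inclusion puts T g f in H^p, and its derivative is g'/h' times F'; so g'/h' acts as a
    multiplier on derivatives. *)
Lemma derivative_quotient_bounded (p : R) (g h : C -> C) :
  1 <= p -> holomorphic g -> locally_univalent h ->
  (forall f, optimal_domain h p f -> optimal_domain g p f) ->
  hardy_infty (fun z => C_derive g z / C_derive h z)%C.
Proof.
  intros Hp Hg [Hh Hn] Hincl.
  assert (Hh' := holomorphic_C_derive h Hh).
  split; [apply holomorphic_quotient; [apply holomorphic_C_derive, Hg|exact Hh'|exact Hn]|].
  apply (multiplier_bounded p); [exact Hp|]. intros F HF.
  assert (HFh : holomorphic F) by apply HF.
  set (f := fun z => (C_derive F z / C_derive h z)%C).
  assert (Hf : holomorphic f)
    by (apply holomorphic_quotient; [apply holomorphic_C_derive, HFh|exact Hh'|exact Hn]).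
  exists (T g f). split.
  - apply Hincl. split; [exact Hf|].
    (* T h f and F have the same derivative, so subordination with equality replaces an argument
       about their constant difference. *)
    apply (hardy_subordinate p F); [exact Hp|apply holomorphic_T; assumption| |exact HF].
    intros z Hz. right.
    rewrite (is_C_derive_unique _ z _ (is_cderive_T h f z Hf Hh Hz)).
    apply f_equal. unfold f. cfield. apply Hn, Hz.
  - intros z Hz. rewrite (is_C_derive_unique _ z _ (is_cderive_T g f z Hf Hg Hz)).
    unfold f. cfield. apply Hn, Hz.
Qed.

Lemma derivative_quotient_representation (g h : C -> C) :
  holomorphic g -> locally_univalent h ->
  forall z, unit_disc z ->
    g z = (T h (fun w => C_derive g w / C_derive h w) z + g (RtoC 0))%C.
Proof.
  intros Hg [Hh Hn] z Hz.
  rewrite (T_primitive h (fun w => C_derive g w / C_derive h w)%C g); try assumption.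
  - cring.
  - apply holomorphic_quotient; [apply holomorphic_C_derive, Hg|apply holomorphic_C_derive, Hh|exact Hn].
  - intros w Hw. eapply is_cderive_eq; [apply holomorphic_is_cderive; assumption|].
    cfield. apply Hn, Hw.
Qed.

Theorem corollary5p4 :
  forall (p : R) (g1 g2 : C -> C),
    1 <= p ->
    BMOA g1 -> BMOA g2 ->
    nonconstant g1 -> nonconstant g2 ->
    locally_univalent g1 -> locally_univalent g2 ->
    let representable (k1 k2 : C -> C) :=
      hardy_infty k1 /\ hardy_infty k2 /\
      (forall z : C, unit_disc z -> g1 z = (T g2 k1 z + g1 0)%C) /\
      (forall z : C, unit_disc z -> g2 z = (T g1 k2 z + g2 0)%C) in
    ((forall f : C -> C, optimal_domain g1 p f <-> optimal_domain g2 p f)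
     <-> (exists k1 k2 : C -> C, representable k1 k2)) /\
    (forall k1 k2 : C -> C, representable k1 k2 ->
       forall z : C, unit_disc z -> k1 z <> 0%C /\ k2 z = (1 / k1 z)%C).
Proof.
  intros p g1 g2 Hp _ _ _ _ Hg1 Hg2 representable.
  assert (H1 : holomorphic g1) by apply Hg1. assert (H2 : holomorphic g2) by apply Hg2.
  split; [split|].
  - intros Heq.
    exists (fun z => C_derive g1 z / C_derive g2 z)%C, (fun z => C_derive g2 z / C_derive g1 z)%C.
    split; [|split; [|split]].
    + exact (derivative_quotient_bounded p g1 g2 Hp H1 Hg2 (fun f => proj2 (Heq f))).
    + exact (derivative_quotient_bounded p g2 g1 Hp H2 Hg1 (fun f => proj1 (Heq f))).
    + apply derivative_quotient_representation; assumption.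
    + apply derivative_quotient_representation; assumption.
  - intros [k1 [k2 [K1 [K2 [E1 E2]]]]] f. split.
    + apply (optimal_domain_incl p g1 g2 k2 Hp H1 H2 K2). intros z.
      apply (C_derive_of_T_representation g2 g1 k2 (g2 (RtoC 0)) z (proj1 K2) H1 E2).
    + apply (optimal_domain_incl p g2 g1 k1 Hp H2 H1 K1). intros z.
      apply (C_derive_of_T_representation g1 g2 k1 (g1 (RtoC 0)) z (proj1 K1) H2 E1).
  - intros k1 k2 [K1 [K2 [E1 E2]]].
    exact (representation_inverse g1 g2 k1 k2 _ _ (proj1 K1) (proj1 K2) Hg1 Hg2 E1 E2).
Qed.
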